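(* Let $n\in\mathbb{N}$, let $\Omega$ be an infinite set, let $M:\mathbb{R}_{\geq 1}\to\mathbb{R}_{\geq 0}$ be a function, and for every $B\in\mathbb{R}_{\geq 1}$ let $\chi_B:\Omega\to\mathbb{R}_{\geq 0}$ be a function such that $\{a\in\Omega:\chi_B(a)>0\}$ is finite for every $B\geq 1$, and $$\lim_{B\to+\infty}\sum_{a\in\Omega}\chi_B(a)=+\infty,\qquad\lim_{B\to+\infty}\frac{\sum_{a\in\Omega}\chi_B(a)}{M(B)}=1.$$ Let $m=(m_1,\ldots,m_n):\Omega\to\mathbb{N}^n$ be a function and $A\in\mathbb{R}$ a real number such that for all $\mathbf{d}\in\mathbb{N}^n$ with $p\mid d_1\cdots d_n\Rightarrow p>A$ the limit $$g(\mathbf{d}):=\lim_{B\to+\infty}\frac{1}{M(B)}\sum_{\substack{a\in\Omega\\ d_i\mid m_i(a)\ \forall 1\leq i\leq n}}\chi_B(a)$$ exists; extend $g$ to $\mathbb{N}^n$ by $g(\mathbf{d})=0$ if $d_1\cdots d_n$ has a prime factor $p\leq A$, and assume that $g$ is multiplicative, i.e. $g(a_1b_1,\ldots,a_nb_n)=g(\mathbf{a})g(\mathbf{b})$ whenever $\gcd(a_1\cdots a_n,b_1\cdots b_n)=1$. Let $\theta_1,\ldots,\theta_n$ be real-valued functions on the primes and $\Theta\in\mathbb{R}$ with $|\theta_i(p)|\leq\Theta$ for all $1\leq i\leq n$ and all primes $p$, and assume that $\lim_{T\to+\infty}\mathcal{V}_i(T)=+\infty$ for all $i=1,\ldots,n$.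 Assume that there exists a truncation pair $(\mathcal{F},\psi)$, and that for every $1\leq i,j\leq n$ the following limit exists: $$\sigma_{i,j}:=\lim_{T\to+\infty}\frac{\sum_{p\leq T}\theta_i(p)\theta_j(p)\left(g_{\{i,j\}}(p)-g_i(p)g_j(p)\right)}{\mathcal{V}_i(T)\mathcal{V}_j(T)}.$$ Then the random vectors $(\Omega,\mathbf{P}_B)\to\mathbb{R}^n$, $a\mapsto\mathbf{K}(a)$, where $$\mathbf{K}(a):=\left(\frac{\left(\sum_{p\mid m_1(a)}\theta_1(p)\right)-\mathcal{M}_1(m_1(a))}{\mathcal{V}_1(m_1(a))},\ldots,\frac{\left(\sum_{p\mid m_n(a)}\theta_n(p)\right)-\mathcal{M}_n(m_n(a))}{\mathcal{V}_n(m_n(a))}\right),$$ converge in distribution as $B\to\infty$ to a central multivariate normal distribution with covariance matrix $\boldsymbol{\Sigma}$ whose $(i,j)$-entry is $\sigma_{i,j}$.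
   Context: $\mathbb{N}$ is the set of positive integers; $p$ always denotes a prime; $\mu$ is the Möbius function; $\omega(m)$ is the number of distinct primes dividing $m$. $\mathbf{P}_B$ is the probability measure on $\Omega$ (discrete $\sigma$-algebra) given by $\mathbf{P}_B[S]=\sum_{a\in S}\chi_B(a)/\sum_{a\in\Omega}\chi_B(a)$. For $S\subset\{1,\ldots,n\}$ and $b\in\mathbb{N}$, $g_S(b)$ is the value of $g$ at the vector with $b$ in each position $i\in S$ and $1$ in the other positions; $g_i:=g_{\{i\}}$. For $T\geq 0$ and $1\leq i\leq n$, $$\mathcal{M}_i(T):=\sum_{p\leq T}\theta_i(p)g_i(p),\qquad\mathcal{V}_i(T):=\Big(\sum_{p\leq T}\theta_i(p)^2g_i(p)(1-g_i(p))\Big)^{1/2}.$$ If $\mathcal{V}_i(m_i(a))=0$, then by convention the $i$-th entry of $\mathbf{K}(a)$ is $1$. For $\mathbf{d}\in\mathbb{N}^n$, $$\mathcal{R}(\mathbf{d},B):=\Big(\sum_{\substack{a\in\Omega\\ d_i\mid m_i(a)\ \forall 1\leq i\leq n}}\chi_B(a)\Big)-g(\mathbf{d})M(B).$$ A truncation pair is a pair of functions $\mathcal{F}:\mathbb{R}_{\geq 0}\to\mathbb{R}$, $\psi:\mathbb{R}\to(0,1]$ satisfying all of the following (for every $1\leq i\leq n$ where relevant), where $\Rightarrow$ denotes convergence in distribution as $B\to\infty$ of random variables in $a\in(\Omega,\mathbf{P}_B)$: (i) $\displaystyle\lim_{B\to+\infty}\frac{1}{\sum_{a\in\Omega}\chi_B(a)}\sum_{\substack{a\in\Omega\\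 m_i(a)\leq\mathcal{F}(B)\ \forall i}}\chi_B(a)=1$; (ii) $\lim_{B\to+\infty}\mathcal{F}(B)^{\psi(B)}=+\infty$; (iii) $\displaystyle\lim_{B\to+\infty}\frac{1}{\psi(B)\,\mathcal{V}_i(\mathcal{F}(B)^{\psi(B)})}=0$ and $\displaystyle\frac{\mathcal{M}_i(m_i(a))-\mathcal{M}_i(\mathcal{F}(B)^{\psi(B)})}{\mathcal{V}_i(\mathcal{F}(B)^{\psi(B)})}\Rightarrow 0$; (iv) $\displaystyle\frac{\mathcal{V}_i(m_i(a))}{\mathcal{V}_i(\mathcal{F}(B)^{\psi(B)})}\Rightarrow 1$; (v) for every $k_1,\ldots,k_n\in\mathbb{N}$, $$\lim_{B\to+\infty}\frac{\prod_{i=1}^n\left(|\mathcal{M}_i(\mathcal{F}(B)^{\psi(B)})|+\Theta\right)^{k_i}}{M(B)\prod_{i=1}^n\mathcal{V}_i(\mathcal{F}(B)^{\psi(B)})^{k_i}}\sum_{\mathbf{d}}\Big(g(\mathbf{d})\,|\mathcal{R}((1,\ldots,1),B)|+|\mathcal{R}(\mathbf{d},B)|\Big)=0,$$ where the sum is over $\mathbf{d}\in\mathbb{N}^n$ such that $p\mid d_1\cdots d_n\Rightarrow A<p\leq\mathcal{F}(B)^{\psi(B)}$, and $\mu(d_i)^2=1$ and $\omega(d_i)\leq k_i$ for all $1\leq i\leq n$. A central multivariate normal distribution has zero mean vector; its covariance matrix is allowed to be singular (a random vector is multivariate normal if every linear combination of its coordinates is univariate normal, a Dirac mass counting as normal of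 variance $0$). *)

(* Defs.v *)
From HB Require Import structures.
From mathcomp Require Import all_boot all_order all_algebra.
From mathcomp Require Import all_classical all_reals all_analysis.

Set Implicit Arguments.
Unset Strict Implicit.
Unset Printing Implicit Defensive.

Import Order.TTheory GRing.Theory Num.Theory.
Import numFieldNormedType.Exports.

Local Open Scope classical_set_scope.
Local Open Scope ring_scope.

Definition omega (d : nat) : nat := size (primes d).

Definition moebius (d : nat) : int :=
  if all (fun p => ~~ (p ^ 2 %| d)%N) (primes d) then (-1) ^+ omega d else 0.

(* The set of n-tuples of positive integers is encoded as the
   [d : {ffun 'I_n -> nat}] satisfying [pos_vec d]. *)

Definition pos_vec (n : nat) (d : {ffun 'I_n -> nat}) : Prop :=
  forall i, (0 < d i)%N.

Definition ones (n : nat) : {ffun 'I_n -> nat} := [ffun=> 1%N].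

Definition vprod (n : nat) (d : {ffun 'I_n -> nat}) : nat :=
  (\prod_(i < n) d i)%N.

Definition vmul (n : nat) (a b : {ffun 'I_n -> nat}) : {ffun 'I_n -> nat} :=
  [ffun i => (a i * b i)%N].

Definition primes_above (R : realType) (n : nat) (A : R)
    (d : {ffun 'I_n -> nat}) : Prop :=
  forall p, prime p -> (p %| vprod d)%N -> A < p%:R.

Definition multiplicative_vec (R : realType) (n : nat)
    (g : {ffun 'I_n -> nat} -> R) : Prop :=
  forall a b, pos_vec a -> pos_vec b -> coprime (vprod a) (vprod b) ->
    g (vmul a b) = g a * g b.

Definition g_at (R : realType) (n : nat) (g : {ffun 'I_n -> nat} -> R)
    (S : {set 'I_n}) (b : nat) : R :=
  g [ffun i => if i \in S then b else 1%N].

(* [chi B] vanishes outside a finite set for [1 <= B], so the finitely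
   supported sums over subsets of [Omega] are the actual sums, and [expect] is
   the integral against the discrete measure [prob chi B]. *)

Definition prob (R : realType) (Omega : choiceType) (chi : R -> Omega -> R)
    (B : R) (S : set Omega) : R :=
  (\sum_(a \in S) chi B a) / (\sum_(a \in [set: Omega]) chi B a).

Definition expect (R : realType) (Omega : choiceType) (chi : R -> Omega -> R)
    (B : R) (f : Omega -> R) : R :=
  \sum_(a \in [set: Omega]) prob chi B [set a] * f a.

Definition mass (R : realType) (Omega : choiceType) (n : nat)
    (chi : R -> Omega -> R) (m : Omega -> {ffun 'I_n -> nat})
    (d : {ffun 'I_n -> nat}) (B : R) : R :=
  \sum_(a \in [set a | forall i, (d i %| m a i)%N]) chi B a.

Definition remainder (R : realType) (Omega : choiceType) (n : nat)
    (M : R -> R) (chi : R -> Omega -> R) (m : Omega -> {ffun 'I_n -> nat})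
    (g : {ffun 'I_n -> nat} -> R) (d : {ffun 'I_n -> nat}) (B : R) : R :=
  mass chi m d B - g d * M B.

Definition borel (V : ptopologicalType) := g_sigma_algebraType (@open V).

Definition cvg_in_distribution (R : realType) (Omega : choiceType)
    (V : ptopologicalType) (chi : R -> Omega -> R) (X : R -> Omega -> V)
    (mu : probability (borel V) R) : Prop :=
  forall f : V -> R, continuous f -> (exists C, forall x, `|f x| <= C) ->
    expect chi B (fun a => f (X B a)) @[B --> +oo] --> \int[mu]_x f x.

Definition cvg_in_distribution_cst (R : realType) (Omega : choiceType)
    (chi : R -> Omega -> R) (X : R -> Omega -> R) (c : R) : Prop :=
  cvg_in_distribution chi X (@dirac _ (borel R) c R).

(* [s] is the standard deviation. In the library [normal_prob m 0] is not the
   Dirac mass at [m]. *)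
Definition normal_law (R : realType) (m s : R) (A : set R) : \bar R :=
  if s == 0 then \d_m A else normal_prob m s A.

Definition multivariate_normal (R : realType) (n : nat)
    (mu : probability (borel 'rV[R]_n) R) : Prop :=
  forall c : 'rV[R]_n, exists m s : R, 0 <= s /\
    forall A : set R, measurable A ->
      mu [set x : 'rV[R]_n | A (\sum_(i < n) c 0 i * x 0 i)]
      = normal_law m s A.

Definition central_multivariate_normal (R : realType) (n : nat)
    (Sigma : 'M[R]_n) (mu : probability (borel 'rV[R]_n) R) : Prop :=
  [/\ multivariate_normal mu,
      forall i : 'I_n, ('E_mu[(fun x : 'rV[R]_n => x 0%R i)] = 0)%E
    & forall i j : 'I_n,
        covariance mu (fun x : 'rV[R]_n => x 0 i) (fun x : 'rV[R]_n => x 0 j)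
        = (Sigma i j)%:E].

(* For [T < 0] the range of the sums over p <= T contains no prime. *)
Definition mean (R : realType) (n : nat) (theta : 'I_n -> nat -> R)
    (g : {ffun 'I_n -> nat} -> R) (i : 'I_n) (T : R) : R :=
  \sum_(0 <= p < (Num.truncn T).+1 | prime p) theta i p * g_at g [set i] p.

Definition stdev (R : realType) (n : nat) (theta : 'I_n -> nat -> R)
    (g : {ffun 'I_n -> nat} -> R) (i : 'I_n) (T : R) : R :=
  Num.sqrt (\sum_(0 <= p < (Num.truncn T).+1 | prime p)
    theta i p ^+ 2 * g_at g [set i] p * (1 - g_at g [set i] p)).

Definition correlation (R : realType) (n : nat) (theta : 'I_n -> nat -> R)
    (g : {ffun 'I_n -> nat} -> R) (i j : 'I_n) (T : R) : R :=
  (\sum_(0 <= p < (Num.truncn T).+1 | prime p) theta i p * theta j p *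
     (g_at g [set i; j] p - g_at g [set i] p * g_at g [set j] p))
  / (stdev theta g i T * stdev theta g j T).

Definition K (R : realType) (Omega : choiceType) (n : nat)
    (m : Omega -> {ffun 'I_n -> nat}) (theta : 'I_n -> nat -> R)
    (g : {ffun 'I_n -> nat} -> R) (a : Omega) : 'rV[R]_n :=
  \row_(i < n)
    if stdev theta g i (m a i)%:R == 0 then 1 else
    ((\sum_(p <- primes (m a i)) theta i p) - mean theta g i (m a i)%:R)
    / stdev theta g i (m a i)%:R.

Definition trunc_vecs (R : realType) (n : nat) (A y : R) (k : 'I_n -> nat) :
    set {ffun 'I_n -> nat} :=
  [set d | [/\ pos_vec d,
      forall p, prime p -> (p %| vprod d)%N -> A < p%:R <= y
    & forall i, moebius (d i) ^+ 2 = 1 /\ (omega (d i) <= k i)%N]].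

(* For [F B < 0] the value of [F B `^ psi B] is irrelevant: [trunc_bounded]
   forces [1 <= F B] for all large [B], since [m] has positive entries. *)
Record truncation_pair (R : realType) (Omega : choiceType) (n : nat)
    (M : R -> R) (chi : R -> Omega -> R) (m : Omega -> {ffun 'I_n -> nat})
    (A : R) (g : {ffun 'I_n -> nat} -> R) (theta : 'I_n -> nat -> R)
    (Theta : R) (F psi : R -> R) : Prop := TruncationPair {
  trunc_psi : forall B, 0 < psi B <= 1;
  trunc_bounded :
    prob chi B [set a | forall i, (m a i)%:R <= F B] @[B --> +oo] --> (1 : R);
  trunc_level : F B `^ psi B @[B --> +oo] --> +oo;
  trunc_stdev : forall i,
    1 / (psi B * stdev theta g i (F B `^ psi B)) @[B --> +oo] --> (0 : R);
  trunc_mean : forall i,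
    cvg_in_distribution_cst chi (fun B a =>
      (mean theta g i (m a i)%:R - mean theta g i (F B `^ psi B))
      / stdev theta g i (F B `^ psi B)) 0;
  trunc_stdev_ratio : forall i,
    cvg_in_distribution_cst chi (fun B a =>
      stdev theta g i (m a i)%:R / stdev theta g i (F B `^ psi B)) 1;
  trunc_remainder : forall k : 'I_n -> nat, (forall i, (0 < k i)%N) ->
    (\prod_(i < n) (`|mean theta g i (F B `^ psi B)| + Theta) ^+ k i)
    / (M B * \prod_(i < n) stdev theta g i (F B `^ psi B) ^+ k i)
    * (\sum_(d \in trunc_vecs A (F B `^ psi B) k)
         (g d * `|remainder M chi m g (ones n) B|
          + `|remainder M chi m g d B|)) @[B --> +oo] --> (0 : R) }.

(* Main.v *)
(* Let y = F(B)^psi(B), let W_i be the sum of theta_i over the primes of (A, y]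
   dividing m_i, centered by mean_i(y) and divided by stdev_i(y), and let X be
   the same statistic for a model in which the primes of (A, y] behave
   independently, the set of indices i with p | m_i having the limiting
   densities prescribed by g.
   - Expanding products of coordinates of W over incidence patterns and using
     condition (v), every mixed moment of W in which all indices occur agrees
     asymptotically with that of X. Condition (v) gives nothing for the moments
     that miss an index, so the comparison is done for expectations weighted by
     rho(x) = prod_i x_i^2: the Taylor polynomials of cos and sin transfer it to
     the weighted characteristic functions, and hence to weighted bounded
     continuous functions.
   - The characteristic function of X converges to that of the normal law with
     covariance Sigma. As Sigma_ii = 1, this law gives small mass to the
     neighbourhoods of the coordinate hyperplanes, where rho is small, so the
     weight can be removed and W converges to the same law.
   - K - W tends to 0 in probability: at most 1/psi primes above y divide an
     integer m_i <= F, and boundedly many primes are at most A. *)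

From HB Require Import structures.
Require Import Defs.
From mathcomp Require Import all_boot all_order all_algebra.
From mathcomp Require Import complex.
From mathcomp Require Import all_classical all_reals all_analysis.
From mathcomp Require Import measurable_realfun.
From mathcomp Require Import ring lra.
Import Order.TTheory GRing.Theory Num.Theory.
Import numFieldNormedType.Exports.
Local Open Scope classical_set_scope.
Local Open Scope ring_scope.
Set Implicit Arguments.
Unset Strict Implicit.
Unset Printing Implicit Defensive.

(** * Taylor estimates *)

(** Convergence is proved by an explicit comparison of functionals. On a box a bounded continuous
    function is approximated by a trigonometric polynomial with the same bound on the whole space,
    and the error off the box is paid by a tail functional. Total mass 1 is not part of the
    argument, so the comparison serves both the model against the Gaussian law and the expectations
    weighted by [rho]. The obstacle in the moment step is that nothing bounds exponential moments of
    W as B grows. The model has such bounds, by independence and boundedness of [theta]. The Taylor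
    remainder multiplied by [rho] is again a mixed moment in which all indices occur, so its
    smallness passes from the model to W; the Taylor degree is fixed before B grows. The model
    exists because inclusion-exclusion turns [g] into limiting frequencies of exact incidence
    patterns, which are limits of nonnegative quotients. Its variances show that Sigma is positive
    semidefinite. As Sigma may be singular, the limit law is built as a linear image of independent
    normal variables. *)

Lemma is_derive_exprn (R : realType) (k : nat) (x : R) :
  is_derive x 1 (fun y : R => y ^+ k) (k%:R * x ^+ k.-1).
Proof.
have := @is_deriveX R R (fun y => y) k x 1 1 (is_derive_id x 1).
have -> : (fun y : R => y) ^+ k = (fun y : R => y ^+ k).
  by apply/funext => y; elim: k => [|k IH]; rewrite ?expr0// !exprS -IH.
by rewrite /GRing.scale/= mulr1.
Qed.

(** Both [h + f] and [h - f] vanish at 0 and have a nonnegative derivative on the half-line, hence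
    stay nonnegative there. *)
Lemma abs_le_of_derive (R : realType) (f h df dh : R -> R) :
  (forall x : R, is_derive x 1 f (df x)) ->
  (forall x : R, is_derive x 1 h (dh x)) ->
  f 0 = 0 -> h 0 = 0 -> (forall x, 0 <= x -> `|df x| <= dh x) ->
  forall x, 0 <= x -> `|f x| <= h x.
Proof.
move=> Df Dh f0 h0 le x x0.
have ndec (u du : R -> R) : (forall x : R, is_derive x 1 u (du x)) -> u 0 = 0 ->
    (forall x, 0 <= x -> 0 <= du x) -> 0 <= u x.
  move=> Du u0 du0; have D (y : R) : derivable u y 1 by have [] := Du y.
  have C : {within `[0, +oo[, continuous u}.
    by apply: continuous_subspaceT => y; exact/differentiable_continuous/derivable1_diffP.
  rewrite -u0; apply: (ger0_derive1_ndecry _ _ C) => // y.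
  rewrite in_itv/= andbT => y0; rewrite derive1E.
  by have [_ ->] := Du y; apply: du0; exact: ltW.
rewrite ler_norml; apply/andP; split.
  rewrite -subr_ge0 opprK.
  apply: (ndec (f + h) (fun x => df x + dh x)).
  - by rewrite fctE f0 h0 addr0.
  - move=> y y0; have := le _ y0; rewrite ler_norml => /andP[+ _].
    by rewrite lerNl -subr_ge0 opprK addrC.
rewrite -subr_ge0.
apply: (ndec (h - f) (fun x => dh x - df x)).
- by rewrite !fctE f0 h0 subr0.
- by move=> y y0; have := le _ y0; rewrite ler_norml subr_ge0 => /andP[].
Qed.

(** Here [k] counts the nonzero terms of the Taylor polynomial, so that [sinT k] differentiates to
    [cosT k] and [cosT k.+1] to [- sinT k]. *)
Fixpoint cosT (R : realType) (k : nat) (x : R) : R :=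
  if k is j.+1 then cosT j x + (-1) ^+ j / (j.*2)`!%:R * x ^+ j.*2 else 0.

Fixpoint sinT (R : realType) (k : nat) (x : R) : R :=
  if k is j.+1 then sinT j x + (-1) ^+ j / (j.*2.+1)`!%:R * x ^+ j.*2.+1 else 0.

Lemma is_derive_monomial (R : realType) (c : R) (k : nat) (x : R) :
  is_derive x 1 (fun y : R => c / (k.+1)`!%:R * y ^+ k.+1) (c / k`!%:R * x ^+ k).
Proof.
have D := @is_derive_exprn R k.+1 x.
apply: is_derive_eq.
rewrite /GRing.scale/= ?scaler0 ?add0r ?addr0 ?mulr0 ?mulr1.
rewrite factS natrM; have := fact_gt0 k.
rewrite -(ltr0n R) => /lt0r_neq0 fk; field; rewrite fk/=.
by rewrite addrC natr1 pnatr_eq0.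
Qed.

Lemma is_derive_sinT (R : realType) (k : nat) (x : R) :
  is_derive x 1 (sinT k : R -> R) (cosT k x).
Proof.
elim: k => [|k IH] /=; first exact: is_derive_cst.
by apply: is_deriveD; exact: is_derive_monomial.
Qed.

Lemma is_derive_cosT (R : realType) (k : nat) (x : R) :
  is_derive x 1 (cosT k.+1 : R -> R) (- sinT k x).
Proof.
elim: k => [|k IH] /=.
  rewrite oppr0 (_ : (fun _ => _) = cst (0 + (-1) ^+ 0 / 0`!%:R * 1)); last by [].
  exact: is_derive_cst.
rewrite opprD.
have -> : - ((-1) ^+ k / (k.*2.+1)`!%:R * x ^+ k.*2.+1) =
   (-1) ^+ k.+1 / (k.*2.+1)`!%:R * x ^+ k.*2.+1.
  by rewrite [(-1) ^+ k.+1]exprS !mulN1r !mulNr.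
by apply: is_deriveD; exact: is_derive_monomial.
Qed.

Lemma cosT0 (R : realType) k : cosT k.+1 (0 : R) = 1.
Proof.
elim: k => [|k /= ->]; first by rewrite /= fact0 expr0 divr1 mulr1 add0r.
by rewrite expr0n doubleS mulr0 addr0.
Qed.

Lemma sinT0 (R : realType) k : sinT k (0 : R) = 0.
Proof.
elim: k => [//|k /= ->]; by rewrite expr0n mulr0 addr0.
Qed.

(** Each bound integrates the previous one, alternating between sine and cosine. The exponent [e] of
    the starting bound is kept free: [e = 0] uses that sine is at most 1, [e = 1] that it is at most
    its argument, and together they give remainders of both parities. *)
Lemma cos_sin_taylor (R : realType) (e k : nat) (x : R) :
  (forall y : R, 0 <= y -> `|sin y| <= y ^+ e / e`!%:R) -> 0 <= x ->
  `|sin x - sinT k x| <= x ^+ (e + k.*2) / (e + k.*2)`!%:R /\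
  `|cos x - cosT k.+1 x| <= x ^+ (e + k.*2).+1 / ((e + k.*2).+1)`!%:R.
Proof.
move=> base.
have mono j (y : R) : is_derive y 1 (fun y : R => y ^+ j.+1 / (j.+1)`!%:R) (y ^+ j / j`!%:R).
  have := @is_derive_monomial R 1 j y.
  rewrite !div1r mulrC; congr is_derive.
  by apply/funext => z; rewrite mulrC.
have sc j : (forall x : R, 0 <= x -> `|sin x - sinT j x| <= x ^+ (e + j.*2) / (e + j.*2)`!%:R) ->
   forall x : R, 0 <= x -> `|cos x - cosT j.+1 x| <= x ^+ (e + j.*2).+1 / ((e + j.*2).+1)`!%:R.
  have D (y : R) : is_derive y 1 (cos - cosT j.+1 : R -> R) (- sin y - (- sinT j y)).
    by apply: is_deriveB; exact: is_derive_cosT.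
  move=> H; apply: (abs_le_of_derive D (mono (e + j.*2))).
  - by rewrite !fctE cos0 cosT0 subrr.
  - by rewrite expr0n mul0r.
  - by move=> y y0; rewrite -opprD normrN; exact: H.
have cs j : (forall x : R, 0 <= x -> `|cos x - cosT j.+1 x| <= x ^+ (e + j.*2).+1 / ((e + j.*2).+1)`!%:R) ->
   forall x : R, 0 <= x -> `|sin x - sinT j.+1 x| <= x ^+ (e + j.+1.*2) / (e + j.+1.*2)`!%:R.
  have D (y : R) : is_derive y 1 (sin - sinT j.+1 : R -> R) (cos y - cosT j.+1 y).
    by apply: is_deriveB; exact: is_derive_sinT.
  rewrite doubleS !addnS; move=> H; apply: (abs_le_of_derive D (mono (e + j.*2).+1)).
  - by rewrite !fctE sin0 sinT0 subrr.
  - by rewrite expr0n mul0r.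
  - by move=> y y0; exact: H.
suff H : forall j, forall x : R, 0 <= x -> `|sin x - sinT j x| <= x ^+ (e + j.*2) / (e + j.*2)`!%:R.
  by move=> x0; split; [exact: H|apply: sc => //; exact: H].
elim=> [y y0|j IH]; last by apply: cs; exact: sc.
by rewrite subr0 addn0; exact: base.
Qed.

Lemma cosTN (R : realType) k (x : R) : cosT k (- x) = cosT k x.
Proof.
elim: k => [//|k /= ->]; congr (_ + _ * _).
by rewrite -!mul2n !exprM sqrrN.
Qed.

Lemma sinTN (R : realType) k (x : R) : sinT k (- x) = - sinT k x.
Proof.
elim: k => [|k /= ->]; first by rewrite oppr0.
by rewrite opprD -mulrN; congr (_ + _ * _); rewrite !exprSr -!mul2n !exprM sqrrN mulrN.
Qed.

Lemma norm_sin_le (R : realType) (y : R) : 0 <= y -> `|sin y| <= y ^+ 1 / 1`!%:R.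
Proof.
rewrite divr1; apply: (@abs_le_of_derive R sin id cos (fun=> 1)).
- by rewrite sin0.
- by [].
- by move=> x _; rewrite ler_norml cos_geN1 cos_le1.
Qed.

Lemma cos_taylor (R : realType) (k : nat) (x : R) :
  `|cos x - cosT k x| <= `|x| ^+ k.*2 / (k.*2)`!%:R.
Proof.
case: k => [|k]; first by rewrite subr0 expr0 divr1 ler_norml cos_geN1 cos_le1.
wlog x0 : x / 0 <= x.
  move=> H; have [/H//|/ltW x0] := leP 0 x.
  by rewrite -cosN -cosTN -(normrN x); apply: H; rewrite oppr_ge0.
by rewrite (ger0_norm x0); have [] := cos_sin_taylor k (@norm_sin_le R) x0.
Qed.

Lemma sin_taylor (R : realType) (k : nat) (x : R) :
  `|sin x - sinT k x| <= `|x| ^+ k.*2 / (k.*2)`!%:R.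
Proof.
wlog x0 : x / 0 <= x.
  move=> H; have [/H//|/ltW x0] := leP 0 x.
  by rewrite -normrN opprD -sinN -sinTN -(normrN x); apply: H; rewrite oppr_ge0.
rewrite (ger0_norm x0).
have [] // := @cos_sin_taylor R 0 k x _ x0.
by move=> y _; rewrite expr0 divr1 ler_norml sin_geN1 sin_le1.
Qed.

Lemma sin_taylor_odd (R : realType) (k : nat) (x : R) :
  `|sin x - sinT k x| <= `|x| ^+ k.*2.+1 / (k.*2.+1)`!%:R.
Proof.
wlog x0 : x / 0 <= x.
  move=> H; have [/H//|/ltW x0] := leP 0 x.
  by rewrite -normrN opprD -sinN -sinTN -(normrN x); apply: H; rewrite oppr_ge0.
by rewrite (ger0_norm x0); have [] := cos_sin_taylor k (@norm_sin_le R) x0.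
Qed.

(** From [1 - x <= expR (- x)] one gets [(1 - x) * expR x <= 1], while [(1 - x) * (1 + x + 2 * x ^+
    2) = 1 + x ^+ 2 * (1 - 2 * x)] is at least 1 when [x <= 1 / 2]. *)
Lemma expR_le_quad (R : realType) (x : R) : `|x| <= 1 / 2 ->
  expR x <= 1 + x + 2 * x ^+ 2.
Proof.
rewrite ler_norml => /andP[xl xu].
have := expR_ge1Dx (- x); have e0 := expR_gt0 x.
rewrite expRN => h.
have : (1 - x) * expR x <= 1.
  by rewrite -[leRHS](@mulVf _ (expR x)) ?gt_eqF// ler_wpM2r// ltW.
have : 0 <= x ^+ 2 * (1 - 2 * x) by apply: mulr_ge0; [exact: sqr_ge0|lra].
move=> h1 h2.
have : (1 - x) * expR x <= (1 - x) * (1 + x + 2 * x ^+ 2) by apply: (le_trans h2); nra.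
by rewrite ler_pM2l//; lra.
Qed.

(** For the upper bound, [expR (- u) * (1 + u) <= 1], and
    [(1 + u) * (1 - u + u ^+ 2) = 1 + u ^+ 3]. *)
Lemma expRN_quad (R : realType) (u : R) : 0 <= u ->
  `|expR (- u) - (1 - u)| <= u ^+ 2.
Proof.
move=> u0; have := expR_ge1Dx (- u) => h1.
rewrite ger0_norm; last by rewrite subr_ge0.
have := expR_ge1Dx u => h2.
have e0 := expR_gt0 u.
have : expR (- u) * (1 + u) <= 1.
  by rewrite expRN -[leRHS](@mulVf _ (expR u)) ?gt_eqF// ler_wpM2l// invr_ge0 ltW.
have e1 := expR_gt0 (- u).
have : 0 <= u ^+ 3 by apply: exprn_ge0.
move=> h3 h4.
have : (1 + u) * expR (- u) <= (1 + u) * (1 - u + u ^+ 2).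
  rewrite mulrC; apply: (le_trans h4); nra.
rewrite ler_pM2l//; lra.
Qed.

Lemma pow_fact_le_exp (R : realType) (k : nat) (x : R) :
  `|x| ^+ k / k`!%:R <= expR x + expR (- x).
Proof.
apply: (@le_trans _ _ (expR `|x|)).
  case: k => [|k]; first by rewrite expr0 fact0 divr1 -expR0 ler_expR.
  by apply: le_trans (expR_ge1Dxn k (normr_ge0 x)); rewrite lerDr.
have [x0|x0] := leP 0 x.
  by rewrite ger0_norm// lerDl expR_ge0.
by rewrite ltr0_norm// lerDr expR_ge0.
Qed.

(** * Expectations under finite product laws *)

(** The expectation when the coordinates of [w] are independent and [w i] has mass function
    [q i]. *)
Definition pexp (R : realType) (I T : finType) (q : I -> T -> R)
    (G : {ffun I -> T} -> R) : R :=
  \sum_(w : {ffun I -> T}) (\prod_i q i (w i)) * G w.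

Definition pmfs (R : realType) (I T : finType) (q : I -> T -> R) : Prop :=
  (forall i t, 0 <= q i t) /\ (forall i, \sum_t q i t = 1).

Lemma pexp_prod (R : realType) (I T : finType) (q h : I -> T -> R) :
  pexp q (fun w => \prod_i h i (w i)) = \prod_i \sum_t q i t * h i t.
Proof.
by rewrite bigA_distr_bigA; apply: eq_bigr => w _; rewrite -big_split.
Qed.

Lemma pexp_cst (R : realType) (I T : finType) (q : I -> T -> R) (c : R) :
  pmfs q -> pexp q (fun=> c) = c.
Proof.
move=> [_ q1]; rewrite /pexp -mulr_suml -bigA_distr_bigA.
by rewrite (eq_bigr (fun=> 1)) ?big1_eq ?mul1r// => i _; exact: q1.
Qed.

Lemma pexpD (R : realType) (I T : finType) (q : I -> T -> R) F G :
  pexp q (fun w => F w + G w) = pexp q F + pexp q G.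
Proof. by rewrite -big_split; apply: eq_bigr => w _; rewrite mulrDr. Qed.

Lemma pexpZ (R : realType) (I T : finType) (q : I -> T -> R) c F :
  pexp q (fun w => c * F w) = c * pexp q F.
Proof. by rewrite mulr_sumr; apply: eq_bigr => w _; rewrite mulrCA. Qed.

Lemma pexpB (R : realType) (I T : finType) (q : I -> T -> R) F G :
  pexp q (fun w => F w - G w) = pexp q F - pexp q G.
Proof.
by rewrite -sumrB; apply: eq_bigr => w _; rewrite mulrBr.
Qed.

Lemma pexp_sum (R : realType) (I T : finType) (q : I -> T -> R)
  (J : Type) (r : seq J) (P : pred J) (F : J -> {ffun I -> T} -> R) :
  pexp q (fun w => \sum_(j <- r | P j) F j w) = \sum_(j <- r | P j) pexp q (F j).
Proof.
by rewrite exchange_big; apply: eq_bigr => w _; rewrite mulr_sumr.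
Qed.

Lemma pexp_le (R : realType) (I T : finType) (q : I -> T -> R) F G :
  pmfs q -> (forall w, F w <= G w) -> pexp q F <= pexp q G.
Proof.
move=> [q0 _] FG; apply: ler_sum => w _; apply: ler_wpM2l => //.
by apply: prodr_ge0.
Qed.

Lemma ler_norm_pexp (R : realType) (I T : finType) (q : I -> T -> R) F :
  pmfs q -> `|pexp q F| <= pexp q (fun w => `|F w|).
Proof.
move=> [q0 _]; apply: (le_trans (ler_norm_sum _ _ _)); apply: ler_sum => w _.
by rewrite normrM ger0_norm// prodr_ge0.
Qed.

Lemma pexp_at (R : realType) (I T : finType) (q : I -> T -> R) (i : I) (h : T -> R) :
  pmfs q -> pexp q (fun w => h (w i)) = \sum_t q i t * h t.
Proof.
move=> [_ q1].
transitivity (pexp q (fun w => \prod_k (if k == i then h (w k) else 1))).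
  by apply: eq_bigr => w _; congr (_ * _); rewrite -big_mkcond big_pred1_eq.
rewrite (pexp_prod q (fun k t => if k == i then h t else 1)).
rewrite (bigD1 i)//= eqxx [X in _ * X]big1 ?mulr1// => k /negbTE ->.
by rewrite -[RHS](q1 k); apply: eq_bigr => t _; rewrite mulr1.
Qed.

Lemma pexp_indep (R : realType) (I T : finType) (q : I -> T -> R) (i j : I)
  (h k : T -> R) : pmfs q -> i != j ->
  pexp q (fun w => h (w i) * k (w j)) = (\sum_t q i t * h t) * (\sum_t q j t * k t).
Proof.
move=> [_ q1] ij.
pose H l t := if l == i then h t else if l == j then k t else 1.
transitivity (pexp q (fun w => \prod_l H l (w l))).
  apply: eq_bigr => w _; congr (_ * _).
  rewrite (bigD1 i)//= {1}/H eqxx (bigD1 j) 1?eq_sym//= {1}/H eqxx.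
  rewrite eq_sym (negbTE ij) big1 ?mulr1// => l /andP[/negbTE li /negbTE lj].
  by rewrite /H li lj.
rewrite (pexp_prod q H) (bigD1 i)//= (bigD1 j) 1?eq_sym//=.
rewrite [X in _ * (_ * X)]big1 ?mulr1.
  congr (_ * _); apply: eq_bigr => t _; rewrite /H ?eqxx//.
  by rewrite eq_sym (negbTE ij) ?eqxx.
move=> l /andP[/negbTE li /negbTE lj]; rewrite -[RHS](q1 l).
by apply: eq_bigr => t _; rewrite /H li lj mulr1.
Qed.

(** For [i != j] independence splits the expectation, and the factor coming from [X] has mean zero;
    only the diagonal survives. *)
Lemma pexp_cov (R : realType) (I T : finType) (q X Y : I -> T -> R) :
  pmfs q -> (forall i, \sum_t q i t * X i t = 0) ->
  pexp q (fun w => (\sum_i X i (w i)) * (\sum_i Y i (w i)))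
  = \sum_i \sum_t q i t * (X i t * Y i t).
Proof.
move=> qP X0; under eq_fun do rewrite big_distrlr/=.
rewrite pexp_sum; apply: eq_bigr => i _; rewrite pexp_sum (bigD1 i)//=.
rewrite (pexp_at i (fun t => X i t * Y i t)) // [X in _ + X]big1 ?addr0// => j ji.
by rewrite pexp_indep 1?eq_sym// X0 mul0r.
Qed.

(** Independence factors the left side. In each factor the linear term of [expR_le_quad] has mean
    zero, which leaves at most 1 plus twice the variance, and that is at most its exponential. *)
Lemma pexp_expR (R : realType) (I T : finType) (q Z : I -> T -> R) :
  pmfs q -> (forall i, \sum_t q i t * Z i t = 0) ->
  (forall i t, `|Z i t| <= 1 / 2) ->
  pexp q (fun w => expR (\sum_i Z i (w i)))
  <= expR (2 * \sum_i \sum_t q i t * Z i t ^+ 2).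
Proof.
move=> [q0 q1] Z0 Zb.
under eq_fun do rewrite expR_sum.
rewrite (pexp_prod q (fun i t => expR (Z i t))) mulr_sumr expR_sum.
apply: ler_prod => i _; apply/andP; split.
  by apply: sumr_ge0 => t _; rewrite mulr_ge0// expR_ge0.
apply: le_trans (expR_ge1Dx _).
apply: (@le_trans _ _ (\sum_t q i t * (1 + Z i t + 2 * Z i t ^+ 2))).
  by apply: ler_sum => t _; rewrite ler_wpM2l// expR_le_quad.
under eq_bigr do rewrite !mulrDr mulr1 mulrCA.
by rewrite !big_split/= q1 Z0 addr0 mulr_sumr.
Qed.

(** * Characteristic functions of sums of independent variables *)

Definition cis (R : realType) (x : R) : R[i] := Complex (cos x) (sin x).

Lemma cisD (R : realType) (x y : R) : cis (x + y) = cis x * cis y.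
Proof. by rewrite /cis cosD sinD; congr Complex; rewrite addrC mulrC. Qed.

Lemma cis_sum (R : realType) (I : finType) (Z : I -> R) :
  cis (\sum_i Z i) = \prod_i cis (Z i).
Proof.
by apply: (big_morph _ (@cisD R)); rewrite /cis cos0 sin0.
Qed.

Lemma sum_Complex (R : realType) (I : finType) (a b : I -> R) :
  \sum_i Complex (a i) (b i) = Complex (\sum_i a i) (\sum_i b i).
Proof. by elim/big_rec3 : _ => // i x y z _ ->. Qed.

Lemma prod_Complex_real (R : realType) (I : finType) (a : I -> R) :
  \prod_i Complex (a i) 0 = Complex (\prod_i a i) 0.
Proof.
elim/big_rec2 : _ => // i x y _ ->.
by rewrite /GRing.mul/= !mulr0 !mul0r subr0 addr0.
Qed.

Lemma mul_Complex (R : realType) (a b c d : R) :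
  Complex a b * Complex c d = Complex (a * c - b * d) (a * d + b * c).
Proof. by []. Qed.

(** Complex multiplication carries the addition formulas, so the cosine and sine of a sum become the
    two parts of one product and factor by independence. *)
Lemma pexp_cis (R : realType) (I T : finType) (q Z : I -> T -> R) :
  Complex (pexp q (fun w => cos (\sum_i Z i (w i)))) (pexp q (fun w => sin (\sum_i Z i (w i))))
  = \prod_i Complex (\sum_t q i t * cos (Z i t)) (\sum_t q i t * sin (Z i t)).
Proof.
rewrite -sum_Complex.
under [RHS]eq_bigr do rewrite -sum_Complex.
rewrite bigA_distr_bigA; apply: eq_bigr => w _.
transitivity (Complex (\prod_i q i (w i)) 0 * cis (\sum_i Z i (w i))).
  by rewrite /cis mul_Complex !mul0r subr0 addr0.
rewrite cis_sum -prod_Complex_real -big_split/=; apply: eq_bigr => i _.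
by rewrite /cis mul_Complex !mul0r subr0 addr0.
Qed.

(** Replacing the factors one at a time costs at most the product of the numbers 1 plus the local
    error, minus 1; this is below the exponential of the total error, minus 1. *)
Lemma prod_Complex_close (R : realType) (I : Type) (r : seq I) (c s v : I -> R) :
  (forall i, `|c i| <= 1) -> (forall i, 0 <= v i) ->
  `|complex.Re (\prod_(i <- r) Complex (c i) (s i)) - expR (- \sum_(i <- r) v i)|
  + `|complex.Im (\prod_(i <- r) Complex (c i) (s i))|
  <= expR (\sum_(i <- r) (`|c i - expR (- v i)| + `|s i|)) - 1.
Proof.
move=> c1 v0; elim: r => [|i r]; first by rewrite !big_nil oppr0 expR0 !subrr !normr0 addr0.
rewrite !big_cons; case: (\prod_(_ <- _) _) => C D /=.
set E := expR (- \sum_(j <- r) v j); set S := \sum_(j <- r) _ => IH.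
rewrite opprD expRD -/E [expR (_ + S)]expRD.
set e := expR (- v i).
have E1 : `|E| <= 1.
  by rewrite ger0_norm ?expR_ge0// -expR0 ler_expR oppr_le0 sumr_ge0.
have C1 : `|C| <= 1 + `|C - E|.
  by rewrite -{1}(subrK E C) (le_trans (ler_normD _ _))// addrC lerD2r.
(* The real part splits into the error of the remaining product, the error of the current factor
   times [E <= 1], and the imaginary cross term. *)
have hc : `|c i * C - s i * D - e * E| <=
    `|c i| * `|C - E| + `|c i - e| + `|s i| * `|D|.
  have -> : c i * C - s i * D - e * E = c i * (C - E) + (c i - e) * E - s i * D by ring.
  rewrite (le_trans (ler_normB _ _))// normrM lerD2r.
  rewrite (le_trans (ler_normD _ _))// !normrM lerD2l.
  by rewrite ler_piMr.
have hs : `|c i * D + s i * C| <= `|c i| * `|D| + `|s i| * `|C|.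
  by rewrite (le_trans (ler_normD _ _))// !normrM.
have := expR_ge1Dx (`|c i - e| + `|s i|).
set X := expR (_ + _).
have := c1 i; have := normr_ge0 (c i); have := normr_ge0 (s i).
have := normr_ge0 (c i - e); have := normr_ge0 D; have := normr_ge0 (C - E).
have := expR_gt0 S.
set Y := expR S; move: IH; rewrite -/Y.
move: (`|c i - e|) (`|s i|) (`|c i|) (`|C - E|) (`|D|) (`|C|) hc hs C1 => a b cc d f CC hc hs C1.
move=> IH Y0 d0 f0 a0 b0 c0 cc1 hX.
apply: (@le_trans _ _ (cc * d + a + b * f + (cc * f + b * CC))); first exact: lerD.
have h1 : cc * d <= d by rewrite ler_piMl.
have h2 : cc * f <= f by rewrite ler_piMl.
have h3 : b * CC <= b * (1 + d) by rewrite ler_wpM2l.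
have h4 : (1 + (a + b)) * Y <= X * Y by rewrite ler_wpM2r// ltW.
have h5 : (a + b) * (1 + d + f) <= (a + b) * Y.
  by rewrite ler_wpM2l ?addr_ge0//; lra.
have h6 : 0 <= a * (d + f) by rewrite mulr_ge0 ?addr_ge0.
lra.
Qed.

(** A quantitative Lindeberg theorem for bounded summands. With local variance [V i], the local
    characteristic function is [1 - V i / 2] up to [delta * V i / 24] in the real part and
    [delta * V i / 6] in the imaginary part, because the linear term is centered. Passing to
    [expR (- (V i / 2))] costs another [delta * V i / 4]. *)
Lemma pexp_chf (R : realType) (I T : finType) (q Z : I -> T -> R) (delta : R) :
  pmfs q -> (forall i, \sum_t q i t * Z i t = 0) ->
  (forall i t, `|Z i t| <= delta) -> delta <= 1 ->
  let v := \sum_i \sum_t q i t * Z i t ^+ 2 in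
  `|pexp q (fun w => cos (\sum_i Z i (w i))) - expR (- (v / 2))| <= expR (delta * v) - 1
  /\ `|pexp q (fun w => sin (\sum_i Z i (w i)))| <= expR (delta * v) - 1.
Proof.
move=> [q0 q1] Z0 Zb d1 v.
pose V i := \sum_t q i t * Z i t ^+ 2.
have V0 i : 0 <= V i by apply: sumr_ge0 => t _; rewrite mulr_ge0// sqr_ge0.
pose c i := \sum_t q i t * cos (Z i t); pose s i := \sum_t q i t * sin (Z i t).
have c1 i : `|c i| <= 1.
  rewrite (le_trans (ler_norm_sum _ _ _))// -(q1 i); apply: ler_sum => t _.
  by rewrite normrM ger0_norm// ler_piMr// ler_norml cos_geN1 cos_le1.
have hv0 i : 0 <= V i / 2 by rewrite divr_ge0.
have := @prod_Complex_close R I (index_enum I) c s (fun i => V i / 2) c1 hv0.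
rewrite -pexp_cis /= -mulr_suml -/v => H.
have loc i : `|c i - expR (- (V i / 2))| + `|s i| <= delta * V i.
  have ds : `|s i| <= delta * V i / 6.
    have -> : s i = \sum_t q i t * (sin (Z i t) - sinT 1 (Z i t)).
      under [RHS]eq_bigr do rewrite mulrBr.
      rewrite sumrB -/(s i) [X in _ - X](_ : _ = 0) ?subr0// -[RHS](Z0 i).
      by apply: eq_bigr => t _; rewrite /= !expr0 expr1 double0 add0r divr1 mul1r.
    rewrite (le_trans (ler_norm_sum _ _ _))// /V mulr_sumr mulr_suml; apply: ler_sum => t _.
    rewrite normrM ger0_norm//.
    have -> : delta * (q i t * Z i t ^+ 2) / 6 = q i t * (delta * Z i t ^+ 2 / 6) by ring.
    rewrite ler_wpM2l// (le_trans (sin_taylor_odd _ _))//=.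
    have -> : ((1.*2.+1)`!%:R : R) = 6 by [].
    rewrite ler_wpM2r ?invr_ge0// -[X in _ <= _ * X]real_normK ?num_real//.
    by rewrite exprS ler_wpM2r ?exprn_ge0.
  have dc : `|c i - (1 - V i / 2)| <= delta * V i / 24.
    have -> : c i - (1 - V i / 2) = \sum_t q i t * (cos (Z i t) - cosT 2 (Z i t)).
      under [RHS]eq_bigr do rewrite mulrBr.
      rewrite sumrB -/(c i); congr (_ - _).
      rewrite -[X in X - _](q1 i) /V mulr_suml -sumrB; apply: eq_bigr => t _ /=.
      have -> : ((1.*2)`!%:R : R) = 2 by [].
      by rewrite double0 !expr0 expr1 fact0 add0r -[1.*2]/2%N; field.
    rewrite (le_trans (ler_norm_sum _ _ _))// /V mulr_sumr mulr_suml; apply: ler_sum => t _.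
    rewrite normrM ger0_norm//.
    have -> : delta * (q i t * Z i t ^+ 2) / 24 = q i t * (delta * Z i t ^+ 2 / 24) by ring.
    rewrite ler_wpM2l// (le_trans (cos_taylor _ _))//=.
    have -> : ((2.*2)`!%:R : R) = 24 by [].
    rewrite ler_wpM2r ?invr_ge0// -[X in _ <= _ * X]real_normK ?num_real//.
    rewrite -[2.*2]/(2 + 2)%N exprD ler_wpM2r ?exprn_ge0//.
    rewrite expr2 -[leRHS]mulr1 ler_pM//.
    by rewrite (le_trans (Zb i t)).
  have de := expRN_quad (hv0 i).
  (* Here [delta <= 1] is used: [Z i t ^+ 2] is at most [delta * 1]. It makes the quadratic error
     [V i ^+ 2] linear in [V i]. *)
  have Vd : V i <= delta.
    apply: (@le_trans _ _ (\sum_t q i t * delta)); last by rewrite -mulr_suml q1 mul1r.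
    apply: ler_sum => t _; rewrite ler_wpM2l// -real_normK ?num_real// expr2.
    by rewrite -[leRHS]mulr1 ler_pM// (le_trans (Zb i t)).
  have VV : V i ^+ 2 <= delta * V i by rewrite expr2 ler_wpM2r.
  have tri : `|c i - expR (- (V i / 2))| <= `|c i - (1 - V i / 2)| + `|expR (- (V i / 2)) - (1 - V i / 2)|.
    by rewrite -[X in `|X|](subrKA (1 - V i / 2)) (le_trans (ler_normD _ _))// lerD2l distrC.
  have dV : 0 <= delta * V i by rewrite mulr_ge0// (le_trans (V0 i)).
  have de' : `|expR (- (V i / 2)) - (1 - V i / 2)| <= delta * V i / 4 by rewrite (le_trans de)// expr_div_n; lra.
  lra.
have fin : expR (\sum_i (`|c i - expR (- (V i / 2))| + `|s i|)) - 1 <= expR (delta * v) - 1.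
  by rewrite lerD2r ler_expR mulr_sumr; apply: ler_sum.
have H2 := le_trans H fin.
by split; apply: le_trans H2; rewrite ?lerDl ?lerDr.
Qed.

(** * Bounded continuous test functions and trigonometric approximation *)

Lemma cvg_bigsum (R : realType) (T : Type) (F : set_system T) {FF : Filter F}
  (J : Type) (r : seq J) (P : pred J) (f : J -> T -> R) (l : J -> R) :
  (forall j, P j -> f j x @[x --> F] --> l j) ->
  (\sum_(j <- r | P j) f j x) @[x --> F] --> \sum_(j <- r | P j) l j.
Proof.
move=> H; elim: r => [|j r IH].
  by rewrite big_nil; under eq_fun do rewrite big_nil; exact: cvg_cst.
rewrite big_cons; under eq_fun do rewrite big_cons.
by case: ifP => // Pj; apply: cvgD => //; exact: H.
Qed.

Lemma cvg_bigprod (R : realType) (T : Type) (F : set_system T) {FF : Filter F}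
  (J : Type) (r : seq J) (P : pred J) (f : J -> T -> R) (l : J -> R) :
  (forall j, P j -> f j x @[x --> F] --> l j) ->
  (\prod_(j <- r | P j) f j x) @[x --> F] --> \prod_(j <- r | P j) l j.
Proof.
move=> H; elim: r => [|j r IH].
  by rewrite big_nil; under eq_fun do rewrite big_nil; exact: cvg_cst.
rewrite big_cons; under eq_fun do rewrite big_cons.
by case: ifP => // Pj; apply: cvgM => //; exact: H.
Qed.

Lemma cont_add (R : realType) (T : topologicalType) (f g : T -> R) :
  continuous f -> continuous g -> continuous (fun x => f x + g x).
Proof. by move=> cf cg x; apply: cvgD; [exact: cf|exact: cg]. Qed.

Lemma cont_mul (R : realType) (T : topologicalType) (f g : T -> R) :
  continuous f -> continuous g -> continuous (fun x => f x * g x).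
Proof. by move=> cf cg x; apply: cvgM; [exact: cf|exact: cg]. Qed.

Lemma cont_cst (R : realType) (T : topologicalType) (c : R) : continuous (fun _ : T => c).
Proof. by move=> x; exact: cvg_cst. Qed.

Lemma cont_sum (R : realType) (T : topologicalType) (J : Type) (r : seq J) (f : J -> T -> R) :
  (forall j, continuous (f j)) -> continuous (fun x => \sum_(j <- r) f j x).
Proof. by move=> cf x; apply: cvg_bigsum => j _; exact: cf. Qed.

Lemma cont_prod (R : realType) (T : topologicalType) (J : Type) (r : seq J) (f : J -> T -> R) :
  (forall j, continuous (f j)) -> continuous (fun x => \prod_(j <- r) f j x).
Proof. by move=> cf x; apply: cvg_bigprod => j _; exact: cf. Qed.

Lemma cont_exp (R : realType) (T : topologicalType) (f : T -> R) k :
  continuous f -> continuous (fun x => f x ^+ k).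
Proof.
move=> cf; elim: k => [|k IH]; first by under eq_fun do rewrite expr0; exact: cont_cst.
by under eq_fun do rewrite exprS; exact: cont_mul.
Qed.

Lemma cont_coord (R : realType) n (i : 'I_n) : continuous (fun x : 'rV[R]_n => x 0 i : R).
Proof. by move=> x; exact: coord_continuous. Qed.

(** * Trigonometric polynomials in several variables *)

Definition dot (R : realType) (n : nat) (t x : 'rV[R]_n) : R :=
  \sum_(i < n) t 0 i * x 0 i.

Lemma dotDl (R : realType) n (s t x : 'rV[R]_n) : dot (s + t) x = dot s x + dot t x.
Proof. by rewrite /dot -big_split; apply: eq_bigr => i _; rewrite mxE mulrDl. Qed.

Lemma dotNl (R : realType) n (t x : 'rV[R]_n) : dot (- t) x = - dot t x.
Proof. by rewrite /dot -sumrN; apply: eq_bigr => i _; rewrite mxE mulNr. Qed.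

Lemma dot0l (R : realType) n (x : 'rV[R]_n) : dot 0 x = 0.
Proof. by rewrite /dot big1// => i _; rewrite mxE mul0r. Qed.

Lemma dot_delta (R : realType) n (c : R) i (x : 'rV[R]_n) : dot (c *: delta_mx 0 i) x = c * x 0 i.
Proof.
rewrite /dot (bigD1 i)//= !mxE !eqxx mulr1 big1 ?addr0// => j ji.
by rewrite !mxE (negbTE ji) andbF mulr0 mul0r.
Qed.

Lemma continuous_dot (R : realType) n (t : 'rV[R]_n) : continuous (dot t).
Proof.
move=> x; apply: (@cvg_bigsum R _ (nbhs x)) => i _; apply: cvgM; first exact: cvg_cst.
exact: coord_continuous.
Qed.

(** The linear span of the real characters. Being inductive, it transfers to all its members
    whatever holds for characteristic functions and is stable under linear combinations. *)
Inductive trig (R : realType) (n : nat) : ('rV[R]_n -> R) -> Prop :=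
| trig_cos t : trig (fun x => cos (dot t x))
| trig_sin t : trig (fun x => sin (dot t x))
| trig_lin a b f g : trig f -> trig g -> trig (fun x => a * f x + b * g x).

Lemma trig_ext (R : realType) n (f g : 'rV[R]_n -> R) : trig f -> f =1 g -> trig g.
Proof. by move=> tf /funext <-. Qed.

Lemma trig_cst (R : realType) n (c : R) : trig (fun _ : 'rV[R]_n => c).
Proof.
apply: (trig_ext (trig_lin c 0 (trig_cos 0) (trig_cos 0))) => x.
by rewrite dot0l cos0 mulr1 mul0r addr0.
Qed.

Lemma trigD (R : realType) n (f g : 'rV[R]_n -> R) : trig f -> trig g -> trig (fun x => f x + g x).
Proof. by move=> tf tg; apply: (trig_ext (trig_lin 1 1 tf tg)) => x; rewrite !mul1r. Qed.

(** The product-to-sum formulas make the span an algebra, so it contains polynomials in sines and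
    cosines. *)
Lemma trigM (R : realType) n (f g : 'rV[R]_n -> R) : trig f -> trig g -> trig (fun x => f x * g x).
Proof.
move=> tf tg; elim: tf => [t|t|a b f1 f2 _ IH1 _ IH2].
- elim: tg => [s|s|a b f1 f2 _ IH1 _ IH2].
  + apply: (trig_ext (trig_lin (1 / 2) (1 / 2) (trig_cos (t + s)) (trig_cos (t - s)))) => x.
    by rewrite !dotDl dotNl !cosD cosN sinN; field.
  + apply: (trig_ext (trig_lin (1 / 2) (- (1 / 2)) (trig_sin (t + s)) (trig_sin (t - s)))) => x.
    by rewrite !dotDl dotNl !sinD cosN sinN; field.
  + by apply: (trig_ext (trig_lin a b IH1 IH2)) => x; ring.
- elim: tg => [s|s|a b f1 f2 _ IH1 _ IH2].
  + apply: (trig_ext (trig_lin (1 / 2) (1 / 2) (trig_sin (t + s)) (trig_sin (t - s)))) => x.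
    by rewrite !dotDl dotNl !sinD cosN sinN; field.
  + apply: (trig_ext (trig_lin (- (1 / 2)) (1 / 2) (trig_cos (t + s)) (trig_cos (t - s)))) => x.
    by rewrite !dotDl dotNl !cosD cosN sinN; field.
  + by apply: (trig_ext (trig_lin a b IH1 IH2)) => x; ring.
- by apply: (trig_ext (trig_lin a b IH1 IH2)) => x; ring.
Qed.

Lemma trig_sum (R : realType) n (J : Type) (r : seq J) (f : J -> 'rV[R]_n -> R) :
  (forall j, trig (f j)) -> trig (fun x => \sum_(j <- r) f j x).
Proof.
move=> H; elim: r => [|j r IH].
  by apply: (trig_ext (@trig_cst R n 0)) => x; rewrite big_nil.
by apply: (trig_ext (trigD (H j) IH)) => x; rewrite big_cons.
Qed.

Lemma trig_prod (R : realType) n (J : Type) (r : seq J) (f : J -> 'rV[R]_n -> R) :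
  (forall j, trig (f j)) -> trig (fun x => \prod_(j <- r) f j x).
Proof.
move=> H; elim: r => [|j r IH].
  by apply: (trig_ext (@trig_cst R n 1)) => x; rewrite big_nil.
by apply: (trig_ext (trigM (H j) IH)) => x; rewrite big_cons.
Qed.

Definition bcont (R : realType) (T : topologicalType) (f : T -> R) : Prop :=
  continuous f /\ exists C, forall x, `|f x| <= C.

Lemma bcont_cst (R : realType) (T : topologicalType) (c : R) : bcont (fun _ : T => c).
Proof. by split; [move=> x; exact: cvg_cst|exists `|c|]. Qed.

Lemma bcont_lin (R : realType) (T : topologicalType) (a b : R) (f g : T -> R) :
  bcont f -> bcont g -> bcont (fun x => a * f x + b * g x).
Proof.
move=> [cf [C fC]] [cg [D gD]]; split.
  by move=> x; apply: cvgD; apply: cvgM; try exact: cvg_cst; [exact: cf|exact: cg].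
exists (`|a| * C + `|b| * D) => x; rewrite (le_trans (ler_normD _ _))// !normrM.
by apply: lerD; apply: ler_wpM2l.
Qed.

Lemma bcontM (R : realType) (T : topologicalType) (f g : T -> R) :
  bcont f -> bcont g -> bcont (fun x => f x * g x).
Proof.
move=> [cf [C fC]] [cg [D gD]]; split.
  by move=> x; apply: cvgM; [exact: cf|exact: cg].
by exists (C * D) => x; rewrite normrM ler_pM.
Qed.

Lemma bcont_trig (R : realType) n (f : 'rV[R]_n -> R) : trig f -> bcont f.
Proof.
elim=> [t|t|a b {}f g _ bf _ bg]; last exact: bcont_lin.
- split; last by exists 1 => x; rewrite ler_norml cos_geN1 cos_le1.
  by move=> x; apply: (cvg_comp (dot t) cos); [exact: continuous_dot|exact: continuous_cos].
- split; last by exists 1 => x; rewrite ler_norml sin_geN1 sin_le1.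
  by move=> x; apply: (cvg_comp (dot t) sin); [exact: continuous_dot|exact: continuous_sin].
Qed.

Lemma continuous_row (R : realType) (T : topologicalType) n (h : 'I_n -> T -> R) :
  (forall i, continuous (h i)) -> continuous (fun x => \row_i h i x).
Proof.
move=> H x; apply/cvg_ballP => e e0.
have : \forall y \near x, forall i : 'I_n, ball (h i x) e (h i y).
  by apply: filter_forall => i; exact: (cvg_ballP _ _).1 (H i x) e e0.
by apply: filterS => y hy; split=> // i j; rewrite !mxE; exact: hy.
Qed.

(** Only [x] is confined to the compact box; [y] may lie outside. Later [x] is a point known to be
    bounded and [y] a perturbation of it. *)
Lemma unif_cont_box (R : realType) n (f : 'rV[R]_n -> R) (c e : R) :
  continuous f -> 0 < e -> exists2 d, 0 < d &
   forall x y : 'rV[R]_n, (forall i, `|x 0 i| <= c) ->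
     (forall i, `|x 0 i - y 0 i| <= d) -> `|f x - f y| <= e.
Proof.
move=> cf e0.
pose K := [set v : 'rV[R]_n | forall i, `[(- c), c]%classic (v ord0 i)].
have cK : compact K by apply: (@rV_compact _ _ (fun=> `[(- c), c]%classic)) => i; exact: segment_compact.
move/compact_near_coveringP: cK => /(_ R (0 : R)^'+ (fun d x => forall y : 'rV[R]_n,
  (forall i, `|x 0 i - y 0 i| <= d) -> `|f x - f y| <= e)) H.
have {}H : \forall d \near (0 : R)^'+, forall x, K x -> forall y : 'rV[R]_n,
    (forall i, `|x 0 i - y 0 i| <= d) -> `|f x - f y| <= e.
  apply: H => x _.
  (* Half of the radius is spent on moving from the centre [x] to [z], the other half on moving from
     [z] to [y]. *)
  have /nbhs_ballP[r /= r0 rf] : nbhs x [set y | `|f x - f y| < e / 2].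
    by have /cvgrPdist_lt := cf x; apply; rewrite divr_gt0.
  exists (ball x (r / 2) : set 'rV[R]_n, [set d | d < r / 2]).
    split; first by apply: nbhsx_ballx; rewrite divr_gt0.
    by apply: nbhs_right_lt; rewrite divr_gt0.
  move=> [z d] /= [[_ xz] dr] y zy.
  have fz : `|f x - f z| < e / 2.
    apply: rf; split => // i j; apply: lt_le_trans (xz i j) _.
    by have : 0 < r := r0; lra.
  have fy : `|f x - f y| < e / 2.
    apply: rf; split => // i j; rewrite ord1 /ball /=.
    rewrite -(subrKA (z 0 j)) (le_lt_trans (ler_normD _ _))//.
    rewrite [ltRHS](splitr r) ltrD//.
      by have := xz 0 j; rewrite /ball.
    by rewrite (le_lt_trans (zy j)).
  rewrite -(subrKA (f x)) (le_trans (ler_normD _ _))// [leRHS](splitr e).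
  by rewrite lerD// ltW// distrC.
have [d [d0 Hd]] : exists d : R, 0 < d /\ forall x, K x -> forall y : 'rV[R]_n,
    (forall i, `|x 0 i - y 0 i| <= d) -> `|f x - f y| <= e.
  near (0 : R)^'+ => d; exists d; split; first by near: d; exact: nbhs_right_gt.
  by near: d.
exists d => // x y xc; apply: Hd => i /=.
by rewrite in_itv/= -ler_norml.
Unshelve. all: by end_near. Qed.

(* [N * n] independent coins with success probabilities [u 0 i]: the expectation
   of [F] at the empirical means is a Bernstein polynomial of [F] in [u]. *)
Definition unit_avg (R : realType) (n N : nat) (w : {ffun 'I_N * 'I_n -> bool}) : 'rV[R]_n :=
  \row_i ((\sum_(k < N) (w (k, i))%:R) / N%:R).

Definition coin (R : realType) (n N : nat) (u : 'rV[R]_n) (ki : 'I_N * 'I_n) (b : bool) : R :=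
  if b then u 0 ki.2 else 1 - u 0 ki.2.

Lemma coin_pmfs (R : realType) n N (u : 'rV[R]_n) : (forall i, 0 <= u 0 i <= 1) ->
  pmfs (coin (N := N) u).
Proof.
move=> u01; split=> [[k i] b|[k i]].
  by have /andP[u0 u1] := u01 i; rewrite /coin; case: b => //=; rewrite subr_ge0.
by rewrite big_bool /coin/= addrC subrK.
Qed.

(** The deviation is a sum of [N] independent centered terms, each of variance [u * (1 - u) / N ^ 2]
    with [u] in the unit interval. *)
Lemma coin_variance (R : realType) n N (u : 'rV[R]_n) (i : 'I_n) : (0 < N)%N ->
  (forall i, 0 <= u 0 i <= 1) ->
  pexp (coin (N := N) u) (fun w => (unit_avg R w 0 i - u 0 i) ^+ 2) <= N%:R^-1.
Proof.
move=> N0 u01; have P := coin_pmfs N u01; have N0' : (N%:R : R) != 0 by rewrite pnatr_eq0 -lt0n.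
pose X (ki : 'I_N * 'I_n) (b : bool) : R :=
  if ki.2 == i then (b%:R - u 0 i) / N%:R else 0.
have E w : unit_avg R w 0 i - u 0 i = \sum_ki X ki (w ki).
  transitivity (\sum_(k < N) \sum_(j < n) X (k, j) (w (k, j))); last first.
    by rewrite pair_bigA/=; apply: eq_bigr => -[k j] _.
  rewrite (eq_bigr (fun k : 'I_N => ((w (k, i))%:R - u 0 i) / N%:R)); last first.
    by move=> k _; rewrite (bigD1 i)//= /X eqxx [X in _ + X]big1 ?addr0// => j /negbTE /= ->.
  rewrite -mulr_suml sumrB mulrBl mxE; congr (_ - _).
  by rewrite sumr_const card_ord -[u 0 i *+ N]mulr_natr mulfK.
have X0 ki : \sum_b coin u ki b * X ki b = 0.
  case: ki => k j; rewrite big_bool /coin /X/=; case: eqP => [->|_]; last by rewrite !mulr0 addr0.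
  by rewrite /=; ring.
under eq_fun do rewrite expr2 E.
rewrite pexp_cov//.
rewrite (_ : \sum_(i0 : 'I_N * 'I_n) _ = \sum_(k < N) \sum_(j < n)
    \sum_b coin u (k, j) b * (X (k, j) b * X (k, j) b)); last first.
  by rewrite [RHS]pair_bigA/=; apply: eq_bigr => -[k j] _.
apply: (@le_trans _ _ (\sum_(k < N) (N%:R ^+ 2)^-1)).
  apply: ler_sum => k _; rewrite (bigD1 i)//= [X in _ + X]big1 ?addr0; last first.
    by move=> j /negbTE ji; rewrite big_bool /X/= ji !mulr0 addr0.
  rewrite big_bool /coin /X/= eqxx.
  have -> : u 0 i * ((1 - u 0 i) / N%:R * ((1 - u 0 i) / N%:R)) +
    (1 - u 0 i) * ((0 - u 0 i) / N%:R * ((0 - u 0 i) / N%:R)) = u 0 i * (1 - u 0 i) * (N%:R ^+ 2)^-1.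
    by field.
  have /andP[u0 u1] := u01 i.
  rewrite ler_piMl ?invr_ge0 ?exprn_ge0//; nra.
by rewrite sumr_const card_ord -[leLHS]mulr_natr expr2 invfM -mulrA mulVf// mulr1.
Qed.

(** Bernstein's proof of the Weierstrass theorem. Where the average is within [d] of [u], uniform
    continuity applies; elsewhere the error is at most [2 * C], which is charged to the squared
    deviation divided by [d ^+ 2]. *)
Lemma coin_approx (R : realType) n (F : 'rV[R]_n -> R) (C e : R) :
  continuous F -> (forall x, `|F x| <= C) -> 0 < e ->
  exists N, forall u : 'rV[R]_n, (forall i, 0 <= u 0 i <= 1) ->
    `|pexp (coin (N := N) u) (fun w => F (unit_avg R w)) - F u| <= e.
Proof.
move=> cF FC e0; have C0 : 0 <= C by apply: le_trans (FC 0).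
have e20 : 0 < e / 2 by rewrite divr_gt0.
have [d d0 Fd] := unif_cont_box 1 cF e20.
(* [K / N%:R] is the Chebyshev bound summed over the [n] coordinates. *)
pose K := 2 * C * n%:R / d ^+ 2.
have K0 : 0 <= K by rewrite /K divr_ge0 ?exprn_ge0 ?mulr_ge0// ltW.
have [N N0 NK] : exists2 N : nat, (0 < N)%N & K / N%:R <= e / 2.
  exists (Num.truncn (K / (e / 2))).+1 => //.
  rewrite ler_pdivrMr// mulrC -ler_pdivrMr//.
  by rewrite ltW// truncnS_gt.
exists N => u u01; have P := coin_pmfs N u01.
rewrite -[X in (_ - X)](pexp_cst (F u) P) -pexpB (le_trans (ler_norm_pexp _ P))//.
apply: (@le_trans _ _ (pexp (coin (N := N) u) (fun w => e / 2 +
    2 * C / d ^+ 2 * \sum_(i < n) (unit_avg R w 0 i - u 0 i) ^+ 2))).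
  apply: pexp_le => // w.
  have s0 : 0 <= \sum_(i < n) (unit_avg R w 0 i - u 0 i) ^+ 2.
    by apply: sumr_ge0 => i _; exact: sqr_ge0.
  have [close|/existsNP[i /negP]] := pselect (forall i, `|u 0 i - unit_avg R w 0 i| <= d).
    rewrite distrC (le_trans (Fd _ _ _ close))//.
      by move=> i; have /andP[u0 u1] := u01 i; rewrite ger0_norm.
    by rewrite lerDl mulr_ge0// divr_ge0 ?exprn_ge0 ?mulr_ge0// ltW.
  rewrite -ltNge => far.
  have h : `|F (unit_avg R w) - F u| <= 2 * C.
    by rewrite (le_trans (ler_normB _ _))// mulr2n mulrDl mul1r lerD.
  apply: (le_trans h); rewrite -[leLHS]add0r lerD ?(ltW e20)//.
  rewrite mulrAC ler_pdivlMr ?exprn_gt0// ler_wpM2l ?mulr_ge0//.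
  rewrite (bigD1 i)//= -[leLHS]addr0 lerD ?sumr_ge0//; last by move=> j _; exact: sqr_ge0.
  rewrite -[leRHS]real_normK ?num_real// distrC ler_pXn2r ?nnegrE ?ltW//.
  exact: lt_trans far.
rewrite pexpD pexp_cst// pexpZ pexp_sum [leRHS]splitr lerD2l.
apply: (@le_trans _ _ (2 * C / d ^+ 2 * \sum_(i < n) N%:R^-1)).
  apply: ler_wpM2l; first by rewrite divr_ge0 ?exprn_ge0 ?mulr_ge0// ltW.
  by apply: ler_sum => i _; exact: coin_variance.
apply: le_trans NK; rewrite sumr_const card_ord -[_ *+ _]mulr_natr /K le_eqVlt; apply/orP; left.
by apply/eqP; field; rewrite pnatr_eq0 -lt0n N0 gt_eqF.
Qed.

(* Substitutes [u_i = (1 + sin (x_i / L)) / 2] in a Bernstein polynomial; the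
   clipping keeps the argument of [asin] away from the end points. *)
Lemma trig_approx (R : realType) n (f : 'rV[R]_n -> R) (C L e : R) :
  continuous f -> (forall x : 'rV[R]_n, `|f x| <= C) -> 0 < L -> 0 < e ->
  exists2 q : 'rV[R]_n -> R, trig q & (forall x, `|q x| <= C) /\
    (forall x : 'rV[R]_n, (forall i, `|x 0 i| <= L) -> `|q x - f x| <= e).
Proof.
move=> cf fC L0 e0.
pose s1 : R := sin 1.
have s11 : s1 < 1.
  have := cos2Dsin2 (1 : R); have := cos1_gt0 R; have := sin_le1 (1 : R); rewrite -/s1.
  by move=> h1 h2 h3; nra.
have s10 : 0 < s1.
  by apply: sin_gt0_pi; rewrite ltr01 /=; have := pi_ge2 R; lra.
pose clip (z : R) := Num.max (- s1) (Num.min z s1).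
have clipP z : -1 < clip z < 1.
  rewrite /clip lt_max gt_max gt_min s11 orbT andbT.
  by rewrite ltrNl opprK s11/= ltrNl (lt_trans _ s10)// ltrN10.
have cclip : continuous clip.
  move=> z; apply: (@continuous_max R _ (cst (- s1)) (fun z => Num.min z s1) z).
    exact: cst_continuous.
  by apply: (@continuous_min R _ id (cst s1) z); [exact: cvg_id|exact: cst_continuous].
pose F (v : 'rV[R]_n) := f (\row_i (L * asin (clip (2 * v 0 i - 1)))).
have casin i : continuous (fun v : 'rV[R]_n => L * asin (clip (2 * v 0 i - 1))).
  apply: cont_mul; first exact: cont_cst.
  have c1 : continuous (fun v : 'rV[R]_n => 2 * v 0 i - 1).
    apply: cont_add; last exact: cont_cst.
    by apply: cont_mul; [exact: cont_cst|exact: cont_coord].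
  move=> v; apply: (cvg_comp (fun v : 'rV[R]_n => clip (2 * v 0 i - 1)) asin).
    exact: cvg_comp (c1 v) (cclip _).
  exact: continuous_asin.
have cF : continuous F.
  have crow : continuous (fun v : 'rV[R]_n => \row_(i < n) (L * asin (clip (2 * v 0 i - 1))) : 'rV[R]_n).
    apply: (@continuous_row R _ n (fun i (v : 'rV[R]_n) => L * asin (clip (2 * v 0 i - 1)))) => i.
    exact: casin.
  by move=> v; exact: cvg_comp (crow v) (cf _).
have FC v : `|F v| <= C by exact: fC.
have [N HN] := coin_approx cF FC e0.
pose u (x : 'rV[R]_n) : 'rV[R]_n := \row_i ((1 + sin (x 0 i / L)) / 2).
have u01 x i : 0 <= u x 0 i <= 1.
  rewrite mxE; have := sin_geN1 (x 0 i / L); have := sin_le1 (x 0 i / L).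
  by move=> h1 h2; lra.
have tu i : trig (fun x => u x 0 i).
  apply: (trig_ext (trig_lin (1 / 2) (1 / 2) (@trig_cst R n 1) (trig_sin (L^-1 *: delta_mx 0 i)))) => x.
  by rewrite dot_delta mxE [x 0 i / L]mulrC; field.
exists (fun x => pexp (coin (N := N) (u x)) (fun w => F (unit_avg R w))).
  apply: trig_sum => w; apply: trigM; last exact: trig_cst.
  apply: trig_prod => ki; rewrite /coin; case: (w ki); first exact: tu.
  by apply: (trig_ext (trig_lin 1 (-1) (@trig_cst R n 1) (tu ki.2))) => x; rewrite mul1r mulN1r.
(* The bound [C] holds on the whole space because the Bernstein weights form a probability at every
   [x]; this is what keeps the error off the box under control later. *)
split => x.
  have P := coin_pmfs N (u01 x).
  by rewrite (le_trans (ler_norm_pexp _ P))// -[leRHS](pexp_cst C P) pexp_le.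
move=> xL.
have -> : f x = F (u x); last exact: HN (u01 x).
rewrite /F; congr f; apply/rowP => i; rewrite !mxE.
have xi : -1 <= x 0 i / L <= 1.
  by have := xL i; rewrite -ler_norml normrM [`|L^-1|]gtr0_norm ?invr_gt0// ler_pdivrMr// mul1r.
(* As [1 <= pi / 2], sine is monotone on the values [x 0 i / L]. Hence the clipping at [sin 1] is
   inactive there and [asin] inverts the sine. *)
have pi2 := pihalf_ge1 R.
have inpi (y : R) : -1 <= y <= 1 -> y \in `[(- (pi / 2)), (pi / 2)].
  by rewrite in_itv/= => /andP[y1 y2]; apply/andP; split; lra.
have mono : {in `[-1, 1] &, {homo (@sin R) : a b / a <= b}}.
  move=> a b; rewrite !in_itv/= => a1 b1.
  rewrite le_eqVlt => /orP[/eqP-> //|ab]; apply: ltW.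
  by rewrite ltr_sin//; exact: inpi.
have -> : 2 * ((1 + sin (x 0 i / L)) / 2) - 1 = sin (x 0 i / L) by field.
have -> : clip (sin (x 0 i / L)) = sin (x 0 i / L).
  have /andP[x1 x2] := xi.
  have h1 : sin (x 0 i / L) <= s1.
    by apply: mono => //; rewrite in_itv/= ?xi// lexx andbT; lra.
  have h2 : - s1 <= sin (x 0 i / L).
    by rewrite -sinN; apply: mono => //; rewrite in_itv/= ?xi// lexx; lra.
  by rewrite /clip (min_idPl h1) (max_idPr h2).
rewrite sinK; last exact: inpi.
by rewrite mulrC divfK ?gt_eqF.
Qed.

(** The total mass is left free, so that expectations weighted by [rho] qualify as well as
    probabilities. *)
Definition posfun (R : realType) n (E : ('rV[R]_n -> R) -> R) : Prop :=
  (forall a b f g, bcont f -> bcont g ->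
     E (fun x => a * f x + b * g x) = a * E f + b * E g) /\
  (forall f g, bcont f -> bcont g -> (forall x, f x <= g x) -> E f <= E g).

(** A continuous majorant of the indicator that some coordinate exceeds [L] in absolute value. It is
    bounded, hence an admissible test function, and it is dominated by second moments. *)
Definition tail (R : realType) n (L : R) (x : 'rV[R]_n) : R :=
  Num.min 1 ((\sum_(i < n) x 0 i ^+ 2) / L ^+ 2).

Lemma tail_ge0 (R : realType) n (L : R) (x : 'rV[R]_n) : 0 <= tail L x.
Proof.
by rewrite /tail le_min ler01 divr_ge0 ?exprn_even_ge0// sumr_ge0// => i _; exact: sqr_ge0.
Qed.

Lemma tail_out (R : realType) n (L : R) (x : 'rV[R]_n) i : 0 < L ->
  L < `|x 0 i| -> tail L x = 1.
Proof.
move=> L0 Lx; apply/min_idPl; rewrite ler_pdivlMr ?exprn_gt0// mul1r.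
rewrite (bigD1 i)//= -[leLHS]addr0 lerD ?sumr_ge0//; last by move=> j _; exact: sqr_ge0.
by rewrite -[leRHS]real_normK ?num_real// ler_sqr ?nnegrE// ltW.
Qed.

Lemma bcont_tail (R : realType) n (L : R) : bcont (@tail R n L).
Proof.
split.
  have c : continuous (fun x : 'rV[R]_n => (\sum_(i < n) x 0 i ^+ 2) / L ^+ 2 : R).
    apply: cont_mul; last exact: cont_cst.
    by apply: cont_sum => i; apply: cont_exp; exact: cont_coord.
  move=> x; apply: (@continuous_min R _ (cst 1) _ x _ (c x)).
  exact: cst_continuous.
by exists 1 => x; rewrite ger0_norm ?tail_ge0// /tail ge_min lexx.
Qed.

Lemma posfun_norm (R : realType) n (E : ('rV[R]_n -> R) -> R) f h :
  posfun E -> bcont f -> bcont h -> (forall x, `|f x| <= h x) -> `|E f| <= E h.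
Proof.
move=> [Elin Ele] bf bh fh.
have bN := bcont_lin (-1) 0 bf bf.
rewrite ler_norml; apply/andP; split; last first.
  by apply: Ele => // x; apply: le_trans (fh x); exact: ler_norm.
rewrite lerNl (_ : - E f = E (fun x => -1 * f x + 0 * f x)); last by rewrite Elin// mulN1r mul0r addr0.
by apply: Ele => // x; rewrite mulN1r mul0r addr0 (le_trans _ (fh x))// -normrN ler_norm.
Qed.

(** Trigonometric polynomials agree in the limit by linearity. A general [f] differs from its
    approximation [q] by a small constant on the box and by at most [2 * C] off it, where [tail L]
    equals 1; mass and tightness bound both contributions. *)
Lemma trig_compare (R : realType) n (T : Type) (G : set_system T) {FG : Filter G}
    (E1 E2 : T -> ('rV[R]_n -> R) -> R) (C0 : R) :
  (\forall B \near G, posfun (E1 B) /\ posfun (E2 B)) ->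
  (\forall B \near G, E1 B (fun=> 1) <= C0 /\ E2 B (fun=> 1) <= C0) ->
  (forall e, 0 < e -> exists2 L, 0 < L &
     \forall B \near G, E1 B (tail L) <= e /\ E2 B (tail L) <= e) ->
  (forall t, E1 B (fun x => cos (dot t x)) - E2 B (fun x => cos (dot t x)) @[B --> G] --> (0 : R)) ->
  (forall t, E1 B (fun x => sin (dot t x)) - E2 B (fun x => sin (dot t x)) @[B --> G] --> (0 : R)) ->
  forall f, bcont f -> E1 B f - E2 B f @[B --> G] --> (0 : R).
Proof.
move=> Epos Emass Etight Ecos Esin f bf.
have Etrig q : trig q -> E1 B q - E2 B q @[B --> G] --> (0 : R).
  elim=> [t|t|a b h k th IHh tk IHk]; [exact: Ecos|exact: Esin|].
  have bh := bcont_trig th; have bk := bcont_trig tk.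
  have : a * (E1 B h - E2 B h) + b * (E1 B k - E2 B k) @[B --> G] --> (a * 0 + b * 0 : R).
    by apply: cvgD; apply: cvgM => //; exact: cvg_cst.
  rewrite !mulr0 addr0; apply: cvg_trans; apply: near_eq_cvg.
  by apply: filterS Epos => B [[E1l _] [E2l _]]; rewrite E1l// E2l//; ring.
have [C fC] := bf.2; have C0' : 0 <= C by apply: le_trans (fC 0).
apply/cvgrPdist_le => e e0.
(* [D] makes the mass bound positive. The choice of [e1] and [e2] gives two errors of at most
   [e / 8] in replacing [f] by [q] under each functional, and the comparison for [q] costs
   [e / 4]. *)
pose D := Num.max C0 1; have D0 : 0 < D by rewrite lt_max ltr01 orbT.
pose e1 := e / (8 * D); have e10 : 0 < e1 by rewrite divr_gt0// mulr_gt0.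
pose e2 := e / (16 * (C + 1)).
have e20 : 0 < e2 by rewrite divr_gt0// mulr_gt0// ltr_wpDl.
have [L L0 HL] := Etight _ e20.
have [q tq [qC qf]] := trig_approx bf.1 fC L0 e10.
have bq := bcont_trig tq.
have e40 : 0 < e / 4 by rewrite divr_gt0.
have /cvgrPdist_le/(_ _ e40) Hq := Etrig q tq.
have bt := @bcont_tail R n L.
have key x : `|1 * f x + (-1) * q x| <= e1 * 1 + (2 * C) * tail L x.
  rewrite mul1r mulN1r mulr1.
  have [inb|/existsNP[i /negP]] := pselect (forall i, `|x 0 i| <= L).
    by rewrite distrC (le_trans (qf _ inb))// lerDl mulr_ge0 ?tail_ge0// mulr_ge0.
  rewrite -ltNge => out; rewrite (tail_out L0 out) mulr1 -[leLHS]add0r lerD ?(ltW e10)//.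
  by rewrite (le_trans (ler_normB _ _))// mulr2n mulrDl mul1r lerD.
have b1 : bcont (fun _ : 'rV[R]_n => 1 : R) by exact: bcont_cst.
have bd := bcont_lin 1 (-1) bf bq.
have bk := bcont_lin e1 (2 * C) b1 bt.
have eachE E : posfun E -> E (fun=> 1) <= C0 -> E (tail L) <= e2 -> `|E f - E q| <= e / 4.
  move=> pE Em Et.
  have := posfun_norm pE bd bk key; rewrite !(pE.1)//= mul1r mulN1r => h.
  apply: (le_trans h).
  have h1 : e1 * E (fun=> 1) <= e / 8.
    apply: (@le_trans _ _ (e1 * D)); first by rewrite ler_wpM2l ?(ltW e10)// le_max Em.
    by rewrite /e1 le_eqVlt; apply/orP; left; apply/eqP; field; rewrite gt_eqF.
  have h2 : 2 * C * E (tail L) <= e / 8.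
    apply: (@le_trans _ _ (2 * (C + 1) * e2)).
      apply: (@le_trans _ _ (2 * C * e2)); first by rewrite ler_wpM2l// mulr_ge0.
      by rewrite ler_wpM2r ?(ltW e20)//; lra.
    have C1 : C + 1 != 0 by rewrite gt_eqF// ltr_wpDl.
    by rewrite /e2 le_eqVlt; apply/orP; left; apply/eqP; field.
  lra.
near=> B.
have [p1 p2] : posfun (E1 B) /\ posfun (E2 B) by near: B.
have [m1 m2] : E1 B (fun=> 1) <= C0 /\ E2 B (fun=> 1) <= C0 by near: B.
have [t1 t2] : E1 B (tail L) <= e2 /\ E2 B (tail L) <= e2 by near: B.
have hq : `|0 - (E1 B q - E2 B q)| <= e / 4 by near: B.
have a1 := eachE _ p1 m1 t1; have a2 := eachE _ p2 m2 t2.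
rewrite sub0r normrN in hq; rewrite sub0r normrN.
have -> : E1 B f - E2 B f = (E1 B f - E1 B q) + (E1 B q - E2 B q) - (E2 B f - E2 B q) by ring.
rewrite (le_trans (ler_normB _ _))//.
have : `|E1 B f - E1 B q + (E1 B q - E2 B q)| <= `|E1 B f - E1 B q| + `|E1 B q - E2 B q| by exact: ler_normD.
lra.
Unshelve. all: by end_near. Qed.

(** * The one-dimensional normal law *)

Section normal_law_integrals.
Local Open Scope ereal_scope.

(** The Radon-Nikodym derivative and the Gaussian density have the same integrals over all
    measurable sets, hence agree almost everywhere. *)
Lemma integral_normal_prob (R : realType) (m s : R) (f : R -> \bar R) :
  measurable_fun [set: R] f -> (forall x, 0 <= f x) ->
  \int[normal_prob m s]_x f x
  = \int[lebesgue_measure]_x (f x * (normal_pdf m s x)%:E).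
Proof.
move=> mf f0; have dom := normal_prob_dominates m s.
rewrite -(Radon_Nikodym_SigmaFinite.change_of_variables dom f0 measurableT mf).
have iRN := Radon_Nikodym_SigmaFinite.f_integrable dom.
have mRN : measurable_fun [set: R] (Radon_Nikodym_SigmaFinite.f (normal_prob m s) lebesgue_measure).
  exact: measurable_int iRN.
apply: ae_eq_integral => //.
- exact: emeasurable_funM.
- apply: emeasurable_funM => //; apply/measurable_EFinP; exact: measurable_normal_pdf.
- apply: ae_eqe_mul2l; apply: integral_ae_eq => //.
  + by apply/measurable_EFinP; exact: measurable_normal_pdf.
  + by move=> E _ mE; rewrite -Radon_Nikodym_SigmaFinite.f_integral.
Qed.

(** Differences of rays give the half-open intervals, which determine a Lebesgue-Stieltjes measure;
    [P] is the one of its own distribution function. *)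
Lemma probability_eq_rays (R : realType) (P Q : probability (measurableTypeR R) R) :
  (forall r : R, P [set` `]-oo, r]] = Q [set` `]-oo, r]]) ->
  forall A : set R, measurable A -> P A = Q A.
Proof.
have ocE (S : probability (measurableTypeR R) R) (a b : R) : (a <= b)%R ->
    S [set` `]a, b]] = S [set` `]-oo, b]] - S [set` `]-oo, a]].
  move=> ab; have -> : [set` `]a, b]] = [set` `]-oo, b]] `\` [set` `]-oo, a]].
    by rewrite -[RHS]setCK setCD setCitvl setUC -[LHS]setCK setCitv.
  rewrite measureD ?setIidr//; first exact: subset_itvl.
  by rewrite -ge0_fin_numE// fin_num_measure.
move=> PQ A mA; rewrite -(lebesgue_stieltjes_cdf_id P mA).
apply: lebesgue_stieltjes_measure_unique => // X /= Xoc.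
rewrite lebesgue_stieltjes_cdf_id; last exact: sub_sigma_algebra.
case: Xoc => -[a b] /= _ <-.
have [ab|ba] := leP a b; last by rewrite set_itv_ge ?measure0// bnd_simp -leNgt ltW.
by rewrite !ocE// !PQ.
Qed.

Lemma normal_prob_opp (R : realType) (m s : R) : normal_prob m (- s) = normal_prob m s.
Proof.
rewrite /normal_prob; apply/funext => A; apply: eq_integral => x _; congr EFin.
by rewrite /normal_pdf /normal_peak /normal_fun oppr_eq0 sqrrN.
Qed.

Lemma measurable_fun_affine (R : realType) (u s : R) :
  measurable_fun [set: R] (fun y : R => (u + s * y)%R).
Proof. by apply: measurable_funD => //; apply: measurable_funM. Qed.

Lemma normal_pdf_affine (R : realType) (u s y : R) : s != 0%R ->
  (normal_pdf u s (u + s * y) * `|s|)%R = normal_pdf 0 1 y.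
Proof.
move=> s0; rewrite !normal_pdfE ?oner_neq0//= /normal_pdf/=.
rewrite /normal_peak /normal_fun.
have -> : (- (u + s * y - u) ^+ 2 / (s ^+ 2 *+ 2) = - (y - 0) ^+ 2 / (1 ^+ 2 *+ 2))%R.
  by field.
rewrite -[RHS]mulr1 -[RHS]mulrA [in RHS]mulr1.
rewrite mulrAC; congr (_ * _)%R.
have -> : Num.sqrt (s ^+ 2 * pi *+ 2) = (`|s| * Num.sqrt (1 ^+ 2 * pi *+ 2))%R.
  by rewrite -mulrnAr sqrtrM ?sqr_ge0// sqrtr_sqr expr1n mul1r.
by rewrite invfM mulrAC mulVf ?normr_eq0// mul1r.
Qed.

Lemma normal_prob_affine_ray (R : realType) (u s r : R) : (0 < s)%R ->
  normal_prob 0 1 [set y : R | (u + s * y <= r)%R] = normal_prob u s `]-oo, r]%classic.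
Proof.
move=> s0.
have s0' : s != 0%R by rewrite gt_eqF.
pose F (y : R) := (u + s * y)%R.
have DF (y : R) : is_derive y 1%R F s.
  rewrite /F; apply: is_derive_eq.
  by rewrite add0r mul1r; exact: mulr1.
have dF : F^`()%classic = cst s.
  by apply/funext => y; rewrite derive1E; have [_ ->] := DF y.
pose b := ((r - u) / s)%R.
have Fb : F b = r by rewrite /F /b; field.
rewrite /normal_prob -Fb.
rewrite (@increasing_ge0_integration_by_substitutionNy _ F (normal_pdf u s) b).
- have -> : [set y : R | (u + s * y <= F b)%R] = `]-oo, b]%classic.
    apply/seteqP; split => y /=; rewrite in_itv/= /F lerD2l ler_pM2l//.
  apply: eq_integral => y _; rewrite dF /=; congr EFin.
  by rewrite -(normal_pdf_affine u y s0') gtr0_norm.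
- by move=> x y _ _ xy; rewrite /F ltrD2l ltr_pM2l.
- by move=> x _; rewrite dF; exact: cst_continuous.
- by rewrite dF; exact: is_cvg_cst.
- by rewrite dF; exact: cvg_cst.
- split; first by move=> x _; have [] := DF x.
  apply: cvg_at_left_filter; apply: differentiable_continuous.
  by apply/derivable1_diffP; have [] := DF b.
- apply/cvgrNyPle => c; exists ((c - u) / s)%R; split; first exact: num_real.
  move=> x /= xc; rewrite /F -lerBrDl mulrC -ler_pdivlMr// ltW//.
- by apply: continuous_subspaceT; exact: continuous_normal_pdf.
- by move=> x _; exact: normal_pdf_ge0.
Qed.

Lemma normal_prob_sym_ray (R : realType) (r : R) :
  normal_prob 0 1 [set y : R | (- y <= r)%R] = normal_prob 0 1 [set` `]-oo, r]].
Proof.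
rewrite /normal_prob -[in RHS](opprK r).
rewrite ge0_integration_by_substitutionNy.
- have -> : [set y : R | (- y <= r)%R] = [set` `[(- r)%R, +oo[].
    by apply/seteqP; split => y /=; rewrite in_itv/= andbT lerNl.
  apply: eq_integral => y _ /=; congr EFin.
  by rewrite !normal_pdfE ?oner_neq0// /normal_fun !subr0 sqrrN.
- by apply: continuous_subspaceT; apply: continuous_normal_pdf; exact: oner_neq0.
- by move=> x _; exact: normal_pdf_ge0.
Qed.

Definition law_of d (R : realType) (T : measurableType d) (P : probability T R)
    (X : {mfun T >-> measurableTypeR R}) : probability (measurableTypeR R) R :=
  distribution P X.

Lemma normal_prob_preimage (R : realType) (f : R -> R) (u s : R) :
  measurable_fun [set: R] f ->
  (forall r : R, normal_prob 0 1 [set y | (f y <= r)%R] = normal_prob u s [set` `]-oo, r]]) ->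
  forall A : set R, measurable A -> normal_prob 0 1 (f @^-1` A) = normal_prob u s A.
Proof.
move=> mf H A mA.
have mf' : @measurable_fun _ _ (measurableTypeR R) (measurableTypeR R) setT f by exact: mf.
pose X : {mfun measurableTypeR R >-> measurableTypeR R} :=
  HB.pack f (@isMeasurableFun.Build _ _ (measurableTypeR R) (measurableTypeR R) f mf').
pose P : probability (measurableTypeR R) R := normal_prob 0 1.
rewrite -[LHS]/(law_of P X A).
apply: (@probability_eq_rays R (law_of P X) (normal_prob u s : probability (measurableTypeR R) R)) => //.
Qed.

Lemma normal_prob_sym (R : realType) (A : set R) : measurable A ->
  normal_prob 0 1 (-%R @^-1` A) = normal_prob 0 1 A.
Proof.
move=> mA; apply: (@normal_prob_preimage R -%R 0 1) => //.
exact: normal_prob_sym_ray.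
Qed.

Lemma normal_prob_affine (R : realType) (u s : R) (A : set R) : s != 0%R -> measurable A ->
  normal_prob 0 1 [set y : R | A (u + s * y)%R] = normal_prob u s A.
Proof.
move=> s0 mA; have pos (t : R) : (0 < t)%R -> normal_prob 0 1 [set y : R | A (u + t * y)%R] = normal_prob u t A.
  move=> t0; apply: (@normal_prob_preimage R (fun y => u + t * y)%R) => //.
    exact: measurable_fun_affine.
  by move=> r; exact: normal_prob_affine_ray.
have [/pos//|s0'] := ltP 0%R s.
(* A negative [s] reduces to [- s]: the law depends on [s] through its square only, and the standard
   law is symmetric. *)
have sN : (0 < - s)%R by rewrite oppr_gt0 lt_neqAle s0.
have := pos _ sN; rewrite normal_prob_opp => <-; rewrite -[RHS]normal_prob_sym.
  by congr (normal_prob 0 1 _); apply/seteqP; split => y /=; rewrite mulrNN.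
rewrite -[X in measurable X]setTI; exact: measurable_fun_affine.
Qed.

(** Completing the square in [u]: the right side is a function of [x] alone times a normal density
    in [u], which integrates to 1. *)
Lemma normal_pdf_convolution (R : realType) (r s u x : R) : (0 < r)%R -> s != 0%R ->
  (normal_pdf u s x * normal_pdf 0 r u)%R =
  (normal_pdf 0 (Num.sqrt (r ^+ 2 + s ^+ 2)) x *
   normal_pdf (x * r ^+ 2 / (r ^+ 2 + s ^+ 2)) (r * s / Num.sqrt (r ^+ 2 + s ^+ 2)) u)%R.
Proof.
move=> r0 s0; have r0' : r != 0%R by rewrite gt_eqF.
have t0 : (0 < r ^+ 2 + s ^+ 2)%R by rewrite ltr_pwDl ?exprn_gt0 ?sqr_ge0.
have q0 : (0 < Num.sqrt (r ^+ 2 + s ^+ 2))%R by rewrite sqrtr_gt0.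
have q0' : Num.sqrt (r ^+ 2 + s ^+ 2) != 0%R by rewrite gt_eqF.
rewrite !normal_pdfE// ?mulf_neq0 ?invr_neq0//= /normal_pdf/=.
rewrite /normal_fun /normal_peak !exprMn exprVn sqr_sqrtr ?(ltW t0)//.
rewrite mulrACA [RHS]mulrACA -!expRD; congr (_ * _)%R.
  rewrite -!invfM -!sqrtrM; last 2 first.
  - by rewrite mulrn_wge0// mulr_ge0 ?pi_ge0 ?ltW.
  - by rewrite mulrn_wge0// mulr_ge0 ?pi_ge0 ?sqr_ge0.
  by congr GRing.inv; congr Num.sqrt; field; rewrite gt_eqF.
by congr expR; field; rewrite s0 r0' gt_eqF.
Qed.

Lemma measurable_normal_pdf2 (R : realType) (s : R) : s != 0%R ->
  measurable_fun [set: R * R] (fun ux : R * R => normal_pdf ux.1 s ux.2).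
Proof.
move=> s0; under eq_fun do rewrite normal_pdfE//=.
apply: measurable_funM => //; apply: measurableT_comp => //=.
apply: measurable_funM => //; apply: measurableT_comp => //=.
by apply: measurable_funX => //; apply: measurable_funB.
Qed.

(** Tonelli puts the integral over [u] inside, where the completed square integrates to 1. *)
Lemma normal_prob_convolution (R : realType) (r s : R) (A : set R) :
  (0 < r)%R -> s != 0%R -> measurable A ->
  \int[normal_prob 0 r]_u normal_prob u s A
  = normal_prob 0 (Num.sqrt (r ^+ 2 + s ^+ 2)) A.
Proof.
move=> r0 s0 mA; have mp := measurable_normal_pdf2 s0.
pose h (ux : R * R) := ((normal_pdf ux.1 s ux.2 * \1_A ux.2)%:E : \bar R).
have mh : measurable_fun [set: R * R] h.
  apply/measurable_EFinP; apply: measurable_funM => //.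
  have mi : measurable_fun [set: R] (\1_A : R -> R) by exact: measurable_indic.
  exact: (measurableT_comp mi measurable_snd).
have hE u : normal_prob u s A = \int[lebesgue_measure]_x h (u, x).
  rewrite /normal_prob integral_mkcond; apply: eq_integral => x _.
  by rewrite /h patchE indicE /=; case: ifPn => _; rewrite ?mulr1 ?mulr0.
have mint : measurable_fun [set: R] (fun u : R => \int[lebesgue_measure]_x h (u, x)).
  apply: (@measurable_fun_fubini_tonelli_F _ _ _ _ _ lebesgue_measure h) => // ux.
  by rewrite lee_fin mulr_ge0 ?normal_pdf_ge0// indicE ler0n.
under eq_integral do rewrite hE.
rewrite integral_normal_prob//; last first.
  by move=> u; apply: integral_ge0 => x _; rewrite lee_fin mulr_ge0 ?normal_pdf_ge0// indicE ler0n.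
pose k (ux : R * R) := (h ux * (normal_pdf 0 r ux.1)%:E).
have k0 ux : 0 <= k ux.
  by rewrite mule_ge0// lee_fin ?mulr_ge0 ?normal_pdf_ge0// indicE ler0n.
have mk : measurable_fun [set: R * R] k.
  apply: emeasurable_funM => //; apply/measurable_EFinP.
  exact: (measurableT_comp (measurable_normal_pdf 0 r) measurable_fst).
transitivity (\int[lebesgue_measure]_u \int[lebesgue_measure]_x k (u, x)).
  apply: eq_integral => u _; rewrite /k -ge0_integralZr//.
  - by apply: (measurableT_comp mh); exact: measurable_pair1.
  - by move=> x _; rewrite lee_fin mulr_ge0 ?normal_pdf_ge0// indicE ler0n.
  - by rewrite lee_fin normal_pdf_ge0.
rewrite (@fubini_tonelli _ _ _ _ _ lebesgue_measure lebesgue_measure k mk k0).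
rewrite [RHS]/normal_prob [RHS]integral_mkcond; apply: eq_integral => x _.
set t := Num.sqrt _; rewrite /k /h/=.
under eq_integral => u _.
  rewrite -EFinM mulrAC normal_pdf_convolution// mulrAC EFinM.
  over.
rewrite ge0_integralZl//; last 3 first.
- by apply/measurable_EFinP; exact: measurable_normal_pdf.
- by move=> u _; rewrite lee_fin normal_pdf_ge0.
- by rewrite lee_fin mulr_ge0 ?normal_pdf_ge0// indicE ler0n.
rewrite integral_normal_pdf mule1 patchE indicE /=.
by case: ifPn => _; rewrite ?mulr1 ?mulr0.
Qed.

End normal_law_integrals.

(** * Transfer of integrals to an image law *)

Section law.
Local Open Scope ereal_scope.

Lemma law_ge0_integral d (R : realType) (T : measurableType d)
  (P : probability T R) (X : T -> measurableTypeR R) (Q : probability (measurableTypeR R) R) (f : measurableTypeR R -> \bar R) :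
  measurable_fun [set: T] X ->
  (forall A : set R, measurable A -> P (X @^-1` A) = Q A) ->
  measurable_fun [set: measurableTypeR R] f -> (forall x, 0 <= f x) ->
  \int[P]_t f (X t) = \int[Q]_x f x.
Proof.
move=> mX PQ mf f0; transitivity (\int[pushforward P X]_x f x).
  by rewrite (ge0_integral_pushforward mX).
by apply: eq_measure_integral => A mA _; exact: PQ.
Qed.

Lemma law_integrable d (R : realType) (T : measurableType d)
  (P : probability T R) (X : T -> measurableTypeR R) (Q : probability (measurableTypeR R) R) (f : measurableTypeR R -> \bar R) :
  measurable_fun [set: T] X ->
  (forall A : set R, measurable A -> P (X @^-1` A) = Q A) ->
  Q.-integrable [set: measurableTypeR R] f -> P.-integrable [set: T] (f \o X).
Proof.
move=> mX PQ /integrableP[mf fi]; apply/integrableP; split.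
  exact: (measurableT_comp mf mX).
by rewrite (@law_ge0_integral _ _ _ P X Q (fun x => `|f x|)) //; exact: measurableT_comp.
Qed.

Lemma law_integral d (R : realType) (T : measurableType d)
  (P : probability T R) (X : T -> measurableTypeR R) (Q : probability (measurableTypeR R) R) (f : measurableTypeR R -> \bar R) :
  measurable_fun [set: T] X ->
  (forall A : set R, measurable A -> P (X @^-1` A) = Q A) ->
  Q.-integrable [set: measurableTypeR R] f ->
  \int[P]_t f (X t) = \int[Q]_x f x.
Proof.
move=> mX PQ fi; have iX := law_integrable mX PQ fi; have /integrableP[mf _] := fi.
transitivity (\int[pushforward P X]_x f x).
  by rewrite (integral_pushforward mX).
by apply: eq_measure_integral => A mA _; exact: PQ.
Qed.

End law.

Lemma Rintegral_cst_prob d (R : realType) (T : measurableType d) (P : probability T R) (c : R) :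
  \int[P]_x c = c.
Proof. by rewrite Rintegral_cst// [X in fine X](@probability_setT _ _ _ P) mulr1. Qed.

Lemma bounded_integrable d (R : realType) (T : measurableType d) (P : probability T R)
  (f : T -> R) (C : R) : measurable_fun [set: T] f -> (forall x, `|f x| <= C) ->
  P.-integrable [set: T] (EFin \o f).
Proof.
move=> mf fC; apply: (@le_integrable _ _ _ P setT measurableT _ (cst C%:E)).
- exact/measurable_EFinP.
- by move=> x _ /=; rewrite lee_fin (le_trans (fC x))// ler_norm.
- by apply: finite_measure_integrable_cst.
Qed.

(** * Moments and characteristic function of the standard normal law *)

Definition stdnormal (R : realType) : probability (measurableTypeR R) R := normal_prob 0 1.

(** Exponential tilting by a square turns the standard density into another normal density. The
    Gaussian integral obtained from it yields integrability of the moments and the value of the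
    variance. *)
Lemma expR_normal_pdf (R : realType) (s x : R) : 0 < s ->
  expR ((1 - s ^- 2) / 2 * x ^+ 2) * normal_pdf 0 1 x = s * normal_pdf 0 s x.
Proof.
move=> s0; have s0' : s != 0 by rewrite gt_eqF.
rewrite !normal_pdfE ?oner_neq0//= /normal_pdf /normal_peak /normal_fun/=.
have -> : Num.sqrt (s ^+ 2 * pi *+ 2) = s * Num.sqrt (1 ^+ 2 * pi *+ 2).
  by rewrite -mulrnAr sqrtrM ?sqr_ge0// sqrtr_sqr gtr0_norm// expr1n mul1r.
set P := Num.sqrt _; have sP z : s * ((s * P)^-1 * z) = P^-1 * z.
  by rewrite invfM -!mulrA mulVKf.
rewrite mulrCA -expRD sP.
by congr (_ * expR _); field.
Qed.

Lemma stdnormal_gaussian (R : realType) (s : R) : 0 < s ->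
  (\int[stdnormal R]_x (expR ((1 - s ^- 2) / 2 * x ^+ 2))%:E)%E = s%:E.
Proof.
move=> s0; have s0' : s != 0 by rewrite gt_eqF.
rewrite integral_normal_prob; last 2 first.
- apply/measurable_EFinP; apply: measurableT_comp => //.
  by apply: measurable_funM => //; exact: measurable_funX.
- by move=> x; rewrite lee_fin expR_ge0.
transitivity (\int[lebesgue_measure]_x (s%:E * (normal_pdf 0 s x)%:E))%E.
  by apply: eq_integral => x _; rewrite -!EFinM expR_normal_pdf.
rewrite ge0_integralZl//; first by rewrite integral_normal_pdf mule1.
- by apply/measurable_EFinP; exact: measurable_normal_pdf.
- by move=> x _; rewrite lee_fin normal_pdf_ge0.
- by rewrite lee_fin ltW.
Qed.

Lemma stdnormal_integrable_gaussian (R : realType) (s : R) : 0 < s ->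
  (stdnormal R).-integrable [set: measurableTypeR R]
    (fun x => (expR ((1 - s ^- 2) / 2 * x ^+ 2))%:E).
Proof.
move=> s0; apply/integrableP; split.
  apply/measurable_EFinP; apply: measurableT_comp => //.
  by apply: measurable_funM => //; exact: measurable_funX.
under eq_integral do rewrite gee0_abs ?lee_fin ?expR_ge0//.
by rewrite stdnormal_gaussian// ltry.
Qed.

(** For [s = Num.sqrt 2] the exponent is [y = x ^+ 2 / 4]. Since [1 + y ^+ 2 / 2 <= expR y], the
    fourth power [16 * y ^+ 2] is at most [32 * expR y], and one more [expR y] covers the constant
    1. *)
Lemma pow_le_expR_sqr (R : realType) (k : nat) (x : R) : (k <= 4)%N ->
  `|x| ^+ k <= 33 * expR ((1 - (Num.sqrt 2) ^- 2) / 2 * x ^+ 2).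
Proof.
move=> k4; have -> : (1 - (Num.sqrt 2) ^- 2) / 2 * x ^+ 2 = x ^+ 2 / 4.
  by rewrite sqr_sqrtr//; field.
have x40 : 0 <= x ^+ 2 / 4 by rewrite divr_ge0// sqr_ge0.
have h := expR_ge1Dxn 1 x40.
have h1 : 1 <= expR (x ^+ 2 / 4) by rewrite -[leLHS]expR0 ler_expR.
have x4 : 0 <= x ^+ 4 by rewrite -[x ^+ 4]/(x ^+ (2 * 2)) exprM sqr_ge0.
apply: (@le_trans _ _ (1 + x ^+ 4)).
  have [x1|x1] := leP `|x| 1.
    by rewrite (le_trans (exprn_ile1 _ (normr_ge0 x) x1))// lerDl.
  apply: (@le_trans _ _ (`|x| ^+ 4)); first by rewrite ler_weXn2l// (ltW x1).
  by rewrite -normrX ger0_norm ?lerDr.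
have e4 : x ^+ 4 = 16 * (x ^+ 2 / 4) ^+ 2 by field.
rewrite e4; move: h; rewrite -[2`!%:R]/(2 : R); lra.
Qed.

Lemma stdnormal_integrable_pow (R : realType) (k : nat) : (k <= 4)%N ->
  (stdnormal R).-integrable [set: measurableTypeR R] (fun x : R => (x ^+ k)%:E).
Proof.
move=> k4; have s0 : (0 : R) < Num.sqrt 2 by rewrite sqrtr_gt0.
apply: (@le_integrable _ _ _ (stdnormal R) setT measurableT (fun x : R => (x ^+ k)%:E)
  (fun x : R => (33 * expR ((1 - (Num.sqrt 2) ^- 2) / 2 * x ^+ 2))%:E)).
- by apply/measurable_EFinP; exact: measurable_funX.
- move=> x _ /=; rewrite lee_fin [leRHS]ger0_norm ?mulr_ge0 ?expR_ge0// normrX.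
  exact: pow_le_expR_sqr.
- have := integrableZl measurableT 33 (stdnormal_integrable_gaussian s0).
  by under eq_fun do rewrite -EFinM.
Qed.

Lemma stdnormal_odd (R : realType) (f : R -> R) :
  (stdnormal R).-integrable [set: measurableTypeR R] (EFin \o f) -> (forall x, f (- x) = - f x) ->
  \int[stdnormal R]_x f x = 0.
Proof.
move=> fi fodd.
have mN : measurable_fun [set: measurableTypeR R] (-%R : R -> measurableTypeR R).
  exact: oppr_measurable.
have := law_integral (P := stdnormal R) mN (@normal_prob_sym R) fi.
move=> /(congr1 fine) H.
have : \int[stdnormal R]_x f x = \int[stdnormal R]_x (-1 * f x).
  rewrite [LHS](esym H) /Rintegral; congr fine; apply: eq_integral => x _ /=.
  by rewrite fodd mulN1r.
rewrite RintegralZl//; lra.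
Qed.

(** Integrate [1 + a * x ^+ 2 <= expR (a * x ^+ 2)], whose right side has integral [s]. *)
Lemma stdnormal_sqr_ineq (R : realType) (s : R) : 0 < s ->
  (1 - s ^- 2) / 2 * \int[stdnormal R]_x x ^+ 2 <= s - 1.
Proof.
move=> s0; have i2 := @stdnormal_integrable_pow R 2 isT.
have ig := stdnormal_integrable_gaussian s0.
have i1 : (stdnormal R).-integrable [set: measurableTypeR R] (EFin \o cst 1).
  exact: finite_measure_integrable_cst.
set a := (1 - s ^- 2) / 2.
have i2a := integrableZl measurableT a i2.
have {}i2a : (stdnormal R).-integrable [set: measurableTypeR R] (EFin \o (fun x : R => a * x ^+ 2)).
  by apply: eq_integrable i2a => // x _ /=; rewrite EFinM.
rewrite -RintegralZl// -lerBDr opprK.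
have e1 : \int[stdnormal R]_x (expR (a * x ^+ 2)) = s by rewrite /Rintegral stdnormal_gaussian.
rewrite -[leRHS]e1 -[X in _ + X](Rintegral_cst_prob (stdnormal R) 1) -RintegralD//.
apply: le_Rintegral => //.
  by apply: eq_integrable (integrableD measurableT i2a i1) => // x _ /=; rewrite -EFinD.
by move=> x _; rewrite addrC expR_ge1Dx.
Qed.

(** The factor [1 - s ^- 2] has the sign of [s - 1], so the inequality bounds the variance from
    above for [s = 1 + e] and from below for [s = 1 - e]; both bounds tend to 1 with [e]. *)
Lemma stdnormal_sqr (R : realType) : \int[stdnormal R]_x x ^+ 2 = 1.
Proof.
have := @stdnormal_sqr_ineq R; set Y := (\int[_]_x _) => key.
apply/eqP; rewrite eq_le; apply/andP; split.
- apply/ler_addgt0Pr => e' e'0; pose e := e' / 2.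
  have e0 : 0 < e by rewrite divr_gt0.
  have -> : e' = 2 * e by rewrite /e; field.
  have s0 : 0 < 1 + e by lra.
  have := key _ s0; have s2 : 0 < (1 + e) ^+ 2 by rewrite exprn_gt0.
  rewrite -(ler_pM2r s2).
  have -> : (1 - (1 + e) ^- 2) / 2 * Y * (1 + e) ^+ 2 = Y * (e * (2 + e) / 2).
    by field; rewrite gt_eqF.
  have -> : (1 + e - 1) * (1 + e) ^+ 2 = (1 + e) ^+ 2 * e by ring.
  have -> : Y * (e * (2 + e) / 2) = (Y * ((2 + e) / 2)) * e by ring.
  rewrite ler_pM2r// => h.
  have : Y * ((2 + e) / 2) <= (1 + 2 * e) * ((2 + e) / 2) by apply: (le_trans h); nra.
  by rewrite ler_pM2r//; lra.
- apply/ler_addgt0Pl => e' e'0; pose e := Num.min (e' / 2) (1 / 2).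
  have e0 : 0 < e by rewrite lt_min !divr_gt0.
  have ee : e <= 1 / 2 by rewrite ge_min lexx orbT.
  have ee' : e <= e' / 2 by rewrite ge_min lexx.
  have s0 : 0 < 1 - e by lra.
  have := key _ s0; have s2 : 0 < (1 - e) ^+ 2 by rewrite exprn_gt0.
  rewrite -(ler_pM2r s2).
  have -> : (1 - (1 - e) ^- 2) / 2 * Y * (1 - e) ^+ 2 = - (Y * ((2 - e) / 2)) * e.
    by field; rewrite gt_eqF.
  have -> : (1 - e - 1) * (1 - e) ^+ 2 = - (1 - e) ^+ 2 * e by ring.
  rewrite ler_pM2r// lerN2 => h.
  have Y0 : 0 <= Y by apply: Rintegral_ge0 => x _; exact: sqr_ge0.
  have : Y * ((2 - e) / 2) <= Y by rewrite ler_piMr//; lra.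
  have e2 : (1 - e) ^+ 2 = 1 - 2 * e + e ^+ 2 by ring.
  rewrite e2 in h; have := sqr_ge0 e; lra.
Qed.

Lemma cos_taylor4 (R : realType) (x : R) : `|cos x - (1 - x ^+ 2 / 2)| <= x ^+ 4 / 24.
Proof.
have -> : 1 - x ^+ 2 / 2 = cosT 2 x.
  by rewrite /= -[(1.*2)`!%:R]/(2 : R) -[1.*2]/2%N double0 fact0 !expr0 expr1; field.
have -> : x ^+ 4 = `|x| ^+ 4.
  by rewrite -normrX ger0_norm// -[x ^+ 4]/(x ^+ (2 * 2)) exprM sqr_ge0.
exact: (cos_taylor 2 x).
Qed.

(** The characteristic function of the standard normal law; its imaginary part vanishes by
    symmetry. *)
Definition nchf (R : realType) (r : R) : R := \int[stdnormal R]_x cos (r * x).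

Lemma measurable_cos_dil (R : realType) (r : R) :
  measurable_fun [set: measurableTypeR R] (fun x : R => cos (r * x)).
Proof.
apply: continuous_measurable_fun => x; apply: (cvg_comp (fun x : R => r * x) cos).
  by apply: cvgM; [exact: cvg_cst|exact: cvg_id].
exact: continuous_cos.
Qed.

Lemma measurable_sin_dil (R : realType) (r : R) :
  measurable_fun [set: measurableTypeR R] (fun x : R => sin (r * x)).
Proof.
apply: continuous_measurable_fun => x; apply: (cvg_comp (fun x : R => r * x) sin).
  by apply: cvgM; [exact: cvg_cst|exact: cvg_id].
exact: continuous_sin.
Qed.

Lemma integrable_cos_dil (R : realType) (P : probability (measurableTypeR R) R) (r : R) :
  P.-integrable [set: measurableTypeR R] (EFin \o (fun x : R => cos (r * x))).
Proof.
apply: (@bounded_integrable _ _ _ P _ 1); first exact: measurable_cos_dil.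
by move=> x; rewrite ler_norml cos_geN1 cos_le1.
Qed.

Lemma integrable_sin_dil (R : realType) (P : probability (measurableTypeR R) R) (r : R) :
  P.-integrable [set: measurableTypeR R] (EFin \o (fun x : R => sin (r * x))).
Proof.
apply: (@bounded_integrable _ _ _ P _ 1); first exact: measurable_sin_dil.
by move=> x; rewrite ler_norml sin_geN1 sin_le1.
Qed.

Lemma nsin0 (R : realType) (r : R) : \int[stdnormal R]_x sin (r * x) = 0.
Proof.
apply: (@stdnormal_odd R (fun x => sin (r * x))); first exact: integrable_sin_dil.
by move=> x; rewrite mulrN sinN.
Qed.

(** Both terms are compared with [1 - r ^+ 2 / 2]: the cosine through its fourth-order Taylor bound
    and unit variance, the exponential through [expRN_quad]. *)
Lemma nchf_small (R : realType) : exists C, forall r : R, `|nchf r - expR (- (r ^+ 2 / 2))| <= C * r ^+ 4.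
Proof.
pose m4 := \int[stdnormal R]_x x ^+ 4.
exists (m4 / 24 + 1 / 4) => r.
have i2 := @stdnormal_integrable_pow R 2 isT.
have i4 := @stdnormal_integrable_pow R 4 isT.
have ic := integrable_cos_dil (stdnormal R) r.
have i1 : (stdnormal R).-integrable [set: measurableTypeR R] (EFin \o cst 1).
  exact: finite_measure_integrable_cst.
have i2a : (stdnormal R).-integrable [set: measurableTypeR R] (EFin \o (fun x : R => - (r ^+ 2 / 2) * x ^+ 2)).
  by apply: eq_integrable (integrableZl measurableT (- (r ^+ 2 / 2)) i2) => // x _ /=; rewrite EFinM.
have i4a : (stdnormal R).-integrable [set: measurableTypeR R] (EFin \o (fun x : R => r ^+ 4 / 24 * x ^+ 4)).
  by apply: eq_integrable (integrableZl measurableT (r ^+ 4 / 24) i4) => // x _ /=; rewrite EFinM.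
have i12 : (stdnormal R).-integrable [set: measurableTypeR R] (EFin \o (fun x : R => 1 - r ^+ 2 / 2 * x ^+ 2)).
  by apply: eq_integrable (integrableD measurableT i1 i2a) => // x _ /=; rewrite -EFinD mulNr.
have e12 : \int[stdnormal R]_x (1 - r ^+ 2 / 2 * x ^+ 2) = 1 - r ^+ 2 / 2.
  transitivity (\int[stdnormal R]_x (1 + - (r ^+ 2 / 2) * x ^+ 2)).
    by apply: eq_Rintegral => x _; rewrite mulNr.
  by rewrite RintegralD// Rintegral_cst_prob RintegralZl// stdnormal_sqr mulr1.
have h1 : `|nchf r - (1 - r ^+ 2 / 2)| <= m4 / 24 * r ^+ 4.
  rewrite -e12 -RintegralB//.
  apply: (le_trans (le_normr_Rintegral _ _)) => //.
    by apply: eq_integrable (integrableB measurableT ic i12) => // x _ /=; rewrite -EFinB.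
  have -> : m4 / 24 * r ^+ 4 = \int[stdnormal R]_x (r ^+ 4 / 24 * x ^+ 4).
    by rewrite RintegralZl// -/m4; ring.
  apply: le_Rintegral => //.
    apply: integrable_norm => //.
    by apply: eq_integrable (integrableB measurableT ic i12) => // x _ /=; rewrite -EFinB.
  move=> x _; have := cos_taylor4 (r * x).
  by rewrite !exprMn; congr (_ <= _); [congr (`|_|)|]; ring.
have r20 : 0 <= r ^+ 2 / 2 by rewrite divr_ge0// sqr_ge0.
have h2 := expRN_quad r20.
rewrite -(subrKA (1 - r ^+ 2 / 2)) (le_trans (ler_normD _ _))//.
rewrite [X in _ + X]distrC mulrDl lerD//.
by rewrite (le_trans h2)// le_eqVlt; apply/orP; left; apply/eqP; field.
Qed.

Lemma normal_cos (R : realType) (r a : R) : r != 0 ->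
  \int[normal_prob 0 r]_x cos (a * x) = nchf (a * r).
Proof.
move=> r0.
have maff : measurable_fun [set: measurableTypeR R] (fun y : R => 0 + r * y : measurableTypeR R).
  exact: measurable_fun_affine.
have ic := @integrable_cos_dil R (normal_prob 0 r) a.
have law (A : set R) : measurable A -> stdnormal R ((fun y : R => 0 + r * y) @^-1` A) = normal_prob 0 r A.
  by move=> mA; exact: normal_prob_affine.
have /(congr1 fine) H := law_integral (P := stdnormal R) (Q := normal_prob 0 r) maff law ic.
rewrite /Rintegral -[LHS]H; congr fine; apply: eq_integral => x _ /=.
by rewrite add0r mulrA.
Qed.

Lemma normal_sin (R : realType) (r a : R) : r != 0 ->
  \int[normal_prob 0 r]_x sin (a * x) = 0.
Proof.
move=> r0.
have maff : measurable_fun [set: measurableTypeR R] (fun y : R => 0 + r * y : measurableTypeR R).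
  exact: measurable_fun_affine.
have ic := @integrable_sin_dil R (normal_prob 0 r) a.
have law (A : set R) : measurable A -> stdnormal R ((fun y : R => 0 + r * y) @^-1` A) = normal_prob 0 r A.
  by move=> mA; exact: normal_prob_affine.
have /(congr1 fine) H := law_integral (P := stdnormal R) (Q := normal_prob 0 r) maff law ic.
rewrite -[RHS](nsin0 (a * r)) /Rintegral -[LHS]H; congr fine; apply: eq_integral => x _ /=.
by rewrite add0r mulrA.
Qed.

Lemma normal_sqr (R : realType) (r : R) : r != 0 ->
  (normal_prob 0 r).-integrable [set: measurableTypeR R] (fun x : R => (x ^+ 2)%:E) /\
  \int[normal_prob 0 r]_x x ^+ 2 = r ^+ 2.
Proof.
move=> r0.
have maff : measurable_fun [set: measurableTypeR R] (fun y : R => 0 + r * y : measurableTypeR R).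
  exact: measurable_fun_affine.
have law (A : set R) : measurable A -> stdnormal R ((fun y : R => 0 + r * y) @^-1` A) = normal_prob 0 r A.
  by move=> mA; exact: normal_prob_affine.
have m2 : measurable_fun [set: measurableTypeR R] (fun x : R => (x ^+ 2)%:E).
  by apply/measurable_EFinP; exact: measurable_funX.
have p2 (x : R) : (0 <= (x ^+ 2)%:E)%E by rewrite lee_fin sqr_ge0.
have H := law_ge0_integral (P := stdnormal R) (Q := normal_prob 0 r) maff law m2 p2.
have E : (\int[normal_prob 0 r]_x (x ^+ 2)%:E = (r ^+ 2)%:E)%E.
  rewrite -H.
  have i2 := @stdnormal_integrable_pow R 2 isT.
  transitivity (\int[stdnormal R]_x ((r ^+ 2)%:E * (x ^+ 2)%:E))%E.
    by apply: eq_integral => x _; rewrite add0r exprMn EFinM.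
  rewrite (integralZl measurableT i2).
  have := stdnormal_sqr R; rewrite /Rintegral => e.
  have fn := integrable_fin_num measurableT i2.
  have -> : (\int[stdnormal R]_x (x ^+ 2)%:E)%E = 1%:E by rewrite -(fineK fn) e.
  by rewrite mule1.
split; last by rewrite /Rintegral E.
apply/integrableP; split; first exact: m2.
have E' : (\int[normal_prob 0 r]_x `|(x ^+ 2)%:E| = (r ^+ 2)%:E)%E.
  by apply: etrans E; apply: eq_integral => x _; rewrite gee0_abs.
by rewrite E'; exact: ltry.
Qed.

Lemma measurable_normal_prob_mean (R : realType) (s : R) (A : set R) :
  s != 0 -> measurable A ->
  measurable_fun [set: measurableTypeR R] (fun u : R => normal_prob u s A).
Proof.
move=> s0 mA; have mp := measurable_normal_pdf2 s0.
pose h (ux : R * R) := ((normal_pdf ux.1 s ux.2 * \1_A ux.2)%:E : \bar R).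
have mh : measurable_fun [set: R * R] h.
  apply/measurable_EFinP; apply: measurable_funM => //.
  have mi : measurable_fun [set: R] (\1_A : R -> R) by exact: measurable_indic.
  exact: (measurableT_comp mi measurable_snd).
have -> : (fun u => normal_prob u s A) = (fun u : R => \int[lebesgue_measure]_x h (u, x))%E.
  apply/funext => u; rewrite /normal_prob integral_mkcond; apply: eq_integral => x _.
  by rewrite /h patchE indicE /=; case: ifPn => _; rewrite ?mulr1 ?mulr0.
apply: (@measurable_fun_fubini_tonelli_F _ _ _ _ _ lebesgue_measure h) => // ux.
by rewrite lee_fin mulr_ge0 ?normal_pdf_ge0// indicE ler0n.
Qed.

(** For fixed first component the section has the normal law of mean [U t] and deviation [s];
    averaging these over the law of [U] is a convolution. *)
Lemma normal_law_add d (R : realType) (T : measurableType d) (P : probability T R)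
    (U : T -> measurableTypeR R) (r s : R) : 0 < r -> s != 0 ->
  measurable_fun [set: T] U ->
  (forall A : set R, measurable A -> P (U @^-1` A) = normal_prob 0 r A) ->
  forall A : set R, measurable A ->
  (P \x stdnormal R)%E [set z : T * measurableTypeR R | A (U z.1 + s * z.2)]
  = normal_prob 0 (Num.sqrt (r ^+ 2 + s ^+ 2)) A.
Proof.
move=> r0 s0 mU law A mA; transitivity (\int[P]_t normal_prob (U t) s A)%E.
  rewrite /product_measure1 /product_subprobability/=; apply: eq_integral => t _ /=.
  rewrite -(normal_prob_affine _ s0 mA); congr (normal_prob 0 1 _).
  by apply/seteqP; split => y; rewrite /xsection/= ?inE.
rewrite -(normal_prob_convolution r0 s0 mA).
apply: (law_ge0_integral (Q := normal_prob 0 r) (f := fun u => normal_prob u s A) mU law).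
  exact: measurable_normal_prob_mean.
by move=> x; exact: measure_ge0.
Qed.

Lemma Rintegral_prod_mul d (R : realType) (T : measurableType d) (P : probability T R)
    (Q : probability (measurableTypeR R) R) (f : T -> R) (h : R -> R) (C D : R) :
  measurable_fun [set: T] f -> measurable_fun [set: measurableTypeR R] h ->
  (forall x, `|f x| <= C) -> (forall x, `|h x| <= D) ->
  \int[(P \x Q)%E]_z (f z.1 * h z.2) = (\int[P]_t f t) * (\int[Q]_y h y).
Proof.
move=> mf mh fC hD.
have mF : measurable_fun [set: T * measurableTypeR R] (fun z => f z.1 * h z.2).
  apply: measurable_funM; first exact: (measurableT_comp mf measurable_fst).
  exact: (measurableT_comp mh measurable_snd).
have iF : (P \x Q)%E.-integrable setT (EFin \o (fun z => f z.1 * h z.2)).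
  apply: (@bounded_integrable _ _ _ (P \x Q)%E _ (C * D)) => // z.
  by rewrite normrM ler_pM.
have ih : Q.-integrable setT (EFin \o h) by apply: (bounded_integrable Q mh hD).
have if_ : P.-integrable setT (EFin \o f) by apply: (bounded_integrable P mf fC).
rewrite {1}/Rintegral -(integral12_prod_meas1 iF) /fubini_F/=.
transitivity (\int[P]_t (f t * \int[Q]_y h y)); last by rewrite RintegralZr.
congr fine; apply: eq_integral => t _.
transitivity ((f t)%:E * \int[Q]_y (h y)%:E)%E.
  rewrite -(integralZl measurableT ih); apply: eq_integral => y _ /=.
  by rewrite EFinM.
by rewrite /Rintegral EFinM fineK//; exact: (integrable_fin_num measurableT ih).
Qed.

Lemma Rintegral_prod_cos d (R : realType) (T : measurableType d) (P : probability T R)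
    (U : T -> measurableTypeR R) (s : R) : measurable_fun [set: T] U ->
  \int[(P \x stdnormal R)%E]_z cos ((U z.1 : R) + s * z.2) = (\int[P]_t cos (U t : R)) * nchf s.
Proof.
move=> mU.
have mc : measurable_fun [set: T] (fun t => cos (U t : R)).
  by apply: measurableT_comp => //; exact: continuous_measurable_fun (@continuous_cos R).
have ms : measurable_fun [set: T] (fun t => sin (U t : R)).
  by apply: measurableT_comp => //; exact: continuous_measurable_fun (@continuous_sin R).
have bc (x : R) : `|cos x| <= 1 by rewrite ler_norml cos_geN1 cos_le1.
have bs (x : R) : `|sin x| <= 1 by rewrite ler_norml sin_geN1 sin_le1.
have mcs := @measurable_cos_dil R s; have mss := @measurable_sin_dil R s.
have e1 := @Rintegral_prod_mul _ R T P (stdnormal R) _ _ 1 1 mc mcs (fun=> bc _) (fun=> bc _).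
have e2 := @Rintegral_prod_mul _ R T P (stdnormal R) _ _ 1 1 ms mss (fun=> bs _) (fun=> bs _).
rewrite -/(nchf s) in e1; rewrite nsin0 mulr0 in e2.
rewrite -e1 -[RHS]subr0 -[X in _ - X]e2 -RintegralB//.
- by apply: eq_Rintegral => z _; rewrite cosD.
- apply: (@bounded_integrable _ _ _ (P \x stdnormal R)%E _ 1).
    apply: measurable_funM; first exact: (measurableT_comp mc measurable_fst).
    exact: (measurableT_comp mcs measurable_snd).
  by move=> z; rewrite normrM mulr_ile1.
- apply: (@bounded_integrable _ _ _ (P \x stdnormal R)%E _ 1).
    apply: measurable_funM; first exact: (measurableT_comp ms measurable_fst).
    exact: (measurableT_comp mss measurable_snd).
  by move=> z; rewrite normrM mulr_ile1.
Qed.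

(** The sum of independent centered normal variables of deviations [r] and [s] has deviation the
    square root of [r ^+ 2 + s ^+ 2]. In the addition formula for the cosine the sine term
    integrates to zero. *)
Lemma nchf_mul (R : realType) (r s : R) : 0 < r -> 0 < s ->
  nchf (Num.sqrt (r ^+ 2 + s ^+ 2)) = nchf r * nchf s.
Proof.
move=> r0 s0; have r0' : r != 0 by rewrite gt_eqF.
have s0' : s != 0 by rewrite gt_eqF.
set t := Num.sqrt (r ^+ 2 + s ^+ 2).
have t0 : t != 0 by rewrite gt_eqF// sqrtr_gt0 ltr_pwDl ?exprn_gt0// sqr_ge0.
pose N1 : probability (measurableTypeR R) R := normal_prob 0 r.
have mid : measurable_fun setT (idfun : measurableTypeR R -> measurableTypeR R) by exact: measurable_id.
have law (A : set R) : measurable A -> N1 (idfun @^-1` A) = normal_prob 0 r A by [].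
have LL := normal_law_add (P := N1) r0 s0' mid law.
have mX : measurable_fun [set: measurableTypeR R * measurableTypeR R]
    (fun z : measurableTypeR R * measurableTypeR R => (z.1 : R) + s * z.2 : measurableTypeR R).
  by apply: measurable_funD => //; apply: measurable_funM.
have /(congr1 fine) H := law_integral (P := (N1 \x stdnormal R)%E) (Q := normal_prob 0 t) mX LL
  (@integrable_cos_dil R (normal_prob 0 t) 1).
have E1 : \int[normal_prob 0 t]_x cos (1 * x) = nchf t := etrans (normal_cos 1 t0) (congr1 _ (mul1r t)).
have E2 : \int[N1]_x cos (1 * x) = nchf r := etrans (normal_cos 1 r0') (congr1 _ (mul1r r)).
rewrite -E1 -E2 {1}/Rintegral -H.
under [X in X * _]eq_Rintegral do rewrite mul1r.
rewrite -(@Rintegral_prod_cos _ R _ N1 idfun s mid) /Rintegral; congr fine.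
by apply: eq_integral => z _ /=; rewrite mul1r.
Qed.

Lemma nchf_sqrt_nat (R : realType) (h : R) (k : nat) : 0 < h ->
  nchf (Num.sqrt k.+1%:R * h) = nchf h ^+ k.+1.
Proof.
move=> h0; elim: k => [|k IH]; first by rewrite sqrtr1 mul1r expr1.
rewrite exprSr -IH -nchf_mul ?mulr_gt0 ?sqrtr_gt0//.
congr nchf; rewrite exprMn sqr_sqrtr// -{2}(mul1r (h ^+ 2)) -mulrDl natr1.
by rewrite sqrtrM ?ler0n// sqrtr_sqr gtr0_norm.
Qed.

Lemma nchf_le1 (R : realType) (r : R) : `|nchf r| <= 1.
Proof.
have ic := integrable_cos_dil (stdnormal R) r.
apply: (le_trans (le_normr_Rintegral measurableT ic)).
rewrite -[leRHS](Rintegral_cst_prob (stdnormal R) 1).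
apply: le_Rintegral => //.
- by apply: integrable_norm.
- exact: (finite_measure_integrable_cst (stdnormal R) 1).
- by move=> x _; rewrite ler_norml cos_geN1 cos_le1.
Qed.

Lemma pow_diff_le (R : realType) (a b : R) (k : nat) : `|a| <= 1 -> `|b| <= 1 ->
  `|a ^+ k - b ^+ k| <= k%:R * `|a - b|.
Proof.
move=> a1 b1; elim: k => [|k IH]; first by rewrite !expr0 subrr normr0 mul0r.
have -> : a ^+ k.+1 - b ^+ k.+1 = a * (a ^+ k - b ^+ k) + (a - b) * b ^+ k.
  by rewrite !exprS; ring.
rewrite (le_trans (ler_normD _ _))// !normrM -natr1 mulrDl mul1r lerD//.
  by rewrite (le_trans _ IH)// ler_piMl.
by rewrite ler_piMr// normrX exprn_ile1.
Qed.

(* [nchf r = nchf (r / sqrt k) ^+ k], and both sides agree to fourth order at 0. *)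
Lemma nchfE (R : realType) (r : R) : nchf r = expR (- (r ^+ 2 / 2)).
Proof.
wlog r0 : r / 0 < r.
  move=> H; have [/H//|] := ltP 0 r; rewrite le_eqVlt => /orP[/eqP->|r0].
    rewrite expr0n mul0r oppr0 expR0 /nchf -[RHS](Rintegral_cst_prob (stdnormal R) 1).
    by apply: eq_Rintegral => x _; rewrite mul0r cos0.
  rewrite -sqrrN -H ?oppr_gt0// /nchf; apply: eq_Rintegral => x _.
  by rewrite mulNr cosN.
have [C HC] := nchf_small R.
suff : `|nchf r - expR (- (r ^+ 2 / 2))| <= 0 by rewrite normr_le0 subr_eq0 => /eqP.
(* The error at [h] is at most [C * h ^+ 4] with [h ^+ 2 = r ^+ 2 / k.+1], and taking the power
   multiplies it by at most [k.+1]; one factor [k.+1] remains in the denominator. *)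
have bound k : `|nchf r - expR (- (r ^+ 2 / 2))| <= C * r ^+ 4 / k.+1%:R.
  have k0 : (0 : R) < k.+1%:R by rewrite ltr0n.
  have q0 : 0 < Num.sqrt k.+1%:R :> R by rewrite sqrtr_gt0.
  pose h := r / Num.sqrt k.+1%:R.
  have h0 : 0 < h by rewrite divr_gt0.
  have rE : r = Num.sqrt k.+1%:R * h by rewrite /h mulrC divfK// gt_eqF.
  have h2 : h ^+ 2 = r ^+ 2 / k.+1%:R by rewrite expr_div_n sqr_sqrtr ?ltW.
  have -> : expR (- (r ^+ 2 / 2)) = expR (- (h ^+ 2 / 2)) ^+ k.+1.
    by rewrite -expRM_natr h2; congr expR; field; rewrite gt_eqF.
  rewrite {1}rE nchf_sqrt_nat//.
  have e1 : `|expR (- (h ^+ 2 / 2))| <= 1.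
    by rewrite ger0_norm ?expR_ge0// -expR0 ler_expR oppr_le0 divr_ge0// sqr_ge0.
  apply: (le_trans (pow_diff_le _ (nchf_le1 h) e1)).
  apply: (@le_trans _ _ (k.+1%:R * (C * h ^+ 4))); first by rewrite ler_wpM2l ?ler0n.
  rewrite -[h ^+ 4]/(h ^+ (2 * 2)) exprM h2 le_eqVlt; apply/orP; left; apply/eqP.
  by field; rewrite gt_eqF.
apply/ler_addgt0Pr => e e0; rewrite add0r.
pose D := C * r ^+ 4.
apply: (le_trans (bound (Num.truncn (`|D| / e)))).
rewrite -/D ler_pdivrMr ?ltr0n// mulrC -ler_pdivrMr//.
apply: (@le_trans _ _ (`|D| / e)); first by rewrite ler_pM2r ?invr_gt0// ler_norm.
by rewrite ltW// truncnS_gt.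
Qed.

(** * Existence of centered Gaussian vectors *)

Lemma normal_law_of_sqr (R : realType) (s : R) (A : set R) :
  normal_law 0 s A = normal_law 0 (Num.sqrt (s ^+ 2)) A.
Proof.
rewrite /normal_law sqrtr_sqr normr_eq0; case: ifP => // _.
by have [s0|s0] := ger0P s; rewrite ?normal_prob_opp.
Qed.

Definition normsq (R : realType) n (c : 'rV[R]_n) : R := \sum_i c 0 i ^+ 2.

(** The joint law is recorded through linear forms only. The induction adds a standard normal factor
    to the product space; a vanishing new coefficient or a vanishing old part is treated separately,
    because the convolution formula requires nonzero deviations. *)
Lemma iid_normal_exists (R : realType) (n : nat) :
  exists d (T : measurableType d) (P : probability T R) (X : 'I_n -> T -> measurableTypeR R),
  (forall i, measurable_fun [set: T] (X i)) /\
  forall (c : 'rV[R]_n) (A : set R), measurable A ->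
    P [set t | A (\sum_i c 0 i * X i t)] = normal_law 0 (Num.sqrt (normsq c)) A.
Proof.
elim: n => [|n [d [T [P [X [mX law]]]]]].
  exists _, (measurableTypeR R), (stdnormal R), (fun _ _ => 0); split=> [[]//|c A mA].
  rewrite /normsq !big_ord0 sqrtr0 /normal_law eqxx.
  have [A0|A0] := pselect (A 0).
    rewrite (_ : [set t | _] = setT) ?probability_setT ?diracE ?mem_set//.
    by apply/seteqP; split => t //= _; rewrite big_ord0.
  rewrite (_ : [set t | _] = set0) ?measure0 ?diracE ?memNset//.
  by apply/seteqP; split => t //=; rewrite big_ord0.
pose X' (i : 'I_n.+1) (z : T * measurableTypeR R) : measurableTypeR R :=
  if unlift ord0 i is Some j then X j z.1 else z.2.
exists _, (T * measurableTypeR R)%type, (P \x stdnormal R)%E, X'; split=> [i|c A mA].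
  rewrite /X'; case: (unlift ord0 i) => [j|]; last exact: measurable_snd.
  exact: (measurableT_comp (mX j) measurable_fst).
pose c' : 'rV[R]_n := \row_i c 0 (lift ord0 i).
pose U (t : T) : measurableTypeR R := \sum_i c' 0 i * X i t.
have mU : measurable_fun [set: T] U.
  apply: measurable_sum => i; apply: measurable_funM; [exact: measurable_cst|exact: mX].
have EX z : \sum_i c 0 i * X' i z = (U z.1 : R) + c 0 ord0 * z.2.
  rewrite big_ord_recl /X' unlift_none addrC; congr (_ + _).
  by apply: eq_bigr => i _; rewrite liftK mxE.
have En : normsq c = normsq c' + c 0 ord0 ^+ 2.
  by rewrite /normsq big_ord_recl addrC; congr (_ + _); apply: eq_bigr => i _; rewrite mxE.
have nn : 0 <= normsq c' by apply: sumr_ge0 => i _; exact: sqr_ge0.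
rewrite (_ : [set t | _] = [set z : T * measurableTypeR R | A ((U z.1 : R) + c 0 ord0 * z.2)]); last first.
  by apply/seteqP; split => z /=; rewrite EX.
have lawU (B : set R) : measurable B -> P (U @^-1` B) = normal_law 0 (Num.sqrt (normsq c')) B.
  by move=> mB; rewrite -law.
have sec : (P \x stdnormal R)%E [set z : T * measurableTypeR R | A ((U z.1 : R) + c 0 ord0 * z.2)]
    = (\int[P]_t stdnormal R [set y : R | A ((U t : R) + c 0 ord0 * y)%R])%E.
  rewrite /product_measure1 /product_subprobability/=; apply: eq_integral => t _ /=.
  by congr (stdnormal R _); apply/seteqP; split => y; rewrite /xsection/= ?inE.
have [c0|c0] := eqVneq (c 0 ord0) 0.
  apply: (etrans sec); rewrite En c0 expr0n addr0 -lawU//.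
  rewrite (eq_integral (fun t => (\1_(U @^-1` A) t)%:E)).
    rewrite integral_indic ?setIT//.
    by rewrite -[X in measurable X]setTI; exact: mU.
  move=> t _; rewrite indicE; have [At|At] := pselect (A (U t)).
    rewrite mem_set// (_ : [set y | _] = setT) ?probability_setT//.
    by apply/seteqP; split => y //= _; rewrite mul0r addr0.
  rewrite memNset// (_ : [set y | _] = set0) ?measure0//.
  by apply/seteqP; split => y //=; rewrite mul0r addr0.
(* Here the old part [U] has the Dirac law at 0, so the integral over its law is evaluated at the
   single mean 0. *)
have [n0|n0] := eqVneq (normsq c') 0.
  have lawD (B : set R) : measurable B -> P (U @^-1` B) = (\d_(0 : measurableTypeR R) : probability _ R) B.
    by move=> mB; rewrite lawU// n0 sqrtr0 /normal_law eqxx.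
  apply: (etrans sec); rewrite En n0 add0r -normal_law_of_sqr /normal_law (negbTE c0).
  transitivity (\int[P]_t normal_prob (U t) (c 0 ord0)%R A)%E.
    by apply: eq_integral => t _; rewrite -normal_prob_affine.
  rewrite (law_ge0_integral (Q := \d_(0 : measurableTypeR R))
    (f := fun u => normal_prob u (c 0 ord0) A) mU lawD)//.
  - rewrite integral_dirac//; last exact: measurable_normal_prob_mean.
    by apply: etrans (mul1e _); congr (_ * _)%E; exact: diracT.
  - exact: measurable_normal_prob_mean.
have q0 : 0 < Num.sqrt (normsq c') by rewrite sqrtr_gt0 lt_neqAle eq_sym n0.
have lawN (B : set R) : measurable B -> P (U @^-1` B) = normal_prob 0 (Num.sqrt (normsq c')) B.
  by move=> mB; rewrite lawU// /normal_law gt_eqF.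
apply: (etrans (normal_law_add q0 c0 mU lawN mA)).
rewrite sqr_sqrtr// -En /normal_law gt_eqF//.
by rewrite sqrtr_gt0 En ltr_pwDl ?sqr_ge0// lt_neqAle eq_sym n0.
Qed.

(** * Factorization of the covariance and the Gaussian law *)

Definition psd (R : realType) n (S : 'M[R]_n) : Prop :=
  S^T = S /\ forall c : 'rV[R]_n, 0 <= (c *m S *m c^T) 0 0.

(** Block induction on the first row and column. A positive pivot leaves the Schur complement, again
    positive semidefinite; a zero pivot forces its column to vanish, so singular matrices are
    covered. *)
Lemma cholesky (R : realType) (n : nat) (S : 'M[R]_n) : psd S ->
  exists L : 'M[R]_n, S = L *m L^T.
Proof.
elim: n S => [|n IH] S [Ssym Spos]; first by exists 0; apply/matrixP => -[].
pose S' : 'M[R]_(1 + n) := S.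
pose a := S 0 0; pose b : 'cV[R]_n := dlsubmx S'; pose D : 'M[R]_n := drsubmx S'.
have Sbl : S' = block_mx a%:M b^T b D.
  rewrite -[LHS](submxK S'); congr block_mx.
    by apply/matrixP => i j; rewrite !ord1 !mxE /a /S' eqxx mulr1n; congr (S _ _); apply/val_inj.
  by rewrite /b trmx_dlsub (Ssym : S'^T = S').
have Dsym : D^T = D by rewrite /D trmx_drsub (Ssym : S'^T = S').
have tb (y : 'rV[R]_n) : (b^T *m y^T) 0 0 = (y *m b) 0 0 by rewrite -trmx_mul mxE.
have quad (x : R) (y : 'rV[R]_n) :
   0 <= x ^+ 2 * a + 2 * x * (y *m b) 0 0 + (y *m D *m y^T) 0 0.
  have Spos' : forall c : 'rV[R]_(1 + n), 0 <= (c *m S' *m c^T) 0 0 := Spos.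
  have := Spos' (row_mx x%:M y); rewrite Sbl tr_row_mx mul_row_block mul_row_col.
  rewrite tr_scalar_mx !mulmxDl mul_mx_scalar !mul_scalar_mx -scalemxAl !mxE.
  rewrite -/(b^T *m y^T) -/(y *m b) -/(y *m D *m y^T).
  have t := tb y; rewrite !mxE in t.
  rewrite big_ord1 !mxE t !eqxx !mulr1n => h.
  apply: (le_trans h); rewrite le_eqVlt; apply/orP; left; apply/eqP.
  by ring.
suff [L HL] : exists L : 'M[R]_(1 + n), S' = L *m L^T by exists L.
have a0 : 0 <= a.
  by have := quad 1 0; rewrite !mul0mx !mxE expr1n mul1r mulr0 !addr0.
have [aE|an] := eqVneq a 0.
  have yb (y : 'rV[R]_n) : (y *m b) 0 0 = 0.
    set u := (y *m b) 0 0; set v := (y *m D *m y^T) 0 0.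
    have v0 : 0 <= v by have := quad 0 y; rewrite -/v expr0n /= !mul0r mulr0 mul0r !add0r.
    apply/eqP/negPn/negP => u0.
    (* With zero pivot the form is affine in its first coordinate; this value makes it equal to -1
       unless [u = 0]. *)
    have := quad (- (v + 1) / (2 * u)) y; rewrite aE mulr0 add0r -/u -/v.
    have -> : 2 * (- (v + 1) / (2 * u)) * u + v = -1 by field.
    by rewrite ler0N1.
  have b0 : b = 0.
    apply/matrixP => i j; rewrite ord1 [RHS]mxE -[RHS](yb (delta_mx 0 i)).
    by rewrite -rowE [in RHS]mxE.
  have psdD : psd D.
    split=> // c; have := quad 0 c; rewrite expr0n /= !mul0r mulr0 mul0r !add0r//.
  have [L DL] := IH D psdD.
  exists (block_mx (0 : 'M[R]_1) 0 0 L : 'M[R]_(1 + n)).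
  rewrite Sbl aE b0 trmx0 tr_block_mx mulmx_block !trmx0.
  by rewrite !mulmx0 !mul0mx !add0r -DL raddf0.
have ap : 0 < a by rewrite lt_neqAle eq_sym an.
have sa0 : Num.sqrt a != 0 by rewrite gt_eqF// sqrtr_gt0.
have sq : Num.sqrt a * Num.sqrt a = a by rewrite -expr2 sqr_sqrtr.
pose D' := D - a^-1 *: (b *m b^T).
have psdD : psd D'.
  split=> [|c]; first by rewrite /D' linearB linearZ /= trmx_mul trmxK Dsym.
  (* The first coordinate is chosen to minimize the form, and the minimum is the form of the Schur
     complement. *)
  have := quad (- (c *m b) 0 0 / a) c.
  set u := (c *m b) 0 0; set v := (c *m D *m c^T) 0 0.
  have -> : (c *m D' *m c^T) 0 0 = v - a^-1 * (u * u).
    rewrite /D' mulmxBr mulmxBl mxE -/v; congr (_ + _).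
    rewrite -scalemxAr -scalemxAl mulmxA -mulmxA [in LHS]mxE [in LHS]mxE.
    have -> : c *m (b *m b^T) *m c^T = (c *m b) *m (b^T *m c^T) by rewrite !mulmxA.
    have -> : ((c *m b) *m (b^T *m c^T)) 0 0 = u * u.
      by rewrite [LHS]mxE big_ord1 tb.
    by [].
  by congr (0 <= _); field.
have [L DL] := IH D' psdD.
exists (block_mx (Num.sqrt a)%:M 0 ((Num.sqrt a)^-1 *: b) L : 'M[R]_(1 + n)).
rewrite Sbl tr_block_mx mulmx_block !trmx0.
rewrite !mulmx0 !mul0mx !addr0 -DL tr_scalar_mx linearZ /=; congr block_mx.
- by rewrite -scalar_mxM sq.
- by rewrite mul_scalar_mx scalerA divff// scale1r.
- by rewrite mul_mx_scalar scalerA divff// scale1r.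
- rewrite -scalemxAl -scalemxAr scalerA /D' addrC -invfM sq subrK//.
Qed.

(** An open set is the union of the boxes with rational end points that it contains. There are
    countably many of them, and the preimage of a box is a finite intersection of conditions on
    coordinates. *)
Lemma measurable_to_borel_rV d (R : realType) (T : measurableType d) (n : nat)
    (X : 'I_n -> T -> measurableTypeR R) : (forall i, measurable_fun [set: T] (X i)) ->
  measurable_fun [set: T] ((fun t => \row_i (X i t : R)) : T -> borel 'rV[R]_n).
Proof.
move=> mX; apply: (@measurability _ _ T (borel 'rV[R]_n) setT _ (@open 'rV[R]_n) erefl) => _ [U oU <-].
rewrite setTI.
pose box (qr : {ffun 'I_n -> rat * rat}) : set 'rV[R]_n :=
  [set x | forall i, ratr (qr i).1 < x 0 i < ratr (qr i).2].
have -> : (fun t => \row_i (X i t : R)) @^-1` U =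
   \bigcup_(qr in [set qr | box qr `<=` U]) (fun t => \row_i (X i t : R)) @^-1` box qr.
  apply/seteqP; split => [t /= Ut|t /= [qr qrU]]; last exact: qrU.
  set x := \row_i _ in Ut *.
  have /nbhs_ballP [e /= e0 eU] : nbhs x U by exact: open_nbhs_nbhs.
  have ex i : exists qr : rat * rat, (x 0 i - e < ratr qr.1 < x 0 i) && (x 0 i < ratr qr.2 < x 0 i + e).
    have [q] := @rat_in_itvoo R (x 0 i - e) (x 0 i) ltac:(by rewrite ltrBlDr ltrDl).
    have [r] := @rat_in_itvoo R (x 0 i) (x 0 i + e) ltac:(by rewrite ltrDl).
    by rewrite !in_itv/= => h1 h2; exists (q, r); rewrite h2 h1.
  pose qr := [ffun i => xchoose (ex i)].
  have qrP i := xchooseP (ex i).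
  exists qr => /=.
    move=> y yb; apply: eU; split=> // i j; rewrite (ord1 i) /ball/=.
    have := yb j; rewrite ffunE; have /andP[/andP[h1 h2] /andP[h3 h4]] := qrP j => /andP[h5 h6].
    by rewrite ltr_norml; apply/andP; split; lra.
  by move=> i; rewrite ffunE; have /andP[/andP[_ ->] /andP[-> _]] := qrP i.
have -> : \bigcup_(qr in [set qr | box qr `<=` U]) (fun t => \row_i (X i t : R)) @^-1` box qr
   = \bigcup_qr (if `[< box qr `<=` U >] then (fun t => \row_i (X i t : R)) @^-1` box qr else set0).
  apply/seteqP; split => [t [qr /= h1 h2]|t [qr _]]; first by exists qr => //; case: asboolP.
  by case: asboolP => // h1 h2; exists qr.
apply: countable_bigcupT_measurable => [|qr]; first exact: countableP.
case: asboolP => // _.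
have -> : (fun t => \row_i (X i t : R)) @^-1` box qr =
  \bigcap_(i in [set: 'I_n]) (X i @^-1` [set` `]ratr (qr i).1, ratr (qr i).2[]).
  apply/seteqP; split => t /=.
    by move=> h i _ /=; have := h i; rewrite mxE in_itv.
  by move=> h i; have := h i I; rewrite /= in_itv mxE.
apply: fin_bigcap_measurable => [|i _]; first exact: finite_finset.
rewrite -[X in measurable X]setTI.
by apply: mX => //; exact: measurable_itv.
Qed.

Lemma dot_mulmx (R : realType) n (c x : 'rV[R]_n) (L : 'M[R]_n) :
  dot c (x *m L^T) = dot (c *m L) x.
Proof.
rewrite /dot; transitivity ((c *m L *m x^T) 0 0).
  rewrite -mulmxA -[L in RHS]trmxK -trmx_mul mxE; apply: eq_bigr => i _.
  by rewrite [in RHS]mxE.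
by rewrite mxE; apply: eq_bigr => i _; congr (_ * _); rewrite mxE.
Qed.

Lemma normsq_mulmx (R : realType) n (c : 'rV[R]_n) (L : 'M[R]_n) :
  normsq (c *m L) = (c *m (L *m L^T) *m c^T) 0 0.
Proof.
rewrite mulmxA -mulmxA -trmx_mul mxE; apply: eq_bigr => i _.
by rewrite [_^T _ _]mxE expr2.
Qed.

(** The law of a linear image of independent standard normal variables: the form [c] becomes the
    form [c *m L], whose squared norm is the value of [S] at [c]. *)
Lemma gaussian_law_exists (R : realType) (n : nat) (S : 'M[R]_n) : psd S ->
  exists mu : probability (borel 'rV[R]_n) R,
  forall (c : 'rV[R]_n) (A : set R), measurable A ->
    mu [set x : 'rV[R]_n | A (dot c x)] = normal_law 0 (Num.sqrt ((c *m S *m c^T) 0 0)) A.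
Proof.
move=> /cholesky[L ->].
have [d [T [P [X [mX law]]]]] := iid_normal_exists R n.
pose Y i (t : T) : measurableTypeR R := ((\row_j (X j t : R)) *m L^T) 0 i.
have mY i : measurable_fun [set: T] (Y i).
  rewrite /Y; under eq_fun do rewrite mxE.
  apply: measurable_sum => j; apply: measurable_funM; last exact: measurable_cst.
  by under eq_fun do rewrite mxE; exact: mX.
pose Z (t : T) : borel 'rV[R]_n := \row_i (Y i t : R).
have mZ : measurable_fun [set: T] Z by exact: measurable_to_borel_rV.
pose Z' : {mfun T >-> borel 'rV[R]_n} := HB.pack Z (@isMeasurableFun.Build _ _ T (borel 'rV[R]_n) Z mZ).
exists (distribution P Z') => c A mA.
rewrite -normsq_mulmx -law// /distribution /pushforward/=; congr (P _).
apply/seteqP; split => t /=.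
  have -> : dot c (Z t) = \sum_i (c *m L) 0 i * X i t; last by [].
  have -> : Z t = (\row_j (X j t : R)) *m L^T by apply/rowP => i; rewrite mxE.
  by rewrite dot_mulmx; apply: eq_bigr => i _; rewrite mxE.
have -> : dot c (Z t) = \sum_i (c *m L) 0 i * X i t; last by [].
have -> : Z t = (\row_j (X j t : R)) *m L^T by apply/rowP => i; rewrite mxE.
by rewrite dot_mulmx; apply: eq_bigr => i _; rewrite mxE.
Qed.

Lemma measurable_fun_continuous (R : realType) (V : ptopologicalType) (f : V -> R) :
  continuous f -> measurable_fun [set: borel V] (f : borel V -> measurableTypeR R).
Proof.
move=> cf; apply: (measurability _ (RGenOInfty.measurableE R)) => _ [_ [a ->] <-].
rewrite setTI; apply: sub_sigma_algebra.
by apply: open_comp; [move=> x _; exact: cf|exact: interval_open].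
Qed.

Lemma integrable_bcont (R : realType) (V : ptopologicalType)
    (mu : probability (borel V) R) (f : V -> R) :
  bcont f -> mu.-integrable setT (EFin \o f).
Proof.
move=> [cf [C fC]]; apply: (@bounded_integrable _ R _ mu f C) => //.
exact: measurable_fun_continuous.
Qed.

(** [normal_law 0 s] bundled as a probability, so that the transfer lemmas also apply to the
    degenerate case. *)
Definition nlaw (R : realType) (s : R) : probability (measurableTypeR R) R :=
  if s == 0 then \d_(0 : measurableTypeR R) : probability (measurableTypeR R) R
  else normal_prob 0 s : probability (measurableTypeR R) R.

Lemma nlawE (R : realType) (s : R) (A : set R) : nlaw s A = normal_law 0 s A.
Proof. by rewrite /nlaw /normal_law; case: ifP. Qed.

Lemma nlaw_cos (R : realType) (s : R) : \int[nlaw s]_x cos (1 * x) = expR (- (s ^+ 2 / 2)).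
Proof.
rewrite /nlaw; have [->|s0] := eqVneq s 0.
  rewrite /Rintegral integral_dirac//; last first.
    by apply/measurable_EFinP; exact: measurable_cos_dil.
  rewrite (_ : (\d__ _ = 1)%E); last exact: diracT.
  by rewrite mul1e /= mulr0 cos0 expr0n mul0r oppr0 expR0.
by apply: (etrans (normal_cos 1 s0)); rewrite mul1r nchfE.
Qed.

Lemma nlaw_sin (R : realType) (s : R) : \int[nlaw s]_x sin (1 * x) = 0.
Proof.
rewrite /nlaw; have [_|s0] := eqVneq s 0; last exact: normal_sin.
rewrite /Rintegral integral_dirac//; last first.
  by apply/measurable_EFinP; exact: measurable_sin_dil.
rewrite (_ : (\d__ _ = 1)%E); last exact: diracT.
by rewrite mul1e /= mulr0 sin0.
Qed.

Lemma nlaw_sqr (R : realType) (s : R) :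
  (nlaw s).-integrable [set: measurableTypeR R] (fun x : R => (x ^+ 2)%:E) /\
  \int[nlaw s]_x x ^+ 2 = s ^+ 2.
Proof.
rewrite /nlaw; have [->|s0] := eqVneq s 0; last exact: normal_sqr.
have m2 : measurable_fun [set: measurableTypeR R] (fun x : R => (x ^+ 2)%:E).
  by apply/measurable_EFinP; exact: measurable_funX.
have d1 : (\d_(0%R : measurableTypeR R) [set: measurableTypeR R] = 1 :> \bar R)%E by exact: diracT.
split.
  apply/integrableP; split=> //; rewrite integral_dirac//; last exact: measurableT_comp.
  by rewrite d1 mul1e /= expr0n normr0 ltry.
rewrite /Rintegral integral_dirac// d1 mul1e /=.
by [].
Qed.

(** * Moments and concentration of a centered Gaussian vector *)

Section gaussian_facts.
Variables (R : realType) (n : nat) (S : 'M[R]_n) (mu : probability (borel 'rV[R]_n) R).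
Hypothesis S_psd : psd S.
Hypothesis law : forall (c : 'rV[R]_n) (A : set R), measurable A ->
  mu [set x : 'rV[R]_n | A (dot c x)] = normal_law 0 (Num.sqrt ((c *m S *m c^T) 0 0)) A.

Let sd (c : 'rV[R]_n) := Num.sqrt ((c *m S *m c^T) 0 0).

Let mdot (c : 'rV[R]_n) :
  measurable_fun [set: borel 'rV[R]_n] (dot c : borel 'rV[R]_n -> measurableTypeR R).
Proof. by apply: measurable_fun_continuous; exact: continuous_dot. Qed.

Let dlaw (c : 'rV[R]_n) (A : set R) : measurable A -> mu (dot c @^-1` A) = nlaw (sd c) A.
Proof. by move=> mA; rewrite nlawE -law. Qed.

Let sd2 (c : 'rV[R]_n) : sd c ^+ 2 = (c *m S *m c^T) 0 0.
Proof. by rewrite sqr_sqrtr//; exact: S_psd.2. Qed.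

Lemma gaussian_cos c : \int[mu]_x cos (dot c x) = expR (- ((c *m S *m c^T) 0 0 / 2)).
Proof.
have /(congr1 fine) H := law_integral (Q := nlaw (sd c)) (@mdot c) (@dlaw c) (@integrable_cos_dil R (nlaw (sd c)) 1).
rewrite -sd2 -nlaw_cos /Rintegral -[RHS]H; congr fine; apply: eq_integral => x _ /=.
by rewrite mul1r.
Qed.

Lemma gaussian_sin c : \int[mu]_x sin (dot c x) = 0.
Proof.
have /(congr1 fine) H := law_integral (Q := nlaw (sd c)) (@mdot c) (@dlaw c) (@integrable_sin_dil R (nlaw (sd c)) 1).
rewrite -(nlaw_sin (sd c)) /Rintegral -[RHS]H; congr fine; apply: eq_integral => x _ /=.
by rewrite mul1r.
Qed.

Lemma gaussian_sqr c :
  mu.-integrable setT (EFin \o (fun x : 'rV[R]_n => dot c x ^+ 2)) /\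
  \int[mu]_x (dot c x ^+ 2) = (c *m S *m c^T) 0 0.
Proof.
have [i2 e2] := nlaw_sqr (sd c).
have iX := law_integrable (@mdot c) (@dlaw c) i2.
split; first exact: iX.
have /(congr1 fine) H := law_integral (Q := nlaw (sd c)) (@mdot c) (@dlaw c) i2.
by rewrite -sd2 -e2 /Rintegral -[RHS]H.
Qed.

Lemma gaussian_dot_integrable c : mu.-integrable setT (EFin \o (dot c : borel 'rV[R]_n -> R)).
Proof.
have [i2 _] := gaussian_sqr c.
have i1 : mu.-integrable setT (EFin \o cst 1) by exact: finite_measure_integrable_cst.
apply: (le_integrable measurableT _ _ (integrableD measurableT i1 i2)).
  by apply/measurable_EFinP; exact: mdot.
move=> x _ /=; rewrite lee_fin.
rewrite [leRHS]ger0_norm; last by rewrite addr_ge0// sqr_ge0.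
rewrite ler_norml; apply/andP; split; nra.
Qed.

(** The forms [c] and [- c] have the same law, so the mean equals its opposite. *)
Lemma gaussian_mean0 c : \int[mu]_x dot c x = 0.
Proof.
have ic := gaussian_dot_integrable c.
have iid : (nlaw (sd c)).-integrable setT (EFin \o (idfun : R -> R)).
  have [i2 _] := nlaw_sqr (sd c).
  have i1 : (nlaw (sd c)).-integrable setT (EFin \o cst 1) by exact: finite_measure_integrable_cst.
  apply: (le_integrable measurableT _ _ (integrableD measurableT i1 i2)).
    by apply/measurable_EFinP; exact: measurable_id.
  move=> x _ /=; rewrite lee_fin.
  rewrite [leRHS]ger0_norm; last by rewrite addr_ge0// sqr_ge0.
  rewrite ler_norml; apply/andP; split; nra.
have sdN : sd (- c) = sd c.
  by rewrite /sd linearN /= mulNmx mulNmx mulmxN opprK.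
have /(congr1 fine) H1 := law_integral (@mdot c) (@dlaw c) iid.
have dlawN A : measurable A -> mu (dot (- c) @^-1` A) = nlaw (sd c) A.
  by move=> mA; exact: (etrans (@dlaw (- c) A mA) (congr1 (fun s => nlaw s A) sdN)).
have /(congr1 fine) H2 := law_integral (@mdot (- c)) dlawN iid.
have : \int[mu]_x dot c x = \int[mu]_x (-1 * dot c x).
  rewrite /Rintegral [LHS]H1 -H2; congr fine; apply: eq_integral => x _ /=.
  by rewrite dotNl mulN1r.
by rewrite RintegralZl//; lra.
Qed.

Let e_ (i : 'I_n) : 'rV[R]_n := delta_mx 0 i.

Let dot_e i (x : 'rV[R]_n) : dot (e_ i) x = x 0 i.
Proof. by rewrite -[e_ i]scale1r dot_delta mul1r. Qed.

Let quad_e i j (a b : R) : ((a *: e_ i + b *: e_ j) *m S *m (a *: e_ i + b *: e_ j)^T) 0 0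
  = a ^+ 2 * S i i + 2 * a * b * S i j + b ^+ 2 * S j j.
Proof.
have ent k l : (e_ k *m S *m (e_ l)^T) 0 0 = S k l.
  by rewrite -rowE trmx_delta -colE !mxE.
have Sji : S j i = S i j by rewrite -{1}S_psd.1 mxE.
rewrite linearD !linearZ /= mulmxDl mulmxDl mulmxDr mulmxDr -!scalemxAl -!scalemxAr.
have addE (A B : 'M[R]_1) : (A + B) 0 0 = A 0 0 + B 0 0 by rewrite mxE.
have scaleE c (A : 'M[R]_1) : (c *: A) 0 0 = c * A 0 0 by rewrite mxE.
rewrite !addE !scaleE !ent Sji.
by ring.
Qed.

Lemma gaussian_central : central_multivariate_normal S mu.
Proof.
have quadE i : (e_ i *m S *m (e_ i)^T) 0 0 = S i i.
  by rewrite -rowE trmx_delta -colE !mxE.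
have ix i : mu.-integrable setT (EFin \o (fun x : 'rV[R]_n => x 0 i)).
  by have := gaussian_dot_integrable (e_ i); apply: eq_integrable => // x _ /=; rewrite dot_e.
have E0 i : ('E_mu[(fun x : 'rV[R]_n => x 0%R i)] = 0)%E.
  rewrite unlock -[LHS]fineK; last exact: (integrable_fin_num measurableT (ix i)).
  congr EFin; rewrite -(gaussian_mean0 (e_ i)) /Rintegral; congr fine.
  by apply: eq_integral => x _; rewrite dot_e.
split=> //.
  move=> c; exists 0, (sd c); split; first exact: sqrtr_ge0.
  by move=> A mA; rewrite -law.
move=> i j; rewrite unlock !E0 /=.
have [ip ep] := gaussian_sqr (1 *: e_ i + 1 *: e_ j).
have [im em] := gaussian_sqr (1 *: e_ i + (-1) *: e_ j).
have P (a b : R) x : dot (a *: e_ i + b *: e_ j) x = a * x 0 i + b * x 0 j.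
  by rewrite dotDl !dot_delta.
(* Polarization: the mixed moment comes from the variances of the sum and of the difference of the
   two coordinates. *)
have fp (x : 'rV[R]_n) : x 0 i * x 0 j = 1 / 4 * (dot (1 *: e_ i + 1 *: e_ j) x ^+ 2)
    + (- (1 / 4)) * (dot (1 *: e_ i + (-1) *: e_ j) x ^+ 2).
  by rewrite !P; field.
have ipa : mu.-integrable setT (EFin \o (fun x : 'rV[R]_n => 1 / 4 * (dot (1 *: e_ i + 1 *: e_ j) x ^+ 2))).
  by apply: eq_integrable (integrableZl measurableT (1 / 4) ip) => // x _ /=; rewrite EFinM.
have ima : mu.-integrable setT (EFin \o (fun x : 'rV[R]_n => (- (1 / 4)) * (dot (1 *: e_ i + (-1) *: e_ j) x ^+ 2))).
  by apply: eq_integrable (integrableZl measurableT (- (1 / 4)) im) => // x _ /=; rewrite EFinM.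
have val : \int[mu]_x (x 0 i * x 0 j) = S i j.
  under eq_Rintegral do rewrite fp.
  by rewrite RintegralD// !RintegralZl// ep em !quad_e; field.
rewrite unlock -val /Rintegral fineK.
  apply: eq_integral => x _; congr EFin.
  by rewrite -[LHS]/((x 0 i - 0) * (x 0 j - 0)) !subr0.
apply: (integrable_fin_num measurableT).
by apply: eq_integrable (integrableD measurableT ipa ima) => // x _ /=; rewrite -EFinD fp.
Qed.

Lemma gaussian_tail (L : R) : 0 < L -> \int[mu]_x tail L x <= (\sum_i S i i) / L ^+ 2.
Proof.
move=> L0; have quadE i : (e_ i *m S *m (e_ i)^T) 0 0 = S i i.
  by rewrite -rowE trmx_delta -colE !mxE.
have isq i : mu.-integrable setT (EFin \o (fun x : 'rV[R]_n => (L ^+ 2)^-1 * (dot (e_ i) x ^+ 2))).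
  by apply: eq_integrable (integrableZl measurableT ((L ^+ 2)^-1) (gaussian_sqr (e_ i)).1) => // x _ /=; rewrite EFinM.
have it := integrable_bcont mu (@bcont_tail R n L).
have [isum esum] : mu.-integrable setT (EFin \o (fun x : 'rV[R]_n => \sum_i ((L ^+ 2)^-1 * (dot (e_ i) x ^+ 2)))) /\
   \int[mu]_x (\sum_i ((L ^+ 2)^-1 * (dot (e_ i) x ^+ 2))) = \sum_i ((L ^+ 2)^-1 * S i i).
  elim: (index_enum _) => [|i r [IHi IHe]].
    under [X in EFin \o X]eq_fun do rewrite big_nil.
    under eq_Rintegral do rewrite big_nil.
    split; first exact: (finite_measure_integrable_cst mu 0).
    by rewrite big_nil Rintegral_cst_prob.
  split.
    apply: eq_integrable (integrableD measurableT (isq i) IHi) => // x _ /=.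
    by rewrite big_cons EFinD.
  under eq_Rintegral do rewrite big_cons.
  by rewrite RintegralD// IHe RintegralZl ?(gaussian_sqr (e_ i)).2 ?quadE ?big_cons//; exact: (gaussian_sqr (e_ i)).1.
rewrite mulrC mulr_sumr -esum; apply: le_Rintegral => // x _.
rewrite /tail ge_min; apply/orP; right; rewrite mulrC mulr_sumr.
by apply: ler_sum => i _; rewrite dot_e.
Qed.

(** The standard normal density is at most 1, and the interval has length [2 * h]. *)
Lemma gaussian_small_ball i (h : R) : 0 < h -> S i i = 1 ->
  (mu [set x : 'rV[R]_n | (`|x 0 i| < h)%R] <= (2 * h)%:E)%E.
Proof.
move=> h0 Sii.
have quadE : (e_ i *m S *m (e_ i)^T) 0 0 = S i i by rewrite -rowE trmx_delta -colE !mxE.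
have mI : measurable [set` `](- h), h[] by exact: measurable_itv.
have -> : [set x : 'rV[R]_n | `|x 0 i| < h] = [set x | [set` `](- h), h[] (dot (e_ i) x)].
  by apply/seteqP; split => x /=; rewrite dot_e in_itv/= ltr_norml.
rewrite law// quadE Sii sqrtr1 /normal_law oner_eq0 /normal_prob.
apply: (@le_trans _ _ (\int[lebesgue_measure]_(x in [set` `](- h)%R, h[]) (cst (1 : \bar R) x))%E).
  apply: ge0_le_integral => //=.
  - by move=> x _; rewrite lee_fin normal_pdf_ge0.
  - by apply/measurable_EFinP; apply: measurable_funTS; exact: measurable_normal_pdf.
  - move=> x _; rewrite lee_fin (le_trans (normal_pdf_ub _ _ _)) ?oner_neq0//.
    rewrite /normal_peak invf_le1 ?sqrtr_gt0 expr1n mul1r; last by rewrite pmulrn_lgt0// pi_gt0.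
    rewrite -[leLHS]sqrtr1 ler_wsqrtr// mulr2n; have := pi_ge2 R; lra.
rewrite integral_cst//.
rewrite mul1e; apply: (@le_trans _ _ (lebesgue_measure [set` `](- h)%R, h[])) => //.
rewrite lebesgue_measure_itv/= lte_fin ifT; last lra.
by rewrite -EFinD lee_fin; lra.
Qed.

End gaussian_facts.

(** * Weighted method of moments *)

(** Unlike [posfun], linearity is asked of all functions, because moments and exponentials are
    unbounded; expectations that are finite sums satisfy it. *)
Definition avg (R : realType) (X : Type) (E : (X -> R) -> R) : Prop :=
  [/\ forall (J : Type) (r : seq J) (c : J -> R) (F : J -> X -> R),
        E (fun x => \sum_(j <- r) c j * F j x) = \sum_(j <- r) c j * E (F j),
      forall f g, (forall x, f x <= g x) -> E f <= E g
    & E (fun=> 1) = 1].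

Section avg_theory.
Variables (R : realType) (X : Type) (E : (X -> R) -> R).
Hypothesis avE : avg E.

Lemma avg_lin a b f g : E (fun x => a * f x + b * g x) = a * E f + b * E g.
Proof.
have [lin _ _] := avE.
have := lin _ [:: true; false] (fun c : bool => if c then a else b) (fun c : bool => if c then f else g).
by rewrite !big_cons big_nil /= addr0 => <-; congr E; apply/funext => x; rewrite !big_cons big_nil addr0.
Qed.

Lemma avg_sum (J : Type) (r : seq J) (F : J -> X -> R) :
  E (fun x => \sum_(j <- r) F j x) = \sum_(j <- r) E (F j).
Proof.
have [lin _ _] := avE; have := lin _ r (fun=> 1) F.
rewrite [in RHS](eq_bigr (fun j => E (F j))); last by move=> j _; rewrite mul1r.
by move=> <-; congr E; apply/funext => x; apply: eq_bigr => j _; rewrite mul1r.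
Qed.

Lemma avgZ a f : E (fun x => a * f x) = a * E f.
Proof.
have := avg_lin a 0 f f; rewrite mul0r addr0 => <-; congr E.
by apply/funext => x; rewrite mul0r addr0.
Qed.

Lemma avgB f g : E (fun x => f x - g x) = E f - E g.
Proof.
have := avg_lin 1 (-1) f g; rewrite mul1r mulN1r => <-; congr E.
by apply/funext => x; rewrite mul1r mulN1r.
Qed.

Lemma avgD f g : E (fun x => f x + g x) = E f + E g.
Proof.
have := avg_lin 1 1 f g; rewrite !mul1r => <-; congr E.
by apply/funext => x; rewrite !mul1r.
Qed.

Lemma avg_cst c : E (fun=> c) = c.
Proof.
have [_ _ E1] := avE; rewrite -[RHS]mulr1 -E1 -avgZ; congr E.
by apply/funext => x; rewrite mulr1.
Qed.

Lemma avg_le f g : (forall x, f x <= g x) -> E f <= E g.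
Proof. by have [_ + _] := avE; exact. Qed.

Lemma avg_norm f h : (forall x, `|f x| <= h x) -> `|E f| <= E h.
Proof.
move=> fh; rewrite ler_norml -mulN1r -avgZ; apply/andP; split; apply: avg_le => x.
  by rewrite mulN1r lerNl (le_trans _ (fh x))// -normrN ler_norm.
by rewrite (le_trans _ (fh x))// ler_norm.
Qed.

Lemma avg_comp (Y : Type) (W : X -> Y) : avg (fun h : Y -> R => E (fun x => h (W x))).
Proof.
have [lin mon one] := avE; split => [J r c F|f g fg|].
- by rewrite -lin.
- by apply: mon => x; exact: fg.
- exact: one.
Qed.
End avg_theory.

Lemma avg_posfun (R : realType) n (E : ('rV[R]_n -> R) -> R) (h : 'rV[R]_n -> R) :
  avg E -> (forall x, 0 <= h x) -> posfun (fun f => E (fun x => h x * f x)).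
Proof.
move=> avE h0; split => [a b f g _ _|f g _ _ fg].
  rewrite -(avg_lin avE); congr E; apply/funext => x; rewrite mulrDr; congr (_ + _); ring.
by apply: avg_le => // x; exact: ler_wpM2l.
Qed.

(** A monomial written as a list of indices: multiplying by a coordinate is a [cons], and condition
    (v) applies when every index occurs in the list. *)
Definition word (R : realType) (n : nat) (w : seq 'I_n) (x : 'rV[R]_n) : R :=
  \prod_(i <- w) x 0 i.

Definition rho (R : realType) (n : nat) (x : 'rV[R]_n) : R := \prod_i x 0 i ^+ 2.

Lemma rho_ge0 (R : realType) n (x : 'rV[R]_n) : 0 <= rho x.
Proof. by apply: prodr_ge0 => i _; exact: sqr_ge0. Qed.

Lemma word_rho (R : realType) n (x : 'rV[R]_n) :
  rho x = word (index_enum 'I_n ++ index_enum 'I_n) x.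
Proof. by rewrite /word big_cat /rho -[RHS]big_split. Qed.

Lemma bin_le_exp2 m j : ('C(m, j) <= 2 ^ m)%N.
Proof.
elim: m j => [|m IH] [|j] //; first by rewrite bin0 expn_gt0.
by rewrite binS expnS mul2n -addnn leq_add.
Qed.

Lemma fact_ratio_le m k : ((m + k)`! <= m`! * k`! * 2 ^ (m + k))%N.
Proof.
rewrite -(bin_fact (leq_addr k m)) addKn mulnC leq_mul2l; apply/orP; right.
exact: bin_le_exp2.
Qed.

(* The value of [l] produces the geometric factor [(1 / 2) ^+ k.*2], which makes
   the Taylor remainders of cos and sin negligible. *)
Lemma monomial_exp_bound (R : realType) n (n0 : (0 < n)%N) (t x : 'rV[R]_n) (k : nat) (l : R) :
  l = 4 * (\sum_i `|t 0 i|) + 1 ->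
  rho x * (dot t x ^+ k.*2 / (k.*2)`!%:R) <=
  (n.*2)`!%:R * 2 ^+ n.*2 * (1 / 2) ^+ k.*2 *
    \sum_i (expR (l * x 0 i) + expR (- (l * x 0 i))).
Proof.
set T := \sum_i `|t 0 i| => lE.
have T0 : 0 <= T by apply: sumr_ge0.
have l0 : 0 < l by rewrite lE; lra.
(* The coordinate of largest absolute value [z] dominates everything: [rho x <= z ^+ n.*2] and
   [dot t x] is at most [T * z] in absolute value. *)
pose i0 := [arg max_(i > Ordinal n0) `|x 0 i|]%O.
have xi i : `|x 0 i| <= `|x 0 i0| by rewrite /i0; case: arg_maxP => // j _ /(_ i); apply.
set z := `|x 0 i0| in xi.
have z0 : 0 <= z by exact: normr_ge0.
have rz : rho x <= z ^+ n.*2.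
  apply: (@le_trans _ _ (\prod_(i < n) z ^+ 2)).
    apply: ler_prod => i _; rewrite sqr_ge0 /= -real_normK ?num_real//.
    by rewrite lerXn2r ?nnegrE// normr_ge0.
  by rewrite prodr_const card_ord -exprM mul2n.
have dz : dot t x ^+ k.*2 <= (T * z) ^+ k.*2.
  rewrite -mul2n !exprM lerXn2r ?nnegrE ?sqr_ge0// -[leLHS]real_normK ?num_real//.
  rewrite lerXn2r ?nnegrE ?normr_ge0 ?(mulr_ge0 T0 z0)//.
  rewrite /dot (le_trans (ler_norm_sum _ _ _))// mulr_suml; apply: ler_sum => i _.
  by rewrite normrM ler_wpM2l.
have d0 : 0 <= dot t x ^+ k.*2 by rewrite exprn_even_ge0// odd_double.
set c := (X in _ <= X * _).
have c0 : 0 <= c by rewrite /c !mulr_ge0 ?exprn_ge0.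
apply: (@le_trans _ _ (c * (expR (l * x 0 i0) + expR (- (l * x 0 i0))))); last first.
  apply: ler_wpM2l => //; rewrite (bigD1 i0)//= lerDl; apply: sumr_ge0 => i _.
  exact: addr_ge0 (expR_ge0 _) (expR_ge0 _).
apply: (@le_trans _ _ (c * (`|l * x 0 i0| ^+ (n.*2 + k.*2) / (n.*2 + k.*2)`!%:R))); last first.
  by rewrite ler_wpM2l// pow_fact_le_exp.
rewrite normrM (gtr0_norm l0) -/z.
apply: (@le_trans _ _ (z ^+ n.*2 * ((T * z) ^+ k.*2 / (k.*2)`!%:R))).
  apply: ler_pM => //; rewrite ?rho_ge0 ?divr_ge0//.
  by rewrite ler_wpM2r ?invr_ge0.
have F0 m : 0 < (m`!%:R : R) by rewrite ltr0n fact_gt0.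
rewrite mulrA ler_pdivrMr// mulrAC mulrA ler_pdivlMr//.
(* Merging the two factorials costs a power of 2 and leaves a single term of the exponential series
   at [l * z]. *)
have fr : ((n.*2 + k.*2)`!%:R : R) <= (n.*2)`!%:R * (k.*2)`!%:R * 2 ^+ (n.*2 + k.*2).
  by rewrite -natrX -!natrM ler_nat fact_ratio_le.
apply: (@le_trans _ _ (z ^+ n.*2 * (T * z) ^+ k.*2 * ((n.*2)`!%:R * (k.*2)`!%:R * 2 ^+ (n.*2 + k.*2)))).
  by rewrite ler_wpM2l// mulr_ge0 ?exprn_ge0// mulr_ge0.
have -> : z ^+ n.*2 * (T * z) ^+ k.*2 * ((n.*2)`!%:R * (k.*2)`!%:R * 2 ^+ (n.*2 + k.*2))
   = (n.*2)`!%:R * 2 ^+ n.*2 * (k.*2)`!%:R * (z ^+ n.*2 * z ^+ k.*2) * (2 * T) ^+ k.*2.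
  by rewrite exprD !exprMn; ring.
have -> : c * (k.*2)`!%:R * (l * z) ^+ (n.*2 + k.*2) =
  (n.*2)`!%:R * 2 ^+ n.*2 * (k.*2)`!%:R * (z ^+ n.*2 * z ^+ k.*2) * (l ^+ n.*2 * (1 / 2 * l) ^+ k.*2).
  by rewrite /c exprD !exprMn; ring.
(* What remains follows from [2 * T <= 1 / 2 * l] and [1 <= l], the two reasons for the value of
   [l]. *)
rewrite ler_wpM2l ?mulr_ge0 ?exprn_ge0//.
apply: (@le_trans _ _ (1 * (1 / 2 * l) ^+ k.*2)).
  by rewrite mul1r lerXn2r ?nnegrE ?mulr_ge0 ?(ltW l0)// lE; lra.
rewrite ler_wpM2r ?exprn_ge0 ?mulr_ge0 ?(ltW l0)//.
by rewrite exprn_ege1// lE; lra.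
Qed.

Section moment_compare.
Variables (R : realType) (n : nat) (n0 : (0 < n)%N).
Variables (T : Type) (G : set_system T) (FG : Filter G).
Variables (E1 E2 : T -> ('rV[R]_n -> R) -> R).
Hypothesis av : \forall B \near G, avg (E1 B) /\ avg (E2 B).
Hypothesis words : forall w : seq 'I_n, (forall i, i \in w) ->
  E1 B (word w) - E2 B (word w) @[B --> G] --> (0 : R).
Hypothesis expo : forall l : R, exists C, \forall B \near G, forall i,
  E2 B (fun x => expR (l * x 0 i) + expR (- (l * x 0 i))) <= C.

Let D B f := E1 B f - E2 B f.

Let D_lin a b f g :
  D B f @[B --> G] --> (0 : R) -> D B g @[B --> G] --> (0 : R) ->
  D B (fun x => a * f x + b * g x) @[B --> G] --> (0 : R).
Proof.
move=> Hf Hg.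
have : a * D B f + b * D B g @[B --> G] --> (a * 0 + b * 0 : R).
  by apply: cvgD; apply: cvgM => //; exact: cvg_cst.
rewrite !mulr0 addr0; apply: cvg_trans; apply: near_eq_cvg.
by apply: filterS av => B [a1 a2]; rewrite /D (avg_lin a1) (avg_lin a2); ring.
Qed.

Let D_sum (J : Type) (r : seq J) (c : J -> R) (F : J -> 'rV[R]_n -> R) :
  (forall j, D B (F j) @[B --> G] --> (0 : R)) ->
  D B (fun x : 'rV[R]_n => \sum_(j <- r) c j * F j x) @[B --> G] --> (0 : R).
Proof.
move=> H; elim: r => [|j r IH].
  have -> : (fun x : 'rV[R]_n => \sum_(j <- [::]) c j * F j x) = (fun=> 0).
    by apply/funext => x; rewrite big_nil.
  apply: (@cvg_trans _ ((fun=> 0 : R) @ G)); last exact: cvg_cst.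
  apply: near_eq_cvg; apply: filterS av => B [a1 a2].
  by rewrite /D (avg_cst a1) (avg_cst a2) subrr.
have -> : (fun x => \sum_(i <- j :: r) c i * F i x) =
          (fun x => c j * F j x + 1 * \sum_(i <- r) c i * F i x).
  by apply/funext => x; rewrite big_cons mul1r.
exact: D_lin.
Qed.

(** Expanding one factor [dot t x] prepends a letter to the word, and a word that contains all
    indices still does so afterwards. *)
Let D_dot (t : 'rV[R]_n) (j : nat) (w : seq 'I_n) : (forall i, i \in w) ->
  D B (fun x => word w x * dot t x ^+ j) @[B --> G] --> (0 : R).
Proof.
elim: j w => [|j IH] w fw.
  have -> : (fun x => word w x * dot t x ^+ 0) = word w.
    by apply/funext => x; rewrite expr0 mulr1.
  exact: words.
have -> : (fun x => word w x * dot t x ^+ j.+1) =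
    (fun x => \sum_i t 0 i * (word (i :: w) x * dot t x ^+ j)).
  apply/funext => x; rewrite exprS mulrCA {1}/dot mulr_suml.
  by apply: eq_bigr => i _; rewrite /word big_cons; ring.
by apply: D_sum => i; apply: IH => k; rewrite inE fw orbT.
Qed.

Let D_rho (t : 'rV[R]_n) (j : nat) :
  D B (fun x => rho x * dot t x ^+ j) @[B --> G] --> (0 : R).
Proof.
under (@eq_fun 'rV[R]_n R) => x do rewrite word_rho.
by apply: D_dot => i; rewrite mem_cat mem_index_enum.
Qed.

Let DZ (t : 'rV[R]_n) j (c : R) :
  D B (fun x => rho x * (c * dot t x ^+ j)) @[B --> G] --> (0 : R).
Proof.
have -> : (fun x => rho x * (c * dot t x ^+ j)) =
  (fun x => c * (rho x * dot t x ^+ j) + 0 * (rho x * dot t x ^+ j)).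
  by apply/funext => x; ring.
exact: D_lin (D_rho _ _) (D_rho _ _).
Qed.

Let rem_bound (t : 'rV[R]_n) : exists2 c : R, 0 <= c & \forall B \near G, forall k,
  E2 B (fun x => rho x * (dot t x ^+ k.*2 / (k.*2)`!%:R)) <= c * (1 / 2) ^+ k.*2.
Proof.
have [C HC] := expo (4 * (\sum_i `|t 0 i|) + 1).
exists ((n.*2)`!%:R * 2 ^+ n.*2 * (n%:R * `|C|)).
  by rewrite !mulr_ge0 ?exprn_ge0.
near=> B => k.
have [_ a2] : avg (E1 B) /\ avg (E2 B) by near: B.
have HB : forall i, E2 B (fun x => expR ((4 * (\sum_i `|t 0 i|) + 1) * x 0 i)
   + expR (- ((4 * (\sum_i `|t 0 i|) + 1) * x 0 i))) <= C by near: B.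
apply: (le_trans (avg_le a2 (fun x => monomial_exp_bound n0 x k (erefl (4 * (\sum_i `|t 0 i|) + 1))))).
rewrite avgZ// avg_sum// -[leRHS]mulrAC ler_wpM2l ?mulr_ge0 ?exprn_ge0//.
apply: (@le_trans _ _ (\sum_(i < n) `|C|)).
  by apply: ler_sum => i _; exact: le_trans (HB i) (ler_norm _).
by rewrite sumr_const card_ord mulr_natl.
Unshelve. all: by end_near. Qed.

(** Exponential moments are controlled under [E2] only. The majorant of the weighted remainder is
    itself a mixed moment containing all indices, so under [E1] it is close to its value under [E2],
    which decays geometrically in the degree. *)
Let D_taylor (t : 'rV[R]_n) (s : R -> R) (p : nat -> R -> R) :
  (forall k, D B (fun x => rho x * p k (dot t x)) @[B --> G] --> (0 : R)) ->
  (forall k y, `|s y - p k y| <= `|y| ^+ k.*2 / (k.*2)`!%:R) ->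
  D B (fun x => rho x * s (dot t x)) @[B --> G] --> (0 : R).
Proof.
move=> Dp sp; apply/cvgrPdist_le => e e0.
have [c c0 Hc] := rem_bound t.
have [k Hk] : exists k, c * (1 / 2) ^+ k.*2 <= e / 4.
  have : c * (1 / 4) ^+ k @[k --> \oo] --> (c * 0 : R).
    apply: cvgM; first exact: cvg_cst.
    by apply: cvg_expr; rewrite ger0_norm//; lra.
  rewrite mulr0 => /cvgrPdist_le/(_ (e / 4) (divr_gt0 e0 (ltr0n _ 4)))[k _ /(_ k (leqnn _))].
  rewrite sub0r normrN ger0_norm; last by rewrite mulr_ge0// exprn_ge0.
  move=> H; have q : (1 / 2) ^+ 2 = 1 / 4 :> R by field.
  by exists k; rewrite -mul2n exprM q.
have Dr : D B (fun x => rho x * (dot t x ^+ k.*2 / (k.*2)`!%:R)) @[B --> G] --> (0 : R).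
  by under (@eq_fun 'rV[R]_n R) => x do rewrite [X in _ * X]mulrC; exact: DZ.
have e4 : 0 < e / 4 by rewrite divr_gt0.
have /cvgrPdist_le/(_ _ e4) N1 := Dp k.
have /cvgrPdist_le/(_ _ e4) N2 := Dr.
near=> B.
have [a1 a2] : avg (E1 B) /\ avg (E2 B) by near: B.
have : forall k, E2 B (fun x => rho x * (dot t x ^+ k.*2 / (k.*2)`!%:R)) <= c * (1 / 2) ^+ k.*2 by near: B.
move=> /(_ k) h2.
have N2' : `|0 - D B (fun x => rho x * (dot t x ^+ k.*2 / (k.*2)`!%:R))| <= e / 4 by near: B.
have N1' : `|0 - D B (fun x => rho x * p k (dot t x))| <= e / 4 by near: B.
move: N1' N2'; rewrite !sub0r !normrN /D => N1' N2'.
have rem E : avg E -> `|E (fun x => rho x * s (dot t x)) - E (fun x => rho x * p k (dot t x))|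
   <= E (fun x => rho x * (dot t x ^+ k.*2 / (k.*2)`!%:R)).
  move=> aE; rewrite -avgB//; apply: avg_norm => // x.
  rewrite -mulrBr normrM ger0_norm ?rho_ge0// ler_wpM2l ?rho_ge0//.
  by rewrite (le_trans (sp k _))// -normrX ger0_norm// exprn_even_ge0// odd_double.
have := rem _ a1; have := rem _ a2.
move: N1' N2' h2 Hk; rewrite !ler_norml.
set u1 := E1 B _; set u2 := E2 B _; set v1 := E1 B _; set v2 := E2 B _.
set w1 := E1 B _; set w2 := E2 B _.
move: (c * _) => q.
by move=> /andP[? ?] /andP[? ?] ? ? /andP[? ?] /andP[? ?]; apply/andP; split; lra.
Unshelve. all: by end_near. Qed.

(** The comparison of characteristic functions is applied to the functionals weighted by [rho].
    Their mass and tightness come from the weighted moments of order 0 and 2, which the remainder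
    bound controls under [E2] and the convergence of moments transfers to [E1]. *)
Lemma moment_compare (h : 'rV[R]_n -> R) : bcont h ->
  E1 B (fun x => rho x * h x) - E2 B (fun x => rho x * h x) @[B --> G] --> (0 : R).
Proof.
have D0 : D B (fun x : 'rV[R]_n => rho x * 0) @[B --> G] --> (0 : R).
  have -> : (fun x : 'rV[R]_n => rho x * 0) = (fun x => rho x * (0 * dot 0 x ^+ 0)).
    by apply/funext => x; rewrite mul0r.
  exact: DZ.
have DD f g : D B (fun x => rho x * f x) @[B --> G] --> (0 : R) ->
    D B (fun x => rho x * g x) @[B --> G] --> (0 : R) ->
    D B (fun x => rho x * (f x + g x)) @[B --> G] --> (0 : R).
  move=> Hf Hg; have := D_lin 1 1 Hf Hg.
  by under (@eq_fun 'rV[R]_n R) => x do rewrite !mul1r -mulrDr.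
have bnd t : exists2 c : R, 0 <= c & \forall B \near G,
   E1 B (fun x => rho x * (dot t x ^+ 1.*2 / (1.*2)`!%:R)) <= c /\
   E2 B (fun x => rho x * (dot t x ^+ 1.*2 / (1.*2)`!%:R)) <= c /\
   E1 B (fun x => rho x * 1) <= c /\ E2 B (fun x => rho x * 1) <= c.
  have [c c0 Hc] := rem_bound t.
  have h1 : D B (fun x => rho x * (dot t x ^+ 1.*2 / (1.*2)`!%:R)) @[B --> G] --> (0 : R).
    by under (@eq_fun 'rV[R]_n R) => x do rewrite [X in _ * X]mulrC; exact: DZ.
  have h2 : D B (fun x => rho x * 1) @[B --> G] --> (0 : R).
    by have := DZ t 0 1; under (@eq_fun 'rV[R]_n R) => x do rewrite expr0 mulr1.
  exists (c + 1); first by rewrite addr_ge0.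
  have /cvgrPdist_le/(_ _ ltr01) := h1; have /cvgrPdist_le/(_ _ ltr01) := h2.
  move=> n1 n2; near=> B.
  have : forall k, E2 B (fun x => rho x * (dot t x ^+ k.*2 / (k.*2)`!%:R)) <= c * (1 / 2) ^+ k.*2 by near: B.
  (* The case [k = 0] bounds the weighted mass, the case [k = 1] the weighted second moment. *)
  move=> Hk; have := Hk 1%N; have := Hk 0%N; rewrite expr0.
  have -> : (fun x => rho x * (dot t x ^+ 0.*2 / (0.*2)`!%:R)) = (fun x => rho x * 1).
    by apply/funext => x; rewrite expr0 divr1.
  have -> : (1 / 2) ^+ 1.*2 = 1 / 4 :> R by rewrite -[1.*2]/2%N; field.
  have : `|0 - D B (fun x => rho x * 1)| <= 1 by near: B.
  have : `|0 - D B (fun x => rho x * (dot t x ^+ 1.*2 / (1.*2)`!%:R))| <= 1 by near: B.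
  rewrite /D !sub0r !normrN !ler_norml.
  set u1 := E1 B _; set u2 := E2 B _; set v1 := E1 B _; set v2 := E2 B _.
  move=> /andP[? ?] /andP[? ?] ? ?.
  do !split; lra.
have [C HC] : exists C : R, \forall B \near G, E1 B (fun x => rho x * 1) <= C /\ E2 B (fun x => rho x * 1) <= C.
  have [c _ Hc] := bnd 0; exists c; by apply: filterS Hc => B [_ [_ ?]].
apply: (@trig_compare R n T G FG (fun B f => E1 B (fun x => rho x * f x))
   (fun B f => E2 B (fun x => rho x * f x)) C) => //.
- by apply: filterS av => B [a1 a2]; split; apply: avg_posfun => // x; exact: rho_ge0.
- move=> e e0.
  have [c c0 Hc] : exists2 c : R, 0 <= c & \forall B \near G, forall i : 'I_n,
     E1 B (fun x => rho x * (x 0 i ^+ 2)) <= c /\ E2 B (fun x => rho x * (x 0 i ^+ 2)) <= c.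
    have /choice[c Hc] : forall i : 'I_n, exists c : R, 0 <= c /\ \forall B \near G,
       E1 B (fun x => rho x * (x 0 i ^+ 2)) <= c /\ E2 B (fun x => rho x * (x 0 i ^+ 2)) <= c.
      move=> i; have [c c0 Hc] := bnd (1 *: delta_mx 0 i).
      exists (2 * c); split; first by rewrite mulr_ge0.
      near=> B.
      have [a1 a2] : avg (E1 B) /\ avg (E2 B) by near: B.
      have -> : (fun x : 'rV[R]_n => rho x * (x 0 i ^+ 2)) =
        (fun x => 2 * (rho x * (dot (1 *: delta_mx 0 i) x ^+ 1.*2 / (1.*2)`!%:R))).
        by apply/funext => x; rewrite dot_delta mul1r -[1.*2]/2%N -[2`!]/2%N; field.
      rewrite !avgZ// !ler_pM2l//.
      by move: (near Hc B) => []// ? [? _].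
    exists (\sum_i c i); first by apply: sumr_ge0 => i _; exact: (Hc i).1.
    have : \forall B \near G, forall i : 'I_n, E1 B (fun x => rho x * (x 0 i ^+ 2)) <= c i /\ E2 B (fun x => rho x * (x 0 i ^+ 2)) <= c i.
      by apply: filter_forall => i; exact: (Hc i).2.
    apply: filterS => B H i.
    have le : c i <= \sum_j c j by rewrite (bigD1 i)//= lerDl sumr_ge0// => j _; exact: (Hc j).1.
    by split; apply: le_trans le; have [] := H i.
  pose L := Num.sqrt (n%:R * c / e) + 1.
  have L0 : 0 < L by rewrite ltr_wpDl ?sqrtr_ge0.
  have LL : n%:R * c / L ^+ 2 <= e.
    rewrite ler_pdivrMr ?exprn_gt0// -ler_pdivrMl// mulrC.
    apply: (@le_trans _ _ (Num.sqrt (n%:R * c / e) ^+ 2)).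
      by rewrite sqr_sqrtr// divr_ge0 ?mulr_ge0// ltW.
    by rewrite lerXn2r ?nnegrE ?sqrtr_ge0 ?(ltW L0)// lerDl.
  exists L => //; near=> B.
  have [a1 a2] : avg (E1 B) /\ avg (E2 B) by near: B.
  have HB : forall i : 'I_n, E1 B (fun x => rho x * (x 0 i ^+ 2)) <= c /\ E2 B (fun x => rho x * (x 0 i ^+ 2)) <= c by near: B.
  have tb E : avg E -> (forall i : 'I_n, E (fun x => rho x * (x 0 i ^+ 2)) <= c) ->
     E (fun x => rho x * tail L x) <= e.
    move=> aE HE; apply: le_trans LL.
    apply: (@le_trans _ _ (E (fun x => \sum_(i < n) (L ^+ 2)^-1 * (rho x * x 0 i ^+ 2)))).
      apply: avg_le => // x; apply: (@le_trans _ _ (rho x * ((\sum_(i < n) x 0 i ^+ 2) / L ^+ 2))).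
        by rewrite ler_wpM2l ?rho_ge0// /tail ge_min lexx orbT.
      rewrite mulr_suml mulr_sumr; apply: ler_sum => i _.
      by rewrite le_eqVlt (_ : rho x * _ = (L ^+ 2)^-1 * (rho x * x 0 i ^+ 2)) ?eqxx//; ring.
    rewrite avg_sum//; apply: (@le_trans _ _ (\sum_(i < n) (L ^+ 2)^-1 * c)).
      by apply: ler_sum => i _; rewrite avgZ// ler_wpM2l// invr_ge0 exprn_ge0// ltW.
    by rewrite sumr_const card_ord -mulrnAr mulrC mulr_natl.
  by split; apply: tb => // i; have [] := HB i.
- move=> t; apply: (@D_taylor t cos (@cosT R)); last by move=> k y; exact: cos_taylor.
  by elim=> [|k IH]; [exact: D0|apply: (DD _ _ IH); exact: DZ].
- move=> t; apply: (@D_taylor t sin (@sinT R)); last by move=> k y; exact: sin_taylor.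
  by elim=> [|k IH]; [exact: D0|apply: (DD _ _ IH); exact: DZ].
Unshelve. all: by end_near.
Qed.
End moment_compare.

(** * Removal of the weight *)

Definition damp (R : realType) (n : nat) (e : R) (x : 'rV[R]_n) : R := (Num.max (rho x) e)^-1.

Lemma continuous_rho (R : realType) n : continuous (@rho R n).
Proof. by apply: cont_prod => i; apply: cont_exp; exact: cont_coord. Qed.

Lemma bcont_damp (R : realType) n (e : R) : 0 < e -> bcont (@damp R n e).
Proof.
move=> e0; have m0 (x : 'rV[R]_n) : 0 < Num.max (rho x) e by rewrite lt_max e0 orbT.
split.
  move=> x; apply: (cvg_comp (fun x => Num.max (rho x) e) (fun r : R => r^-1)); last first.
    by apply: inv_continuous; rewrite gt_eqF.
  apply: (@continuous_max R _ (@rho R n) (cst e) x); first exact: continuous_rho.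
  exact: cst_continuous.
exists (e^-1) => x; rewrite /damp ger0_norm ?invr_ge0 ?(ltW (m0 x))// lef_pV2 ?posrE//.
by rewrite le_max lexx orbT.
Qed.

(** The product is the minimum of 1 and [rho x / e], a continuous cutoff that vanishes on the
    coordinate hyperplanes and equals 1 where [rho x] is at least [e]. *)
Lemma damp_itv (R : realType) n (e : R) (x : 'rV[R]_n) : 0 < e -> 0 <= rho x * damp e x <= 1.
Proof.
move=> e0; have m0 : 0 < Num.max (rho x) e by rewrite lt_max e0 orbT.
rewrite /damp mulr_ge0 ?rho_ge0 ?invr_ge0 ?(ltW m0)//=.
by rewrite ler_pdivrMr// mul1r le_max lexx.
Qed.

Lemma bcont_rho_damp (R : realType) n (e : R) : 0 < e -> bcont (fun x : 'rV[R]_n => rho x * damp e x).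
Proof.
move=> e0; split; first exact: cont_mul (@continuous_rho R n) (bcont_damp n e0).1.
by exists 1 => x; have /andP[? ?] := damp_itv x e0; rewrite ger0_norm.
Qed.

(** The cutoff [phi] is [rho] times a bounded continuous function, so [f * phi] is covered by the
    weighted comparison. Applied to the constant 1, the same comparison shows that [E1] also gives
    little mass to [1 - phi], because the limit [I] does. *)
Lemma remove_weight (R : realType) n (T : Type) (G : set_system T) (FG : Filter G)
    (E1 E2 : T -> ('rV[R]_n -> R) -> R) (I : ('rV[R]_n -> R) -> R) :
  (\forall B \near G, avg (E1 B)) ->
  posfun I -> I (fun=> 1) = 1 ->
  (forall f, bcont f -> E2 B f @[B --> G] --> I f) ->
  (forall h, bcont h ->
     E1 B (fun x => rho x * h x) - E2 B (fun x => rho x * h x) @[B --> G] --> (0 : R)) ->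
  (forall e, 0 < e -> exists2 d, 0 < d & 1 - I (fun x => rho x * damp d x) <= e) ->
  forall f, bcont f -> E1 B f @[B --> G] --> I f.
Proof.
move=> av pI I1 HE2 Hr small f bf; have [C fC] := bf.2.
have C0 : 0 <= C by apply: le_trans (fC 0).
apply/cvgrPdist_le => e e0.
pose e1 := e / (8 * (C + 1)).
have C1 : 0 < C + 1 by rewrite ltr_wpDl.
have e10 : 0 < e1 by rewrite divr_gt0// mulr_gt0.
have [d d0 small1] := small _ e10.
pose phi (x : 'rV[R]_n) := rho x * damp d x.
have bphi : bcont phi := bcont_rho_damp n d0.
have bfphi : bcont (fun x => f x * phi x) := bcontM bf bphi.
have phi01 x : 0 <= phi x <= 1 := damp_itv x d0.
have lim h : bcont h -> E1 B (fun x => h x * phi x) @[B --> G] --> I (fun x => h x * phi x).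
  move=> bh; have : E1 B (fun x => rho x * (h x * damp d x)) - E2 B (fun x => rho x * (h x * damp d x))
      + E2 B (fun x => h x * phi x) @[B --> G] --> 0 + I (fun x => h x * phi x).
    by apply: cvgD; [exact: (Hr _ (bcontM bh (bcont_damp n d0)))|exact: (HE2 _ (bcontM bh bphi))].
  rewrite add0r; apply: cvg_trans; apply: near_eq_cvg; apply: nearW => B.
  have -> : (fun x => rho x * (h x * damp d x)) = (fun x => h x * phi x).
    by apply/funext => x; rewrite /phi mulrCA.
  by rewrite subrK.
have e4 : 0 < e / 4 by rewrite divr_gt0.
have /cvgrPdist_le/(_ _ e4) N1 := lim _ bf.
have /cvgrPdist_le/(_ _ e10) N2 := lim _ (bcont_cst _ (1 : R)).
near=> B.
have aE : avg (E1 B) by near: B.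
have {}N1' : `|I (fun x => f x * phi x) - E1 B (fun x => f x * phi x)| <= e / 4 by near: B.
have {}N2' : `|I (fun x => 1 * phi x) - E1 B (fun x => 1 * phi x)| <= e1 by near: B.
have r1 : `|E1 B f - E1 B (fun x => f x * phi x)| <= C * (1 - E1 B (fun x => 1 * phi x)).
  rewrite -(avgB aE).
  have -> : C * (1 - E1 B (fun x => 1 * phi x)) = E1 B (fun x => C * (1 - 1 * phi x)).
    rewrite (avgZ aE C); congr (_ * _).
    by have := avgB aE (fun=> 1) (fun x => 1 * phi x); rewrite (avg_cst aE) => /esym.
  apply: (avg_norm aE) => x; have /andP[p0 p1] := phi01 x.
  rewrite -{1}[f x]mulr1 -mulrBr normrM mul1r ler_pM//.
  by rewrite ger0_norm// subr_ge0.
have b1 : bcont (fun x => 1 * 1 + (-1) * phi x) := bcont_lin 1 (-1) (bcont_cst _ 1) bphi.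
have r2 : `|I f - I (fun x => f x * phi x)| <= C * (1 - I phi).
  have -> : I f - I (fun x => f x * phi x) = I (fun x => 1 * f x + (-1) * (f x * phi x)).
    by rewrite pI.1// mul1r mulN1r.
  have -> : C * (1 - I phi) = I (fun x => C * (1 * 1 + -1 * phi x) + 0 * 1).
    rewrite (pI.1 C 0 _ _ b1 (bcont_cst _ 1)) (pI.1 1 (-1) _ _ (bcont_cst _ 1) bphi) I1; ring.
  apply: (posfun_norm pI); [exact: bcont_lin|exact: bcont_lin b1 (bcont_cst _ 1)|].
  move=> x; have /andP[p0 p1] := phi01 x.
  have -> : 1 * f x + -1 * (f x * phi x) = f x * (1 - phi x) by ring.
  have -> : C * (1 * 1 + -1 * phi x) + 0 * 1 = C * (1 - phi x) by ring.
  by rewrite normrM ler_pM// ger0_norm// subr_ge0.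
have Ip : I (fun x => 1 * phi x) = I phi by congr I; apply/funext => x; rewrite mul1r.
rewrite Ip in N2'.
have Ce : C * e1 <= e / 8.
  have -> : e / 8 = (C + 1) * e1 by rewrite /e1; field; rewrite gt_eqF.
  by rewrite ler_wpM2r ?(ltW e10)// lerDl.
have s2 : C * (1 - I phi) <= e / 8 by apply: le_trans Ce; rewrite ler_wpM2l.
have s1 : C * (1 - E1 B (fun x => 1 * phi x)) <= e / 4.
  apply: (@le_trans _ _ (C * (e1 + e1))); last by lra.
  rewrite ler_wpM2l//; move: N2' small1; rewrite -/(phi) !ler_norml.
  set u := I _; set v := E1 B _.
  by move=> /andP[? ?] ?; lra.
have k1 := le_trans r1 s1; have k2 := le_trans r2 s2.
move: k1 k2 N1'; rewrite !ler_norml.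
set a := E1 B f; set b := E1 B _; set c := I f; set g := I _.
by move=> /andP[? ?] /andP[? ?] /andP[? ?]; apply/andP; split; lra.
Unshelve. all: by end_near. Qed.

(** Closeness of [V] and [W] is asked only where [W] is bounded by [L], since a change of
    normalization multiplies [W]. The function [r] majorizes the indicator of the bad event, and
    large values of [W] are paid by [tail L]. *)
Lemma slutsky (R : realType) n (T X : Type) (G : set_system T) (FG : Filter G)
    (E : T -> (X -> R) -> R) (V W : T -> X -> 'rV[R]_n) (I : ('rV[R]_n -> R) -> R) (c : R) :
  (\forall B \near G, avg (E B)) ->
  (forall L, 0 < L -> I (tail L) <= c / L ^+ 2) ->
  (forall f, bcont f -> E B (fun a => f (W B a)) @[B --> G] --> I f) ->
  (forall L d, 0 < L -> 0 < d -> exists r : T -> X -> R,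
     E B (r B) @[B --> G] --> (0 : R) /\
     \forall B \near G, forall a, 0 <= r B a /\
       ((forall i, `|W B a 0 i| <= L) -> (exists i, d < `|V B a 0 i - W B a 0 i|) -> 1 <= r B a)) ->
  forall f, bcont f -> E B (fun a => f (V B a)) @[B --> G] --> I f.
Proof.
move=> av Itail HW HV f bf; have [C fC] := bf.2.
have C0 : 0 <= C by apply: le_trans (fC 0).
apply/cvgrPdist_le => e e0.
have C1 : 0 < C + 1 by rewrite ltr_wpDl.
pose e1 := e / (16 * (C + 1)).
have e10 : 0 < e1 by rewrite divr_gt0// mulr_gt0.
(* Chosen so that [c / L ^+ 2 <= e1]; adding 1 keeps [L] positive. *)
pose L := Num.sqrt (`|c| / e1) + 1.
have L0 : 0 < L by rewrite ltr_wpDl ?sqrtr_ge0.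
have LL : c / L ^+ 2 <= e1.
  rewrite ler_pdivrMr ?exprn_gt0// -ler_pdivrMl// mulrC.
  apply: (@le_trans _ _ (`|c| / e1)); first by rewrite ler_wpM2r ?invr_ge0 ?(ltW e10)// ler_norm.
  have q0 : 0 <= `|c| / e1 by rewrite divr_ge0 ?(ltW e10).
  rewrite -[leLHS](sqr_sqrtr q0).
  by rewrite lerXn2r ?nnegrE ?sqrtr_ge0 ?(ltW L0)// lerDl.
have e4 : 0 < e / 4 by rewrite divr_gt0.
have [d d0 ud] := unif_cont_box L bf.1 e4.
have [r [/cvgrPdist_le/(_ _ e10) Nr rP]] := HV L d L0 d0.
have /cvgrPdist_le/(_ _ e10) Nt := HW _ (@bcont_tail R n L).
have /cvgrPdist_le/(_ _ e4) Nf := HW _ bf.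
near=> B.
have aE : avg (E B) by near: B.
have N1 : `|I f - E B (fun a => f (W B a))| <= e / 4 by near: B.
have N2 : `|I (tail L) - E B (fun a => tail L (W B a))| <= e1 by near: B.
have N3 : `|0 - E B (r B)| <= e1 by near: B.
have rB : forall a, 0 <= r B a /\
       ((forall i, `|W B a 0 i| <= L) -> (exists i, d < `|V B a 0 i - W B a 0 i|) -> 1 <= r B a) by near: B.
have le1 : `|E B (fun a => f (V B a)) - E B (fun a => f (W B a))|
   <= E B (fun a => e / 4 + (2 * C) * (r B a + tail L (W B a))).
  rewrite -(avgB aE); apply: (avg_norm aE) => a.
  have [ra0 ra] := rB a; have t0 := tail_ge0 L (W B a).
  have far : 1 <= r B a + tail L (W B a) -> `|f (V B a) - f (W B a)| <= e / 4 + 2 * C * (r B a + tail L (W B a)).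
    move=> h; apply: (@le_trans _ _ (2 * C * 1)).
      rewrite (le_trans (ler_normB _ _))// mulr1 mulr_natl mulr2n lerD//.
    apply: (@le_trans _ _ (2 * C * (r B a + tail L (W B a)))); first by rewrite ler_wpM2l// mulr_ge0.
    by rewrite lerDr ltW.
  have [WL|/existsNP[i /negP]] := pselect (forall i, `|W B a 0 i| <= L); last first.
    by rewrite -ltNge => Wi; apply: far; rewrite (tail_out L0 Wi) lerDr.
  have [ex|nex] := pselect (exists i, d < `|V B a 0 i - W B a 0 i|).
    by apply: far; rewrite -[leLHS]addr0 lerD// ra.
  rewrite distrC (le_trans (ud (W B a) (V B a) WL _))//.
    by move=> i; rewrite leNgt distrC; apply/negP => h; apply: nex; exists i.
  by rewrite lerDl mulr_ge0 ?mulr_ge0 ?addr_ge0.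
move: le1; rewrite (avgD aE) (avg_cst aE) (avgZ aE) (avgD aE) => le1.
have Ce : C * e1 <= e / 16.
  have -> : e / 16 = (C + 1) * e1 by rewrite /e1; field; rewrite gt_eqF.
  by rewrite ler_wpM2r ?(ltW e10)// lerDl.
have le2 : 2 * C * (E B (r B) + E B (fun a => tail L (W B a))) <= 2 * C * (e1 * 3).
  rewrite ler_wpM2l ?mulr_ge0//.
  move: N2 N3 (Itail _ L0) LL; rewrite sub0r normrN !ler_norml.
  set u := E B _; set v := E B _; set w := I _; move: (c / _) => q.
  by move=> /andP[? ?] /andP[? ?] ? ?; lra.
have le3 := le_trans le1 (lerD (lexx (e / 4)) le2).
have le4 : e / 4 + 2 * C * (e1 * 3) <= 3 / 4 * e.
  by rewrite (_ : 2 * C * (e1 * 3) = 6 * (C * e1)); [lra|ring].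
move: (le_trans le3 le4) N1; rewrite !ler_norml.
set u := E B _; set v := E B _; set w := I f.
by move=> /andP[? ?] /andP[? ?]; apply/andP; split; lra.
Unshelve. all: by end_near. Qed.

Lemma posfun_integral (R : realType) n (mu : probability (borel 'rV[R]_n) R) :
  posfun (fun f => \int[mu]_x f x).
Proof.
split=> [a b f g bf bg|f g bf bg fg].
  have iF := integrable_bcont mu bf; have iG := integrable_bcont mu bg.
  rewrite RintegralD//.
  - by rewrite !RintegralZl.
  - by apply: eq_integrable (integrableZl measurableT a iF) => // x _ /=; rewrite EFinM.
  - by apply: eq_integrable (integrableZl measurableT b iG) => // x _ /=; rewrite EFinM.
by apply: le_Rintegral => //; exact: integrable_bcont.
Qed.

(** If all coordinates are at least [h] in absolute value, then [rho] reaches the threshold and the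
    cutoff equals 1. The remaining mass is at most [n] times [2 * h], which is below [e]. *)
Lemma damp_small (R : realType) n (mu : probability (borel 'rV[R]_n) R) :
  (forall i (h : R), 0 < h -> (mu [set x : 'rV[R]_n | (`|x 0 i| < h)%R] <= (2 * h)%:E)%E) ->
  forall e, 0 < e -> exists2 d, 0 < d & 1 - \int[mu]_x (rho x * damp d x) <= e.
Proof.
move=> small e e0.
pose h := e / (2 * (n%:R + 1)).
have h0 : 0 < h by rewrite divr_gt0// mulr_gt0// ltr_wpDl.
have d0 : 0 < \prod_(i < n) h ^+ 2 by apply: prodr_gt0 => i _; rewrite exprn_gt0.
exists (\prod_(i < n) h ^+ 2) => //; set d := \prod_(i < n) _ in d0 *.
pose phi (x : 'rV[R]_n) := rho x * damp d x.
have bphi : bcont phi := bcont_rho_damp n d0.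
have b1 : bcont (fun x => 1 * 1 + (-1) * phi x) := bcont_lin 1 (-1) (bcont_cst _ 1) bphi.
have -> : 1 - \int[mu]_x (rho x * damp d x) = \int[mu]_x (1 * 1 + (-1) * phi x).
  rewrite ((posfun_integral mu).1 1 (-1) _ _ (bcont_cst _ 1) bphi) Rintegral_cst_prob mulr1.
  by rewrite mulN1r.
have i1 := integrable_bcont mu b1.
pose S (i : 'I_n) : set (borel 'rV[R]_n) := [set x : 'rV[R]_n | (`|x 0 i| < h)%R].
have mS i : measurable (S i).
  have cm : measurable_fun setT (fun x : borel 'rV[R]_n => (x : 'rV[R]_n) 0 i : R).
    by apply: measurable_fun_continuous; exact: cont_coord.
  rewrite -[S i]setTI.
  rewrite (_ : S i = (fun x : borel 'rV[R]_n => (x : 'rV[R]_n) 0 i : R) @^-1` `](-h), h[%classic).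
    by apply: cm => //; exact: measurable_itv.
  by apply/seteqP; split => x; rewrite /S /= in_itv/= ltr_norml.
rewrite -lee_fin /Rintegral fineK; last exact: (integrable_fin_num measurableT i1).
apply: (@le_trans _ _ (\int[mu]_x \sum_(i < n) (\1_(S i) x)%:E)%E).
  apply: ge0_le_integral => //.
  - move=> x _; have /andP[p0 p1] := damp_itv x d0.
    by rewrite lee_fin /phi; lra.
  - exact: (measurable_int mu i1).
  - apply: emeasurable_sum => i; apply/measurable_EFinP; exact: measurable_indic.
  - move=> x _; rewrite sumEFin lee_fin.
    have /andP[p0 p1] := damp_itv x d0.
    have [/existsP[i xi]|/existsPn nx] := boolP [exists i, `|x 0 i| < h].
      apply: (@le_trans _ _ 1); first by rewrite /phi; lra.
      rewrite (bigD1 i)//= indicE mem_set// lerDl sumr_ge0//.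
    have dr : d <= rho x.
      apply: ler_prod => i _; rewrite exprn_ge0 ?(ltW h0)//= -[leRHS]real_normK ?num_real//.
      by rewrite lerXn2r ?nnegrE ?(ltW h0)// leNgt nx.
    rewrite /phi /damp (max_idPl dr) divff ?gt_eqF//; last by apply: lt_le_trans dr.
    by rewrite mulr1 mulN1r subrr sumr_ge0.
rewrite ge0_integral_sum//; last first.
  by move=> i; apply/measurable_EFinP; exact: measurable_indic.
apply: (@le_trans _ _ (\sum_(i < n) (2 * h)%:E)%E).
  by apply: lee_sum => i _; rewrite integral_indic// setIT; exact: small.
rewrite sumEFin lee_fin sumr_const card_ord -[leLHS]mulr_natl.
have n1 : 0 < (n%:R + 1 : R) by rewrite ltr_wpDl.
have -> : n%:R * (2 * h) = e * n%:R / (n%:R + 1) by rewrite /h; field; rewrite gt_eqF.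
by rewrite ler_pdivrMr// ler_wpM2l ?(ltW e0)// lerDl.
Qed.

(** [trig_compare] against a constant family; unit variances give tightness on both sides by
    Chebyshev. *)
Lemma gaussian_cvg (R : realType) n (T : Type) (G : set_system T) (FG : Filter G)
    (E : T -> ('rV[R]_n -> R) -> R) (S : 'M[R]_n) (mu : probability (borel 'rV[R]_n) R) :
  psd S ->
  (forall (c : 'rV[R]_n) (A : set R), measurable A ->
     mu [set x | A (dot c x)] = normal_law 0 (Num.sqrt ((c *m S *m c^T) 0 0)) A) ->
  (\forall B \near G, avg (E B)) ->
  (\forall B \near G, forall i, E B (fun x => x 0 i ^+ 2) <= 1) ->
  (forall i, S i i = 1) ->
  (forall t, E B (fun x => cos (dot t x)) @[B --> G] --> expR (- ((t *m S *m t^T) 0 0 / 2))) ->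
  (forall t, E B (fun x => sin (dot t x)) @[B --> G] --> (0 : R)) ->
  forall f, bcont f -> E B f @[B --> G] --> \int[mu]_x f x.
Proof.
move=> Spsd law av var Sii Ec Es f bf.
suff : E B f - \int[mu]_x f x @[B --> G] --> (0 : R).
  move=> h; have : E B f - \int[mu]_x f x + \int[mu]_x f x @[B --> G] --> 0 + \int[mu]_x f x.
    by apply: cvgD => //; exact: cvg_cst.
  by rewrite add0r; apply: cvg_trans; apply: near_eq_cvg; apply: nearW => B; rewrite subrK.
apply: (@trig_compare R n T G FG E (fun _ f => \int[mu]_x f x) 1) => //.
- apply: filterS av => B aE; split; last exact: posfun_integral.
  by have := avg_posfun aE (fun=> ler01); under eq_fun do under eq_fun do rewrite mul1r.
- by apply: filterS av => B [_ _ ->]; rewrite Rintegral_cst_prob.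
- move=> e e0; pose L := Num.sqrt (n%:R / e) + 1.
  have L0 : 0 < L by rewrite ltr_wpDl ?sqrtr_ge0.
  have LL : n%:R / L ^+ 2 <= e.
    rewrite ler_pdivrMr ?exprn_gt0// -ler_pdivrMl// mulrC.
    have q0 : 0 <= n%:R / e by rewrite divr_ge0 ?(ltW e0).
    rewrite -[leLHS](sqr_sqrtr q0).
    by rewrite lerXn2r ?nnegrE ?sqrtr_ge0 ?(ltW L0)// lerDl.
  exists L => //; near=> B.
  have aE : avg (E B) by near: B.
  have vB : forall i, E B (fun x => x 0 i ^+ 2) <= 1 by near: B.
  split; last first.
    apply: le_trans (gaussian_tail Spsd law L0) _.
    by rewrite (eq_bigr (fun=> 1))// sumr_const card_ord.
  apply: le_trans LL; apply: (@le_trans _ _ (E B (fun x => \sum_(i < n) (L ^+ 2)^-1 * x 0 i ^+ 2))).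
    by apply: (avg_le aE) => x; rewrite -mulr_sumr mulrC /tail ge_min lexx orbT.
  rewrite (avg_sum aE); apply: (@le_trans _ _ (\sum_(i < n) (L ^+ 2)^-1 * 1)).
    by apply: ler_sum => i _; rewrite (avgZ aE) ler_wpM2l// invr_ge0 exprn_ge0// ltW.
  by rewrite mulr1 sumr_const card_ord mulr_natl.
- move=> t; rewrite (gaussian_cos Spsd law) -[X in _ --> X](subrr (expR (- ((t *m S *m t^T) 0 0 / 2)))).
  by apply: cvgB; [exact: Ec|exact: cvg_cst].
- move=> t; rewrite (gaussian_sin law) -[X in _ --> X](subrr 0).
  by apply: cvgB; [exact: Es|exact: cvg_cst].
Unshelve. all: by end_near. Qed.

(** * Expansion of moments over incidence patterns *)

Lemma big_option_type (R : nmodType) (I : finType) (F : option I -> R) :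
  \sum_o F o = F None + \sum_p F (Some p).
Proof.
rewrite (bigD1 None)//=; congr (_ + _).
rewrite (reindex_omap Some id)/=; last by case.
by apply: eq_bigl => p; rewrite eqxx.
Qed.

Lemma prod_bool (R : realType) (J : finType) (b : pred J) :
  \prod_j (b j)%:R = ([forall j, b j])%:R :> R.
Proof.
have [/forallP h|/forallPn[j nb]] := boolP [forall j, b j].
  by rewrite big1// => j _; rewrite h.
by rewrite (bigD1 j)//= (negbTE nb) mul0r.
Qed.

Definition incidence (R : realType) (n : nat) (I : finType) (D : {ffun 'I_n -> {set I}})
    (w : {ffun I -> {set 'I_n}}) : R :=
  ([forall i, forall p in D i, i \in w p])%:R.

(** Stated for an arbitrary linear [L] because it is applied to a difference of two expectations.
    Each factor selects either its constant or one element [p]. A selection compatible with [D] has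
    at most [#|D (u l)|] choices of [p] in the factor [l], which accounts for [k%:R ^+ k]. *)
Lemma incidence_moment (R : realType) (n : nat) (I : finType)
    (L : ({ffun I -> {set 'I_n}} -> R) -> R) (k : nat) (u : 'I_k -> 'I_n)
    (a : 'I_n -> I -> R) (b beta : 'I_n -> R) (Th : R) (good : {set I}) :
  (forall (J : finType) (c : J -> R) F, L (fun w => \sum_j c j * F j w) = \sum_j c j * L (F j)) ->
  0 <= Th -> (forall i p, p \in good -> `|a i p| <= Th) ->
  (forall i p, p \notin good -> a i p = 0) -> (forall i, `|b i| <= beta i) ->
  `|L (fun w => \prod_l (\sum_p a (u l) p * (u l \in w p)%:R + b (u l)))| <=
  k%:R ^+ k * \prod_l (beta (u l) + Th) *
  \sum_(D : {ffun 'I_n -> {set I}} |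
     [forall i, (D i \subset good) && (#|D i| <= #|[pred l | u l == i]|)%N])
    `|L (incidence R D)|.
Proof.
move=> Llin Th0 a_good a_bad b_beta.
have be0 i : 0 <= beta i by apply: le_trans (b_beta i).
pose c l (o : option I) := if o is Some p then a (u l) p else b (u l).
pose c' l (o : option I) := if o is Some p then Th * (p \in good)%:R else beta (u l).
have c'0 l o : 0 <= c' l o by case: o => [p|] /=; rewrite ?be0 ?mulr_ge0.
have cc' l o : `|c l o| <= c' l o.
  case: o => [p|] //=; have [pg|pb] := boolP (p \in good); first by rewrite mulr1 a_good.
  by rewrite a_bad// normr0 mulr0.
(* Indicators are idempotent, so a product of them depends only on which elements were selected for
   each index, not on how often. *)
pose supp (phi : {ffun 'I_k -> option I}) : {ffun 'I_n -> {set I}} :=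
  [ffun i => finset (fun p => [exists l, (u l == i) && (phi l == Some p)])].
have -> : (fun w : {ffun I -> {set 'I_n}} => \prod_l (\sum_p a (u l) p * (u l \in w p)%:R + b (u l)))
   = (fun w => \sum_(phi : {ffun 'I_k -> option I}) (\prod_l c l (phi l)) * incidence R (supp phi) w).
  apply/funext => w.
  pose e l (o : option I) : bool := if o is Some p then u l \in w p else true.
  transitivity (\prod_l \sum_(o : option I) c l o * (e l o)%:R).
    by apply: eq_bigr => l _; rewrite big_option_type /= mulr1 addrC.
  rewrite bigA_distr_bigA; apply: eq_bigr => phi _; rewrite big_split; congr (_ * _).
  rewrite prod_bool; congr (nat_of_bool _)%:R; apply/forallP/forallP => h.
    move=> i; apply/forall_inP => p; rewrite ffunE inE => /existsP[l /andP[/eqP <- /eqP pl]].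
    by have := h l; rewrite /e pl.
  move=> l; rewrite /e; case pl: (phi l) => [p|//].
  have /forall_inP := h (u l); apply; rewrite ffunE inE; apply/existsP; exists l.
  by rewrite eqxx pl eqxx.
rewrite Llin (le_trans (ler_norm_sum _ _ _))//.
apply: (@le_trans _ _ (\sum_(phi : {ffun 'I_k -> option I}) (\prod_l c' l (phi l)) * `|L (incidence R (supp phi))|)).
  apply: ler_sum => phi _; rewrite normrM ler_wpM2r// normr_prod.
  by apply: ler_prod => l _; rewrite normr_ge0 cc'.
rewrite (partition_big supp predT)//= mulr_sumr [leRHS]big_mkcond/=.
apply: ler_sum => D _.
rewrite (eq_bigr (fun phi : {ffun 'I_k -> option I} => (\prod_l c' l (phi l)) * `|L (incidence R D)|)); last first.
  by move=> phi /eqP ->.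
rewrite -mulr_suml.
have [adm|nadm] := ifPn; last first.
  rewrite big1 ?mul0r// => phi /eqP suppD.
  apply/eqP; apply: contraR nadm => nz; apply/forallP => i; apply/andP; split.
    apply/fintype.subsetP => p; rewrite -suppD ffunE inE => /existsP[l /andP[_ /eqP pl]].
    apply: contraR nz => pb.
    by rewrite (bigD1 l)//= pl /= (negbTE pb) mulr0 mul0r.
  rewrite -suppD ffunE -(card_imset _ (@Some_inj _)); apply: leq_trans (leq_imset_card phi _).
  apply: subset_leq_card; apply/fintype.subsetP => o /imsetP[p]; rewrite inE => /existsP[l /andP[ul /eqP pl]] ->.
  by apply/imsetP; exists l; rewrite ?inE.
rewrite ler_wpM2r//.
(* Having support exactly [D] is relaxed to selecting inside [D], a condition on each factor
   separately; the sum then becomes a product. *)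
apply: (@le_trans _ _ (\sum_(phi : {ffun 'I_k -> option I})
    \prod_l (c' l (phi l) * (if phi l is Some p then (p \in D (u l))%:R else 1)))).
  rewrite big_mkcond; apply: ler_sum => phi _; case: ifPn => [/eqP suppD|_]; last first.
    by apply: prodr_ge0 => l _; rewrite mulr_ge0//; case: (phi l).
  apply: ler_prod => l _; rewrite c'0 /=.
  case pl: (phi l) => [p|]; last by rewrite mulr1.
  suff -> : p \in D (u l) by rewrite mulr1.
  by rewrite -suppD ffunE inE; apply/existsP; exists l; rewrite eqxx pl eqxx.
rewrite -(bigA_distr_bigA (fun l o => c' l o * (if o is Some p then (p \in D (u l))%:R else 1))).
have -> : k%:R ^+ k = \prod_(l < k) (k%:R : R) by rewrite prodr_const card_ord.
rewrite -big_split; apply: ler_prod => l _; apply/andP; split.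
  by apply: sumr_ge0 => o _; rewrite mulr_ge0//; case: o.
rewrite big_option_type /= mulr1.
(* A factor [l] exists, so [k] is positive and [beta] is at most [k] times itself. *)
have k1 : (1 <= k)%N by apply: leq_ltn_trans (ltn_ord l).
have /forallP/(_ (u l))/andP[_ cD] := adm.
have cDk : (#|D (u l)| <= k)%N by apply: (leq_trans cD); rewrite -[leqRHS]card_ord max_card.
apply: (@le_trans _ _ (beta (u l) + Th * #|D (u l)|%:R)).
  rewrite lerD2l -sum1_card natr_sum mulr_sumr [leRHS]big_mkcond /=; apply: ler_sum => p _.
  by case: ifP => _; rewrite ?mulr0// !mulr1 ler_piMr//; case: (p \in good).
rewrite mulrDr lerD//.
  by rewrite ler_peMl// ler1n.
by rewrite mulrC ler_wpM2r// ler_nat.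
Qed.

(** * Squarefree divisors *)

Lemma coprime_no_common_prime (a b : nat) : (0 < a)%N ->
  (forall q, prime q -> q %| a -> q %| b -> false)%N -> coprime a b.
Proof.
move=> a0 H; rewrite /coprime; apply: contraT => g1.
have gt1 : (1 < gcdn a b)%N by rewrite ltn_neqAle eq_sym g1 gcdn_gt0 a0.
apply: (H (pdiv (gcdn a b))); first exact: pdiv_prime.
  exact: dvdn_trans (pdiv_dvd _) (dvdn_gcdl _ _).
exact: dvdn_trans (pdiv_dvd _) (dvdn_gcdr _ _).
Qed.

Section squarefree_products.
Local Open Scope nat_scope.
Implicit Types (r : seq nat).

Lemma prod_primes_gt0 r : all prime r -> 0 < \prod_(p <- r) p.
Proof.
move=> /allP rp; rewrite big_seq; apply: prodn_cond_gt0 => p /rp; exact: prime_gt0.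
Qed.

Lemma logn_prod_primes r q : all prime r -> prime q ->
  logn q (\prod_(p <- r) p) = count_mem q r.
Proof.
move=> + qp; elim: r => [|p r IH] /=; first by rewrite big_nil logn1.
move=> /andP[pp rp]; rewrite big_cons lognM ?(prime_gt0 pp) ?prod_primes_gt0//.
by rewrite IH// logn_prime// eq_sym.
Qed.

Lemma dvd_prod_primes r q : all prime r -> prime q ->
  (q %| \prod_(p <- r) p) = (q \in r).
Proof.
move=> rp qp; have := logn_gt0 q (\prod_(p <- r) p).
rewrite logn_prod_primes// -has_count has_pred1 mem_primes qp prod_primes_gt0//=.
Qed.

Lemma omega_prod_primes r : all prime r -> uniq r -> omega (\prod_(p <- r) p) = size r.
Proof.
move=> rp ru; apply: perm_size; apply: uniq_perm => //; first exact: primes_uniq.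
move=> q; rewrite mem_primes prod_primes_gt0//=; have [qp|/negbTE qp] := boolP (prime q).
  by rewrite dvd_prod_primes.
by apply/esym/negP => /(allP rp); rewrite qp.
Qed.

Lemma moebius_prod_primes r : all prime r -> uniq r ->
  (moebius (\prod_(p <- r) p) ^+ 2 = 1)%R.
Proof.
move=> rp ru; rewrite /moebius ifT ?sqrr_sign//.
apply/allP => q; rewrite mem_primes => /and3P[qp d0 _].
by rewrite pfactor_dvdn// logn_prod_primes// count_uniq_mem// -ltnNge ltnS leq_b1.
Qed.

Lemma prod_primes_dvd r m : all prime r -> uniq r ->
  (\prod_(p <- r) p %| m) = all (fun p => p %| m) r.
Proof.
elim: r => [|p r IH] /=; first by rewrite big_nil dvd1n.
move=> /andP[pp rp] /andP[pr ru]; rewrite big_cons Gauss_dvd ?IH//.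
by rewrite prime_coprime// dvd_prod_primes.
Qed.

(** Comparison of valuations: on both sides they are 0 or 1, with the same primes. *)
Lemma squarefree_eq_prod d r : 0 < d -> (moebius d ^+ 2 = 1)%R -> all prime r -> uniq r ->
  (forall q, prime q -> (q \in r) = (q %| d)) -> d = \prod_(p <- r) p.
Proof.
move=> d0 md rp ru rd; apply: eqn_from_log => //; first exact: prod_primes_gt0.
move=> q; have [qp|qp] := boolP (prime q); last first.
  by rewrite (lognE q d) (lognE q (\prod_(p <- r) p)) (negbTE qp).
rewrite logn_prod_primes// count_uniq_mem// rd//.
have sq : all (fun p => ~~ (p ^ 2 %| d)) (primes d).
  by move: md; rewrite /moebius; case: ifP.
have [qd|qd] := boolP (q %| d); last first.
  by apply/eqP; rewrite -leqn0 leqNgt logn_gt0 mem_primes qp d0 (negbTE qd).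
have /(allP sq) : q \in primes d by rewrite mem_primes qp d0.
rewrite pfactor_dvdn// -ltnNge ltnS => l1; apply/eqP; rewrite eqn_leq l1/=.
by rewrite logn_gt0 mem_primes qp d0.
Qed.

End squarefree_products.

Definition nats (N : nat) (S : {set 'I_N}) : seq nat := [seq val p | p <- enum S].

Lemma nats_uniq N (S : {set 'I_N}) : uniq (nats S).
Proof. by rewrite map_inj_uniq ?enum_uniq//; exact: val_inj. Qed.

Lemma mem_nats N (S : {set 'I_N}) (p : 'I_N) : (val p \in nats S) = (p \in S).
Proof. by rewrite mem_map ?mem_enum//; exact: val_inj. Qed.

Lemma size_nats N (S : {set 'I_N}) : size (nats S) = #|S|.
Proof. by rewrite size_map -cardE. Qed.

Definition prod_vec (n N : nat) (D : {ffun 'I_n -> {set 'I_N}}) : {ffun 'I_n -> nat} :=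
  [ffun i => (\prod_(p <- nats (D i)) p)%N].

Definition good_primes (R : realType) (A : R) (N : nat) : {set 'I_N} :=
  finset (fun p : 'I_N => prime p && (A < (p : nat)%:R)).

Lemma good_prime (R : realType) (A : R) N (S : {set 'I_N}) : S \subset good_primes A N -> all prime (nats S).
Proof.
move=> /fintype.subsetP sub; apply/allP => q /mapP[p]; rewrite mem_enum => /sub + ->.
by rewrite inE => /andP[].
Qed.

Lemma dvd_vprod n (d : {ffun 'I_n -> nat}) q : prime q ->
  (q %| vprod d)%N = [exists i, (q %| d i)%N].
Proof.
move=> qp; rewrite /vprod Euclid_dvd_prod// big_orE; apply: eq_existsb => i.
by [].
Qed.

(** A squarefree vector corresponds to the family of its sets of prime divisors, with [omega] as
    cardinality. In particular the range is finite, and the finitely supported sum is an ordinary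
    one. *)
Lemma trunc_vecs_sum (R : realType) n (A y : R) (k : 'I_n -> nat) (h : {ffun 'I_n -> nat} -> R) :
  0 <= y ->
  \sum_(d \in trunc_vecs A y k) h d =
  \sum_(D : {ffun 'I_n -> {set 'I_(Num.truncn y).+1}} |
     [forall i, (D i \subset good_primes A (Num.truncn y).+1) && (#|D i| <= k i)%N])
    h (prod_vec D).
Proof.
move=> y0; set N := (Num.truncn y).+1.
pose P (D : {ffun 'I_n -> {set 'I_N}}) :=
  [forall i, (D i \subset good_primes A N) && (#|D i| <= k i)%N].
have PP D : P D -> forall i, (D i \subset good_primes A N) /\ (#|D i| <= k i)%N.
  by move=> /forallP H i; apply/andP.
pose r := [seq prod_vec D | D <- enum P].
have dvdE D : P D -> forall i (q : 'I_N), prime q -> (q %| prod_vec D i)%N = (q \in D i).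
  move=> PD i q qp; rewrite ffunE dvd_prod_primes ?mem_nats//.
  exact: good_prime (PP D PD i).1.
have ru : uniq r.
  rewrite map_inj_in_uniq ?enum_uniq// => D D'; rewrite !mem_enum => PD PD' e.
  apply/ffunP => i; apply/finset.setP => q.
  have [qp|qp] := boolP (prime q); first by rewrite -!dvdE// e.
  have bad E : P E -> (q \in E i) = false.
    move=> PE; apply/negP => /(fintype.subsetP (PP E PE i).1).
    by rewrite inE (negbTE qp).
  by rewrite !bad.
have trN (q : nat) : q%:R <= y -> (q < N)%N by move=> qy; rewrite /N ltnS truncn_ge_nat.
transitivity (\sum_(d <- r) h d).
  rewrite (fsbig_seq _ _ ru); apply: eq_fsbigl; apply/seteqP; split => d.
  - move=> [dpos dp dk] /=.
    pose D : {ffun 'I_n -> {set 'I_N}} := [ffun i => finset (fun p : 'I_N => prime p && (p %| d i)%N)].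
    have Dg i : D i \subset good_primes A N.
      apply/fintype.subsetP => p; rewrite ffunE !inE => /andP[pp pd]; rewrite pp/=.
      by have /(dp p pp)/andP[] : (p %| vprod d)%N by rewrite dvd_vprod//; apply/existsP; exists i.
    have DE : d = prod_vec D.
      apply/ffunP => i; rewrite ffunE; apply: squarefree_eq_prod => //.
      - exact: (dk i).1.
      - exact: good_prime (Dg i).
      - exact: nats_uniq.
      - move=> q qp; apply/idP/idP.
          by move=> /mapP[p]; rewrite mem_enum ffunE inE => /andP[_ pd] ->.
        move=> qd; have qN : (q < N)%N.
          by have /(dp q qp)/andP[_ /trN] : (q %| vprod d)%N by rewrite dvd_vprod//; apply/existsP; exists i.
        by rewrite -[q]/(val (Ordinal qN)) mem_nats ffunE inE qp.
    apply/mapP; exists D => //; rewrite mem_enum; apply/forallP => i; rewrite Dg /=.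
    rewrite -size_nats -(omega_prod_primes (good_prime (Dg i)) (nats_uniq _)).
    by have := (dk i).2; rewrite {1}DE ffunE.
  - move=> /= /mapP[D]; rewrite mem_enum => PD ->; split.
    + by move=> i; rewrite ffunE prod_primes_gt0// (good_prime (PP D PD i).1).
    + move=> q qp; rewrite dvd_vprod// => /existsP[j]; rewrite ffunE dvd_prod_primes//; last exact: good_prime (PP D PD j).1.
      move=> /mapP[p]; rewrite mem_enum => /(fintype.subsetP (PP D PD j).1); rewrite inE => /andP[_ Ap] ->.
      rewrite Ap /=; have := ltn_ord p; rewrite /N ltnS -(ler_nat R) => /le_trans; apply.
      by rewrite truncn_le.
    + move=> i; rewrite ffunE; have gp := good_prime (PP D PD i).1; split.
        exact: moebius_prod_primes gp (nats_uniq _).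
      by rewrite (omega_prod_primes gp (nats_uniq _)) size_nats (PP D PD i).2.
by rewrite big_map big_enum.
Qed.

(** * Counting and local densities *)

(** The vector is the product over the primes [p] of the vectors with entry [p] at the positions of
    [T p], and these are coprime in pairs. *)
Lemma g_prod_primes (R : realType) n (g : {ffun 'I_n -> nat} -> R) (r : seq nat) (T : nat -> {set 'I_n}) :
  g (ones n) = 1 -> multiplicative_vec g -> uniq r ->
  (forall p i, p \in r -> i \in T p -> prime p) ->
  g [ffun i => (\prod_(p <- r) (if i \in T p then p else 1))%N] = \prod_(p <- r) g_at g (T p) p.
Proof.
move=> g1 gm; elim: r => [_ _|p r IH /= /andP[pr ru] Tp].
  by rewrite big_nil -[RHS]g1; congr g; apply/ffunP => i; rewrite !ffunE big_nil.
have Tr q j : q \in r -> j \in T q -> prime q.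
  by move=> qr; apply: Tp; rewrite inE qr orbT.
have Tpp j : j \in T p -> prime p by apply: Tp; rewrite inE eqxx.
rewrite big_cons -IH// /g_at.
set v1 := [ffun i => if i \in T p then p else 1%N]; set v2 := [ffun i => (\prod_(_ <- r) _)%N].
have pos1 : pos_vec v1 by move=> j; rewrite ffunE; case: ifP => // /Tpp/prime_gt0.
have pos2 : pos_vec v2.
  move=> j; rewrite ffunE big_seq; apply: prodn_cond_gt0 => q qr.
  by case: ifP => // /(Tr _ _ qr)/prime_gt0.
rewrite -gm//; first by congr g; apply/ffunP => i; rewrite !ffunE big_cons.
apply: coprime_no_common_prime; first by rewrite prodn_gt0// => j; exact: pos1.
move=> q qp; rewrite !dvd_vprod// => /existsP[j]; rewrite ffunE; case: ifP; last first.
  by move=> _; rewrite dvdn1 => /eqP q1; rewrite q1 in qp.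
move=> /Tpp pp; rewrite dvdn_prime2// => /eqP qE /existsP[l]; rewrite ffunE.
rewrite Euclid_dvd_prod// big_has => /hasP[q' q'r]; case: ifP; last first.
  by move=> _; rewrite dvdn1 => /eqP q1; rewrite q1 in qp.
move=> /(Tr _ _ q'r) q'p; rewrite dvdn_prime2// => /eqP qE'.
by move: pr; rewrite -qE qE' q'r.
Qed.

Lemma g_prod_vec (R : realType) n (g : {ffun 'I_n -> nat} -> R) (A : R) N (D : {ffun 'I_n -> {set 'I_N}}) :
  g (ones n) = 1 -> multiplicative_vec g -> (forall i, D i \subset good_primes A N) ->
  g (prod_vec D) = \prod_(p < N) g_at g (finset (fun i => p \in D i)) p.
Proof.
move=> g1 gm Dg.
pose T (q : nat) : {set 'I_n} := finset (fun i => q \in nats (D i)).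
have := @g_prod_primes R n g (map val (index_enum 'I_N)) T g1 gm _ _.
have -> : [ffun i => (\prod_(p <- map val (index_enum 'I_N)) (if i \in T p then p else 1))%N] = prod_vec D.
  apply/ffunP => i; rewrite !ffunE /nats !big_map big_enum [RHS]big_mkcond /=.
  by apply: eq_bigr => p _; rewrite inE mem_nats.
move=> ->.
- rewrite big_map; apply: eq_bigr => p _; congr g_at.
  by apply/finset.setP => i; rewrite !inE mem_nats.
- by rewrite map_inj_uniq ?index_enum_uniq//; exact: val_inj.
- move=> p i _; rewrite inE; exact: (allP (good_prime (Dg i))).
Qed.

(* [q p] is the limiting law of the set of [i] such that [p] divides [m_i]; it is
   an arbitrary probability when [p] is not a prime above [A]. *)
Definition local_law (R : realType) n (g : {ffun 'I_n -> nat} -> R) (A : R)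
    (q : nat -> {set 'I_n} -> R) : Prop :=
  [/\ forall p S, 0 <= q p S, forall p, \sum_S q p S = 1
    & forall p (T : {set 'I_n}), prime p -> A < p%:R -> \sum_S q p S * (T \subset S)%:R = g_at g T p].

(** Regrouped by primes, the incidence is a product of independent conditions that the pattern at
    [p] contains [T p], each of probability [g_at g (T p) p]. Where [T p] is empty the factor is 1,
    which covers all [p] outside the good primes. *)
Lemma pexp_incidence (R : realType) n (g : {ffun 'I_n -> nat} -> R) (A : R) q N
    (D : {ffun 'I_n -> {set 'I_N}}) :
  g (ones n) = 1 -> multiplicative_vec g -> local_law g A q ->
  (forall i, D i \subset good_primes A N) ->
  pexp (fun p : 'I_N => q p) (incidence R D) = g (prod_vec D).
Proof.
move=> g1 gm [q0 q1 qg] Dg; rewrite (g_prod_vec (A := A))//.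
pose T (p : 'I_N) : {set 'I_n} := finset (fun i => p \in D i).
rewrite (_ : incidence R D = (fun w => \prod_p (T p \subset w p)%:R)); last first.
  apply/funext => w; rewrite prod_bool; congr (nat_of_bool _)%:R.
  apply/forallP/forallP => H.
    move=> p; apply/fintype.subsetP => i; rewrite inE => pD.
    by have /forall_inP/(_ p pD) := H i.
  move=> i; apply/forall_inP => p pD; apply: (fintype.subsetP (H p)); by rewrite inE.
rewrite (pexp_prod (fun p : 'I_N => q p) (fun p S => (T p \subset S)%:R)).
apply: eq_bigr => p _.
have [] := boolP (p \in good_primes A N); first by rewrite inE => /andP[pp Ap]; exact: qg.
move=> pb; have T0 : T p = finset.set0.
  apply/finset.setP => i; rewrite !inE; apply/negP => /(fintype.subsetP (Dg i)).
  by rewrite (negbTE pb).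
rewrite -/(T p) T0; under eq_bigr do rewrite finset.sub0set mulr1.
rewrite q1 -g1 /g_at; congr g; apply/ffunP => i; by rewrite !ffunE inE.
Qed.

Section counting.
Variables (R : realType) (Omega : choiceType) (n : nat).
Variables (M : R -> R) (chi : R -> Omega -> R).
Hypothesis M_ge0 : forall B, 1 <= B -> 0 <= M B.
Hypothesis chi_ge0 : forall B a, 1 <= B -> 0 <= chi B a.
Hypothesis chi_finite : forall B, 1 <= B -> finite_set [set a | 0 < chi B a].

Definition total (B : R) : R := \sum_(a \in [set: Omega]) chi B a.

Lemma chi_sum B : 1 <= B -> exists s : seq Omega, forall f : Omega -> R,
  \sum_(a \in [set: Omega]) chi B a * f a = \sum_(a <- s) chi B a * f a.
Proof.
move=> B1; exists (finmap.enum_fset (fset_set [set a | 0 < chi B a])) => f.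
rewrite (fsbigE (finmap.enum_fset (fset_set [set a | 0 < chi B a]))).
- by apply: eq_bigl => a; rewrite in_setT.
- exact: finmap.fset_uniq.
- by move=> a.
- move=> a _; rewrite in_fset_set; last exact: chi_finite.
  rewrite notin_setE /= => /negP; rewrite -leNgt => c0.
  have : chi B a == 0 by rewrite eq_le c0 chi_ge0.
  by move=> /eqP ->; rewrite mul0r.
Qed.

Lemma chi_sum_set B (S : set Omega) :
  \sum_(a \in S) chi B a = \sum_(a \in [set: Omega]) chi B a * (a \in S)%:R.
Proof.
rewrite fsbig_mkcond; apply: eq_fsbigr => a _; rewrite /patch.
by case: ifP => _; rewrite ?mulr1 ?mulr0.
Qed.

Lemma expectE B f : expect chi B f = (\sum_(a \in [set: Omega]) chi B a * f a) / total B.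
Proof.
rewrite /expect mulr_fsuml; apply: eq_fsbigr => a _.
by rewrite /prob fsbig_set1 mulrAC.
Qed.

Lemma prob_expect B (S : set Omega) : prob chi B S = expect chi B (fun a => (a \in S)%:R).
Proof. by rewrite expectE /prob chi_sum_set. Qed.

Lemma expect_avg B : 1 <= B -> 0 < total B -> avg (expect chi B).
Proof.
move=> B1 t0; have [s sE] := chi_sum B1; split.
- move=> J r c F; rewrite expectE sE.
  transitivity ((\sum_(j <- r) c j * \sum_(a <- s) chi B a * F j a) / total B).
    congr (_ / _); rewrite (eq_bigr (fun a => \sum_(j <- r) c j * (chi B a * F j a))); last first.
      by move=> a _; rewrite mulr_sumr; apply: eq_bigr => j _; rewrite mulrCA.
    by rewrite exchange_big; apply: eq_bigr => j _; rewrite mulr_sumr.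
  by rewrite mulr_suml; apply: eq_bigr => j _; rewrite expectE sE mulrA.
- move=> f h fh; rewrite !expectE !sE ler_wpM2r ?invr_ge0 ?(ltW t0)//.
  by apply: ler_sum => a _; rewrite ler_wpM2l// chi_ge0.
- rewrite expectE; under eq_fsbigr do rewrite mulr1.
  by rewrite divff// gt_eqF.
Qed.

Variable m : Omega -> {ffun 'I_n -> nat}.

Lemma mass_expect d B : 0 < total B ->
  mass chi m d B = total B * expect chi B (fun a => ([forall i, (d i %| m a i)%N])%:R).
Proof.
move=> t0; rewrite expectE mulrCA divff ?gt_eqF// mulr1 /mass chi_sum_set.
apply: eq_fsbigr => a _; congr (_ * (nat_of_bool _)%:R).
apply/idP/idP; first by rewrite inE => H; apply/forallP.
by move=> /forallP H; rewrite inE.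
Qed.

Lemma mass_ones B : mass chi m (ones n) B = total B.
Proof.
rewrite /mass /total; apply: eq_fsbigl; apply/seteqP; split => a //= _ i.
by rewrite ffunE dvd1n.
Qed.

Variables (A : R) (g : {ffun 'I_n -> nat} -> R).
Hypothesis g_lim : forall d, pos_vec d -> primes_above A d ->
     mass chi m d B / M B @[B --> +oo] --> g d.

Lemma g_ones : total B / M B @[B --> +oo] --> (1 : R) -> g (ones n) = 1.
Proof.
move=> H; have pv : pos_vec (ones n) by move=> i; rewrite ffunE.
have pa : primes_above A (ones n).
  move=> p pp; rewrite dvd_vprod// => /existsP[j]; rewrite ffunE dvdn1 => /eqP p1.
  by rewrite p1 in pp.
have := g_lim pv pa; rewrite (_ : (fun B => mass chi m (ones n) B / M B) = (fun B => total B / M B)).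
  by move=> h; exact: (cvg_unique _ h H).
by apply/funext => B; rewrite mass_ones.
Qed.

Lemma mass_ge0 d B : 1 <= B -> 0 <= mass chi m d B.
Proof. by move=> B1; apply: fsumr_ge0 => a _; exact: chi_ge0. Qed.

Lemma g_ge0 d : (forall d, pos_vec d -> ~ primes_above A d -> g d = 0) -> pos_vec d -> 0 <= g d.
Proof.
move=> g_zero pd; have [pa|npa] := pselect (primes_above A d); last by rewrite g_zero.
apply: (cvgr_to_ge (g_lim pd pa)); near=> B.
by rewrite divr_ge0 ?mass_ge0 ?M_ge0//; near: B; exact: nbhs_pinfty_ge.
Unshelve. all: by end_near. Qed.

Definition pattern_mass p (S : {set 'I_n}) B : R :=
  \sum_(a \in [set a | finset (fun i => (p %| m a i)%N) = S]) chi B a.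

Lemma mass_patterns p (T : {set 'I_n}) B : 1 <= B ->
  mass chi m [ffun i => if i \in T then p else 1%N] B =
  \sum_S pattern_mass p S B * (T \subset S)%:R.
Proof.
move=> B1; have [s sE] := chi_sum B1.
rewrite /mass chi_sum_set sE (eq_bigr (fun S : {set 'I_n} => \sum_(a <- s) chi B a *
   (a \in [set a | finset (fun i => (p %| m a i)%N) = S])%:R * (T \subset S)%:R)); last first.
  by move=> S _; rewrite /pattern_mass chi_sum_set sE mulr_suml.
rewrite exchange_big; apply: eq_bigr => a _.
rewrite (bigD1 (finset (fun i => (p %| m a i)%N)))//= big1 ?addr0; last first.
  move=> S /eqP nS; rewrite memNset ?mulr0 ?mul0r//= => h; exact: nS.
rewrite [in RHS]mem_set// mulr1; congr (_ * (nat_of_bool _)%:R).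
apply/idP/idP.
  rewrite inE => H; apply/fintype.subsetP => i iT; rewrite inE.
  by have := H i; rewrite ffunE iT.
move=> /fintype.subsetP H; rewrite inE => i; rewrite ffunE; case: ifP => // /H.
by rewrite inE.
Qed.

(** Induction from the full set downwards: having pattern exactly [S] is having a pattern containing
    [S], whose density is a value of [g], minus the patterns strictly containing [S]. *)
Lemma pattern_mass_cvg p (S : {set 'I_n}) : prime p -> A < p%:R ->
  exists l, pattern_mass p S B / M B @[B --> +oo] --> (l : R).
Proof.
move=> pp Ap; have [k] := ubnP (n - #|S|)%N; elim: k S => // k IH S Sk.
have pv : pos_vec [ffun i => if i \in S then p else 1%N].
  by move=> i; rewrite ffunE; case: ifP => // _; exact: prime_gt0.
have pa : primes_above A [ffun i => if i \in S then p else 1%N].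
  move=> q qp; rewrite dvd_vprod// => /existsP[j]; rewrite ffunE; case: ifP => _.
    by rewrite dvdn_prime2// => /eqP ->.
  by rewrite dvdn1 => /eqP q1; rewrite q1 in qp.
have /choice[l Hl] : forall S' : {set 'I_n}, exists l, S \proper S' -> pattern_mass p S' B / M B @[B --> +oo] --> (l : R).
  move=> S'; have [SS'|nSS'] := boolP (S \proper S'); last by exists 0.
  have [|l Hl] := IH S'; last by exists l.
  have := proper_card SS'; have := max_card (mem S'); rewrite card_ord => h1 h2.
  rewrite ltnS in Sk; apply: leq_trans Sk; apply: ltn_sub2l => //.
  exact: leq_trans h1.
exists (g [ffun i => if i \in S then p else 1%N] - \sum_(S' : {set 'I_n} | S \proper S') l S').
have : mass chi m [ffun i => if i \in S then p else 1%N] B / M B -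
    \sum_(S' : {set 'I_n} | S \proper S') pattern_mass p S' B / M B @[B --> +oo] -->
    g [ffun i => if i \in S then p else 1%N] - \sum_(S' : {set 'I_n} | S \proper S') l S'.
  apply: cvgB; first exact: g_lim.
  by apply: cvg_bigsum => S'; exact: Hl.
apply: cvg_trans; apply: near_eq_cvg; near=> B.
have B1 : 1 <= B by near: B; exact: nbhs_pinfty_ge.
rewrite mass_patterns// mulr_suml (bigD1 S)//= subxx mulr1 -addrA.
rewrite [X in _ + X](_ : _ = 0) ?addr0//; apply/eqP; rewrite subr_eq0; apply/eqP.
rewrite big_mkcond [RHS]big_mkcond; apply: eq_bigr => S' _.
rewrite finset.properEneq [S == _]eq_sym; case: (S' == S) => //=.
by case: (S \subset S'); rewrite ?mulr1 ?mulr0 ?mul0r.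
Unshelve. all: by end_near. Qed.

(** The law at [p] consists of the limiting masses of exact patterns, nonnegative as limits of
    nonnegative quotients and of total [g (ones n) = 1]. At the other [p] a Dirac mass at the empty
    pattern is taken. *)
Lemma local_law_exists : total B / M B @[B --> +oo] --> (1 : R) -> exists q, local_law g A q.
Proof.
move=> tot1.
have H p : exists q : {set 'I_n} -> R, [/\ forall S, 0 <= q S, \sum_S q S = 1
    & forall T : {set 'I_n}, prime p -> A < p%:R -> \sum_S q S * (T \subset S)%:R = g_at g T p].
  have [/andP[pp Ap]|bad] := boolP (prime p && (A < p%:R)); last first.
    exists (fun S => (S == finset.set0)%:R); split => //.
      by rewrite (bigD1 finset.set0)//= eqxx big1 ?addr0// => S /negbTE ->.
    by move=> T pp Ap; rewrite pp Ap in bad.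
  have /choice[l Hl] : forall S, exists l, pattern_mass p S B / M B @[B --> +oo] --> (l : R).
    by move=> S; exact: pattern_mass_cvg.
  have lg (T : {set 'I_n}) : \sum_S l S * (T \subset S)%:R = g_at g T p.
    have pv : pos_vec [ffun i => if i \in T then p else 1%N].
      by move=> i; rewrite ffunE; case: ifP => // _; exact: prime_gt0.
    have pa : primes_above A [ffun i => if i \in T then p else 1%N].
      move=> q qp; rewrite dvd_vprod// => /existsP[j]; rewrite ffunE; case: ifP => _.
        by rewrite dvdn_prime2// => /eqP ->.
      by rewrite dvdn1 => /eqP q1; rewrite q1 in qp.
    have h1 := g_lim pv pa.
    have h2 : \sum_S pattern_mass p S B / M B * (T \subset S)%:R @[B --> +oo] -->
        (\sum_S l S * (T \subset S)%:R : R).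
      by apply: cvg_bigsum => S _; exact: (cvgM (Hl S) (cvg_cst _)).
    apply: (cvg_unique _ _ h1) => //; apply: cvg_trans h2; apply: near_eq_cvg; near=> B.
    have B1 : 1 <= B by near: B; exact: nbhs_pinfty_ge.
    by rewrite mass_patterns// mulr_suml; apply: eq_bigr => S _; rewrite mulrAC.
  exists l; split => [S||T _ _]; last exact: lg.
    apply: (cvgr_to_ge (Hl S)); near=> B.
    have B1 : 1 <= B by near: B; exact: nbhs_pinfty_ge.
    rewrite divr_ge0 ?M_ge0//; apply: fsumr_ge0 => a _; exact: chi_ge0.
  have := lg finset.set0; under eq_bigr do rewrite finset.sub0set mulr1.
  move=> ->; rewrite -(g_ones tot1) /g_at; congr g; apply/ffunP => i.
  by rewrite !ffunE inE.
have /choice[q Hq] := H; exists q; split.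
- by move=> p S; have [] := Hq p.
- by move=> p; have [] := Hq p.
- by move=> p; have [] := Hq p.
Unshelve. all: by end_near. Qed.

End counting.

(** * Comparison of moments with the independent model *)

Section statistic.
Variables (R : realType) (n : nat) (A : R) (g : {ffun 'I_n -> nat} -> R).
Variables (theta : 'I_n -> nat -> R) (y : R).
Local Notation N := (Num.truncn y).+1.

(** Primes up to [A] are dropped because the limits defining [g] say nothing about them; [g] is zero
    there, so the mean is unchanged. *)
Definition coef (i : 'I_n) (p : 'I_N) : R :=
  if p \in good_primes A N then theta i p else 0.

(** A function of the incidence pattern alone, so that the same function is evaluated on actual
    integers and in the model. *)
Definition statistic (w : {ffun 'I_N -> {set 'I_n}}) : 'rV[R]_n :=
  \row_i ((\sum_p coef i p * (i \in w p)%:R - mean theta g i y) / stdev theta g i y).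

Definition divisor_pattern (mv : {ffun 'I_n -> nat}) : {ffun 'I_N -> {set 'I_n}} :=
  [ffun p : 'I_N => finset (fun i => (p %| mv i)%N)].

Lemma incidence_pattern (D : {ffun 'I_n -> {set 'I_N}}) mv :
  (forall i, D i \subset good_primes A N) ->
  incidence R D (divisor_pattern mv) = ([forall i, (prod_vec D i %| mv i)%N])%:R.
Proof.
move=> Dg; congr (nat_of_bool _)%:R; apply: eq_forallb => i.
rewrite ffunE prod_primes_dvd ?nats_uniq//; last exact: good_prime (Dg i).
apply/forall_inP/allP => [H _ /mapP[p pD ->]|H p pD].
  by rewrite mem_enum in pD; have := H p pD; rewrite ffunE inE.
by rewrite ffunE inE; apply: H; rewrite mem_nats.
Qed.
End statistic.

Section moment_diff.
Variables (R : realType) (Omega : choiceType) (n : nat).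
Variables (M : R -> R) (chi : R -> Omega -> R).
Hypothesis chi_ge0 : forall B a, 1 <= B -> 0 <= chi B a.
Hypothesis chi_finite : forall B, 1 <= B -> finite_set [set a | 0 < chi B a].
Variables (m : Omega -> {ffun 'I_n -> nat}) (A : R) (g : {ffun 'I_n -> nat} -> R).
Hypothesis g1 : g (ones n) = 1.
Hypothesis g_pos : forall d, pos_vec d -> 0 <= g d.
Hypothesis g_mult : multiplicative_vec g.
Variables (theta : 'I_n -> nat -> R) (Theta : R).
Hypothesis Theta0 : 0 <= Theta.
Hypothesis theta_bound : forall i p, prime p -> `|theta i p| <= Theta.
Variable q : nat -> {set 'I_n} -> R.
Hypothesis q_law : local_law g A q.

(** The expectation is normalized by the total mass and [g] by [M B]; changing one into the other
    produces the term with the remainder at [ones n]. *)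
Lemma incidence_diff B (y : R) (D : {ffun 'I_n -> {set 'I_(Num.truncn y).+1}}) :
  1 <= B -> 0 < total chi B ->
  (forall i, D i \subset good_primes A (Num.truncn y).+1) ->
  `|expect chi B (fun a => incidence R D (divisor_pattern y (m a))) -
    pexp (fun p : 'I_(Num.truncn y).+1 => q p) (incidence R D)| <=
  (g (prod_vec D) * `|remainder M chi m g (ones n) B| + `|remainder M chi m g (prod_vec D) B|)
   / total chi B.
Proof.
move=> B1 t0 Dg; rewrite (pexp_incidence g1 g_mult q_law Dg).
under [X in expect _ _ X]eq_fun do rewrite (incidence_pattern _ Dg).
have := mass_expect m (prod_vec D) t0; set e := expect _ _ _ => me.
have gd : 0 <= g (prod_vec D).
  apply: g_pos => i; rewrite ffunE; apply: prod_primes_gt0; exact: good_prime (Dg i).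
rewrite ler_pdivlMr// -{1}(gtr0_norm t0) -normrM.
have -> : (e - g (prod_vec D)) * total chi B =
   remainder M chi m g (prod_vec D) B - g (prod_vec D) * remainder M chi m g (ones n) B.
  rewrite /remainder me (mass_expect m (ones n) t0) -(mass_expect m (ones n) t0) mass_ones g1.
  by ring.
by rewrite (le_trans (ler_normB _ _))// normrM (ger0_norm gd) addrC.
Qed.

(** [incidence_moment] for the difference of the actual and the model expectation, with the means as
    constants. Grouping equal letters turns products over the word into powers with the
    multiplicities as exponents, the shape of condition (v). *)
Lemma moment_diff B (y : R) (s : seq 'I_n) : 1 <= B -> 0 < total chi B -> 0 <= y ->
  (forall i, 0 < stdev theta g i y) ->
  `|expect chi B (fun a => word s (statistic A g theta (divisor_pattern y (m a)))) -
    pexp (fun p : 'I_(Num.truncn y).+1 => q p) (fun w => word s (@statistic R n A g theta y w))| <=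
  (size s)%:R ^+ (size s) *
  ((\prod_i (`|mean theta g i y| + Theta) ^+ count_mem i s) /
   (\prod_i stdev theta g i y ^+ count_mem i s) *
   ((\sum_(d \in trunc_vecs A y (fun i => count_mem i s))
      (g d * `|remainder M chi m g (ones n) B| + `|remainder M chi m g d B|)) / total chi B)).
Proof.
move=> B1 t0 y0 V0; set N := (Num.truncn y).+1.
have avE := expect_avg chi_ge0 chi_finite B1 t0.
pose u (l : 'I_(size s)) := tnth (in_tuple s) l.
have prod_u (F : 'I_n -> R) : \prod_l F (u l) = \prod_(i <- s) F i by rewrite [RHS]big_tnth.
have prod_c (F : 'I_n -> R) : \prod_(i <- s) F i = \prod_i F i ^+ count_mem i s.
  elim: s {u prod_u} => [|j r IH]; first by rewrite big_nil big1// => i _; rewrite expr0.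
  rewrite big_cons IH (bigD1 j)//= mulrA [RHS](bigD1 j)//= eqxx add1n exprS; congr (_ * _).
  by apply: eq_bigr => i /negbTE ij; rewrite eq_sym ij add0n.
have count_u i : #|[pred l | u l == i]| = count_mem i s.
  by rewrite -sum1_card -sum1_count [RHS]big_tnth; apply: eq_bigl.
pose L (F : {ffun 'I_N -> {set 'I_n}} -> R) :=
  expect chi B (fun a => F (divisor_pattern y (m a))) - pexp (fun p : 'I_N => q p) F.
have Llin (J : finType) (c : J -> R) (F : J -> {ffun 'I_N -> {set 'I_n}} -> R) :
   L (fun w => \sum_j c j * F j w) = \sum_j c j * L (F j).
  have [lin _ _] := avE.
  rewrite /L lin pexp_sum -sumrB; apply: eq_bigr => j _.
  by rewrite pexpZ mulrBr.
pose Vs := \prod_(i <- s) stdev theta g i y.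
have Vs0 : 0 < Vs by apply: prodr_gt0 => i _; exact: V0.
have wordE (w : {ffun 'I_N -> {set 'I_n}}) : word s (@statistic R n A g theta y w) =
   Vs^-1 * \prod_l (\sum_p coef A theta (u l) p * (u l \in w p)%:R + - mean theta g (u l) y).
  rewrite (prod_u (fun i => \sum_p coef A theta i p * (i \in w p)%:R + - mean theta g i y)).
  rewrite /Vs -prodfV -big_split; apply: eq_bigr => i _.
  by rewrite mxE mulrC.
have aG i (p : 'I_N) : p \in good_primes A N -> `|coef A theta i p| <= Theta.
  move=> pg; rewrite /coef pg; apply: theta_bound.
  by move: pg; rewrite inE => /andP[].
have aB i (p : 'I_N) : p \notin good_primes A N -> coef A theta i p = 0.
  by rewrite /coef => /negbTE ->.
have bb i : `|- mean theta g i y| <= `|mean theta g i y| by rewrite normrN.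
have im := @incidence_moment R n _ L (size s) u (fun i p => coef A theta i p) (fun i => - mean theta g i y)
   (fun i => `|mean theta g i y|) Theta (good_primes A N) Llin Theta0 aG aB bb.
have -> : expect chi B (fun a => word s (statistic A g theta (divisor_pattern y (m a)))) -
    pexp (fun p : 'I_N => q p) (fun w => word s (@statistic R n A g theta y w)) =
    Vs^-1 * L (fun w => \prod_l (\sum_p coef A theta (u l) p * (u l \in w p)%:R + - mean theta g (u l) y)).
  rewrite /L mulrBr -(avgZ avE) -pexpZ; congr (_ - _); congr (_ _ _).
  - by apply/funext => a; rewrite wordE.
  - by apply/funext => a; rewrite wordE.
rewrite normrM gtr0_norm ?invr_gt0// mulrC ler_pdivrMr//.
apply: (le_trans im).
rewrite (prod_u (fun i => `|mean theta g i y| + Theta)) (prod_c (fun i => `|mean theta g i y| + Theta)).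
rewrite -(prod_c (fun i => stdev theta g i y)) -/Vs.
set Pm := \prod_i _; set S := \sum_(D | _) _; set k := _ ^+ _.
have Pm0 : 0 <= Pm by apply: prodr_ge0 => i _; rewrite exprn_ge0// addr_ge0.
set SS := (\sum_(d \in _) _) / _.
have -> : k * (Pm / Vs * SS) * Vs = k * Pm * SS by field; rewrite gt_eqF.
rewrite ler_wpM2l ?mulr_ge0 ?exprn_ge0//.
rewrite /SS (trunc_vecs_sum _ _ _ y0) mulr_suml /S.
rewrite (eq_bigl (fun D : {ffun 'I_n -> {set 'I_N}} =>
   [forall i, (D i \subset good_primes A N) && (#|D i| <= count_mem i s)%N])); last first.
  by move=> D; apply: eq_forallb => i; rewrite count_u.
apply: ler_sum => D /forallP DP; apply: incidence_diff => // i.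
by have /andP[] := DP i.
Qed.
End moment_diff.

(** * The independent model *)

Section model.
Variables (R : realType) (n : nat) (A : R) (g : {ffun 'I_n -> nat} -> R).
Hypothesis g_zero : forall d, pos_vec d -> ~ primes_above A d -> g d = 0.
Variables (theta : 'I_n -> nat -> R) (Theta : R).
Hypothesis Theta0 : 0 <= Theta.
Hypothesis theta_bound : forall i p, prime p -> `|theta i p| <= Theta.
Variable q : nat -> {set 'I_n} -> R.
Hypothesis q_law : local_law g A q.
Variable y : R.
Local Notation N := (Num.truncn y).+1.
Hypothesis V0 : forall i, 0 < stdev theta g i y.

Lemma g_at_bad (T : {set 'I_n}) p i : i \in T -> prime p -> ~~ (A < p%:R) -> g_at g T p = 0.
Proof.
move=> iT pp pA; rewrite /g_at g_zero//.
  by move=> j; rewrite ffunE; case: ifP => // _; exact: prime_gt0.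
move=> /(_ p pp); rewrite dvd_vprod// (negbTE pA) => H.
have /H// : [exists j, (p %| [ffun l => if l \in T then p else 1%N] j)%N].
by apply/existsP; exists i; rewrite ffunE iT dvdnn.
Qed.

Lemma sum_primes_good (F : nat -> R) : (forall p, prime p -> ~~ (A < p%:R) -> F p = 0) ->
  \sum_(0 <= p < N | prime p) F p = \sum_(p < N) (if p \in good_primes A N then F p else 0).
Proof.
move=> F0; rewrite big_mkord big_mkcond; apply: eq_bigr => p _; rewrite inE.
by case: ifP => //= pp; case: ifPn => // /F0 ->.
Qed.

Definition centered (i : 'I_n) (p : 'I_N) (S : {set 'I_n}) : R :=
  coef A theta i p * ((i \in S)%:R - g_at g [set i] p) / stdev theta g i y.

(** The mean runs over all primes up to [y], but [g] vanishes at those not above [A]; subtracting it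
    therefore centers each prime exactly. *)
Lemma statistic_centered w i : @statistic R n A g theta y w 0 i = \sum_p centered i p (w p).
Proof.
rewrite mxE /centered -mulr_suml; congr (_ / _).
under [RHS]eq_bigr do rewrite mulrBr.
rewrite sumrB; congr (_ - _); rewrite /mean sum_primes_good; last first.
  by move=> p pp pA; rewrite (g_at_bad (i := i))// ?mulr0// finset.set11.
by apply: eq_bigr => p _; rewrite /coef; case: ifP; rewrite ?mul0r.
Qed.

Lemma dot_statistic (t : 'rV[R]_n) w : dot t (@statistic R n A g theta y w) = \sum_p \sum_i t 0 i * centered i p (w p).
Proof.
rewrite /dot exchange_big; apply: eq_bigr => i _ /=.
by rewrite statistic_centered mulr_sumr.
Qed.

Lemma q_pmfs : pmfs (fun p : 'I_N => q p).
Proof. by have [q0 q1 _] := q_law; split. Qed.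

Lemma law_single p i : prime p -> A < p%:R -> \sum_S q p S * (i \in S)%:R = g_at g [set i] p.
Proof.
move=> pp pA; have [_ _ <-//] := q_law; apply: eq_bigr => S _.
by rewrite finset.sub1set.
Qed.

Lemma law_pair p i j : prime p -> A < p%:R ->
  \sum_S q p S * ((i \in S)%:R * (j \in S)%:R) = g_at g [set i; j] p.
Proof.
move=> pp pA; have [_ _ <-//] := q_law; apply: eq_bigr => S _.
by rewrite finset.subUset !finset.sub1set -natrM mulnb.
Qed.

Lemma g_single01 p i : prime p -> A < p%:R -> 0 <= g_at g [set i] p <= 1.
Proof.
move=> pp pA; have [q0 q1 _] := q_law; rewrite -law_single//; apply/andP; split.
  by apply: sumr_ge0 => S _; rewrite mulr_ge0.
by rewrite -[leRHS](q1 p); apply: ler_sum => S _; rewrite ler_piMr ?q0//; case: (i \in S).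
Qed.

Lemma centered0 i (p : 'I_N) : \sum_S q p S * centered i p S = 0.
Proof.
have [_ q1 _] := q_law.
have [pg|/negbTE pb] := boolP (p \in good_primes A N); last first.
  by rewrite big1// => S _; rewrite /centered /coef pb !mul0r mulr0.
have /andP[pp pA] : prime p && (A < (p : nat)%:R) by move: pg; rewrite inE.
rewrite (eq_bigr (fun S => coef A theta i p / stdev theta g i y *
   (q p S * (i \in S)%:R - q p S * g_at g [set i] p))); last first.
  by move=> S _; rewrite /centered; ring.
by rewrite -mulr_sumr sumrB law_single// -mulr_suml q1 mul1r subrr mulr0.
Qed.

Lemma centered_bound i p S : `|centered i p S| <= Theta / stdev theta g i y.
Proof.
rewrite /centered normrM normfV (gtr0_norm (V0 i)) ler_wpM2r ?invr_ge0 ?(ltW (V0 i))//.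
have [pg|/negbTE pb] := boolP (p \in good_primes A N); last first.
  by rewrite /coef pb mul0r normr0.
have /andP[pp pA] : prime p && (A < (p : nat)%:R) by move: pg; rewrite inE.
have /andP[h0 h1] := g_single01 i pp pA.
rewrite normrM -[leRHS]mulr1 ler_pM//; first by rewrite /coef pg theta_bound.
by rewrite ler_norml; case: (i \in S) => /=; apply/andP; split; lra.
Qed.

(** At one prime the indicators of [i] and [j] have covariance equal to the value of [g] at the pair
    minus the product of the single values. *)
Lemma centered_cov i j :
  \sum_(p < N) \sum_S q p S * (centered i p S * centered j p S) = correlation theta g i j y.
Proof.
have [_ q1 _] := q_law.
rewrite /correlation sum_primes_good; last first.
  move=> p pp pA; rewrite (g_at_bad (i := i) (T := [set i; j]))// ?finset.set21//.
  by rewrite (g_at_bad (i := i))// ?finset.set11// mul0r subrr mulr0.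
rewrite mulr_suml; apply: eq_bigr => p _; rewrite inE.
have [/andP[pp pA]|/negbTE pb] := boolP (_ && _); last first.
  by rewrite mul0r big1// => S _; rewrite /centered /coef inE pb !mul0r mulr0.
have cE k : coef A theta k p = theta k p by rewrite /coef inE pp pA.
rewrite (eq_bigr (fun S => theta i p * theta j p / (stdev theta g i y * stdev theta g j y) *
   (q p S * ((i \in S)%:R * (j \in S)%:R) - g_at g [set j] p * (q p S * (i \in S)%:R)
    - g_at g [set i] p * (q p S * (j \in S)%:R) + g_at g [set i] p * g_at g [set j] p * q p S))); last first.
  by move=> S _; rewrite /centered !cE invfM; ring.
rewrite -mulr_sumr big_split /= !sumrB -!mulr_sumr law_pair// !law_single// q1.
by ring.
Qed.

Lemma statistic_cov i j :
  pexp (fun p : 'I_N => q p) (fun w => @statistic R n A g theta y w 0 i * @statistic R n A g theta y w 0 j)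
  = correlation theta g i j y.
Proof.
under [X in pexp _ X]eq_fun do rewrite !statistic_centered.
rewrite pexp_cov; [exact: centered_cov|exact: q_pmfs|exact: centered0].
Qed.

(** For [i = j] the pair is a singleton, and numerator and denominator are the same sum; it is
    nonnegative since each [g_at g [set i] p] is a probability. *)
Lemma correlation_diag i : correlation theta g i i y = 1.
Proof.
have V : stdev theta g i y ^+ 2 = \sum_(0 <= p < N | prime p)
    theta i p ^+ 2 * g_at g [set i] p * (1 - g_at g [set i] p).
  rewrite sqr_sqrtr//; apply: sumr_ge0 => p pp.
  have [pA|pA] := boolP (A < p%:R); last first.
    by rewrite (g_at_bad (i := i))// ?finset.set11// mulr0 mul0r.
  have /andP[h0 h1] := g_single01 i pp pA.
  by apply: mulr_ge0; [apply: mulr_ge0 => //; exact: sqr_ge0|rewrite subr_ge0].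
rewrite /correlation -expr2 V finset.setUid.
rewrite (eq_bigr (fun p => theta i p ^+ 2 * g_at g [set i] p * (1 - g_at g [set i] p))).
  by rewrite divff// -V gt_eqF// exprn_gt0.
by move=> p _; ring.
Qed.

Lemma statistic_exp i (l : R) : `|l| * (Theta / stdev theta g i y) <= 1 / 2 ->
  pexp (fun p : 'I_N => q p) (fun w => expR (l * @statistic R n A g theta y w 0 i)) <= expR (2 * l ^+ 2).
Proof.
move=> lV.
have -> : (fun w => expR (l * @statistic R n A g theta y w 0 i)) =
    (fun w : {ffun 'I_N -> {set 'I_n}} => expR (\sum_p (l * centered i p (w p)))).
  by apply/funext => w; rewrite statistic_centered mulr_sumr.
apply: le_trans (pexp_expR (q := fun p : 'I_N => q p) (Z := fun p S => l * centered i p S) _ _ _) _.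
- exact: q_pmfs.
- move=> p; rewrite (eq_bigr (fun S => l * (q p S * centered i p S))); last by move=> S _; rewrite mulrCA.
  by rewrite -mulr_sumr centered0 mulr0.
- by move=> p S; rewrite normrM (le_trans _ lV)// ler_wpM2l// centered_bound.
rewrite ler_expR ler_wpM2l//.
rewrite (eq_bigr (fun p : 'I_N => l ^+ 2 * \sum_S q p S * (centered i p S * centered i p S))); last first.
  by move=> p _; rewrite mulr_sumr; apply: eq_bigr => S _; ring.
by rewrite -mulr_sumr centered_cov correlation_diag mulr1.
Qed.

Definition quad (t : 'rV[R]_n) : R := \sum_i \sum_j t 0 i * t 0 j * correlation theta g i j y.

Lemma sum_centered_sqr (t : 'rV[R]_n) :
  \sum_(p < N) \sum_S q p S * (\sum_i t 0 i * centered i p S) ^+ 2 = quad t.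
Proof.
transitivity (\sum_(p < N) \sum_S \sum_i \sum_j t 0 i * t 0 j * (q p S * (centered i p S * centered j p S))).
  apply: eq_bigr => p _; apply: eq_bigr => S _.
  rewrite expr2 mulr_suml mulr_sumr; apply: eq_bigr => i _.
  by rewrite mulr_sumr mulr_sumr; apply: eq_bigr => j _; ring.
rewrite (eq_bigr (fun p : 'I_N => \sum_i \sum_S \sum_j t 0 i * t 0 j * (q p S * (centered i p S * centered j p S)))); last first.
  by move=> p _; exact: exchange_big.
rewrite exchange_big; apply: eq_bigr => i _ /=.
rewrite (eq_bigr (fun p : 'I_N => \sum_j \sum_S t 0 i * t 0 j * (q p S * (centered i p S * centered j p S)))); last first.
  by move=> p _; exact: exchange_big.
rewrite exchange_big; apply: eq_bigr => j _ /=.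
by rewrite -centered_cov mulr_sumr; apply: eq_bigr => p _; rewrite mulr_sumr.
Qed.

(** The form is the variance of a linear combination in the model; in the limit this yields
    positivity of Sigma. *)
Lemma quad_ge0 (t : 'rV[R]_n) : 0 <= quad t.
Proof.
have [q0 _ _] := q_law.
rewrite -sum_centered_sqr; apply: sumr_ge0 => p _; apply: sumr_ge0 => S _.
by rewrite mulr_ge0 ?sqr_ge0.
Qed.

Lemma statistic_chf (t : 'rV[R]_n) : let d := \sum_(i < n) `|t 0 i| * (Theta / stdev theta g i y) in d <= 1 ->
  `|pexp (fun p : 'I_N => q p) (fun w => cos (dot t (@statistic R n A g theta y w))) - expR (- (quad t / 2))|
     <= expR (d * quad t) - 1 /\
  `|pexp (fun p : 'I_N => q p) (fun w => sin (dot t (@statistic R n A g theta y w)))|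
     <= expR (d * quad t) - 1.
Proof.
move=> d d1.
have cd p S : `|\sum_i t 0 i * centered i p S| <= d.
  rewrite (le_trans (ler_norm_sum _ _ _))//; apply: ler_sum => i _.
  by rewrite normrM ler_wpM2l// centered_bound.
have c0 (p : 'I_N) : \sum_S q p S * (\sum_i t 0 i * centered i p S) = 0.
  rewrite (eq_bigr (fun S => \sum_i t 0 i * (q p S * centered i p S))); last first.
    by move=> S _; rewrite mulr_sumr; apply: eq_bigr => i _; rewrite mulrCA.
  by rewrite exchange_big big1// => i _; rewrite -mulr_sumr centered0 mulr0.
have dE (h : R -> R) : (fun w => h (dot t (@statistic R n A g theta y w))) =
    (fun w : {ffun 'I_N -> {set 'I_n}} => h (\sum_p \sum_i t 0 i * centered i p (w p))).
  by apply/funext => w; rewrite dot_statistic.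
by have := pexp_chf q_pmfs c0 cd d1; rewrite sum_centered_sqr (dE cos) (dE sin).
Qed.

End model.

(** * Truncation error *)

Lemma pexp_avg (R : realType) (I T : finType) (q : I -> T -> R) : pmfs q -> avg (pexp q).
Proof.
move=> qP; split.
- by move=> J r c F; rewrite pexp_sum; apply: eq_bigr => j _; exact: pexpZ.
- by move=> f h; exact: pexp_le.
- exact: pexp_cst.
Qed.

Lemma primes_sum_split (R : realType) (A : R) N (th : nat -> R) d : (0 < d)%N ->
  \sum_(p <- primes d) th p =
  \sum_(p < N) (if p \in good_primes A N then th p else 0) * (p %| d)%:R +
  \sum_(p <- primes d | ~~ ((p < N)%N && (A < p%:R))) th p.
Proof.
move=> d0; rewrite (bigID (fun p => (p < N)%N && (A < p%:R))) /=; congr (_ + _).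
rewrite (eq_bigr (fun p : 'I_N => if (prime p && (A < (p : nat)%:R)) && (p %| d)%N then th p else 0)); last first.
  by move=> p _; rewrite inE; case: ifP; case: (_ %| _)%N; rewrite ?mul0r ?mulr1 ?mulr0.
rewrite -(big_mkord xpredT (fun p => if (prime p && (A < p%:R)) && (p %| d)%N then th p else 0)).
rewrite -big_mkcond -[LHS]big_filter -[RHS]big_filter; apply: perm_big; apply: uniq_perm.
- by rewrite filter_uniq// primes_uniq.
- by rewrite filter_uniq// iota_uniq.
move=> p; rewrite !mem_filter mem_primes d0 mem_index_iota /=.
by case: (p < N)%N; case: (A < _); case: (prime p); case: (_ %| _)%N.
Qed.

(** The product of [c] distinct prime divisors above [y] is at most [d], so [y ^+ c <= F]. Taking
    logarithms with [ln y = psi * ln F] and [ln F > 0] bounds [c]. *)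
Lemma large_primes_count (R : realType) (F psi y : R) (d : nat) :
  y = F `^ psi -> 1 < y -> 0 < psi -> (0 < d)%N -> d%:R <= F ->
  (count (fun p => Num.truncn y < p)%N (primes d))%:R <= psi^-1.
Proof.
move=> yE y1 psi0 d0 dF; set c := count _ _.
have F0 : 0 < F by apply: lt_le_trans dF; rewrite ltr0n.
have lny : ln y = psi * ln F by rewrite yE ln_powR.
have lny0 : 0 < ln y by rewrite ln_gt0.
have lnF0 : 0 < ln F by move: lny0; rewrite lny pmulr_rgt0.
pose r := [seq p <- primes d | (Num.truncn y < p)%N].
have rp : all prime r by apply/allP => p; rewrite mem_filter mem_primes => /and4P[].
have ru : uniq r by rewrite filter_uniq// primes_uniq.
have rd : (\prod_(p <- r) p <= d)%N.
  apply: dvdn_leq => //; rewrite prod_primes_dvd//; apply/allP => p.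
  by rewrite mem_filter mem_primes => /and4P[].
have yr : y ^+ c <= (\prod_(p <- r) p)%:R.
  rewrite natr_prod /c -size_filter -/r.
  have : all (fun p => Num.truncn y < p)%N r by apply/allP => p; rewrite mem_filter => /andP[].
  elim: r {rp ru rd} => [|p r IH] /=; first by rewrite big_nil expr0.
  move=> /andP[yp /IH ih]; rewrite big_cons exprS; have y0 := ltW (lt_trans ltr01 y1).
  apply: ler_pM => //; first exact: exprn_ge0.
  by have := yp; rewrite truncn_lt_nat // => /ltW.
have yF : y ^+ c <= F by apply: le_trans dF; apply: le_trans yr _; rewrite ler_nat.
have y0 : 0 < y by apply: lt_trans y1.
have : ln (y ^+ c) <= ln F by rewrite ler_ln ?posrE ?exprn_gt0.
rewrite lnXn// -[X in _ <= X]mul1r lny -mulrnAl ler_pM2r// -mulr_natl.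
by rewrite -ler_pdivlMr// div1r.
Qed.

Lemma small_primes_count (R : realType) (A : R) (d : nat) :
  (count (fun p => ~~ (A < p%:R)%R) (primes d) <= (Num.truncn A).+1)%N.
Proof.
rewrite -size_filter -[leqRHS](size_iota 0); apply: uniq_leq_size.
  by rewrite filter_uniq// primes_uniq.
move=> p; rewrite mem_filter -leNgt => /andP[pA _]; rewrite mem_iota /= add0n ltnS.
by rewrite truncn_ge_nat// (le_trans _ pA).
Qed.

Lemma sieved_sum_bound (R : realType) (A F psi y Theta : R) (th : nat -> R) (d : nat) :
  y = F `^ psi -> 1 < y -> 0 < psi -> (0 < d)%N -> d%:R <= F ->
  0 <= Theta -> (forall p, prime p -> `|th p| <= Theta) ->
  `|\sum_(p <- primes d) th p -
    \sum_(p < (Num.truncn y).+1) (if p \in good_primes A (Num.truncn y).+1 then th p else 0) * (p %| d)%:R|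
  <= Theta * ((Num.truncn A).+1%:R + psi^-1).
Proof.
move=> yE y1 psi0 d0 dF T0 thb.
rewrite (@primes_sum_split R A (Num.truncn y).+1 th d d0) addrC addKr.
rewrite (le_trans (ler_norm_sum _ _ _))//.
apply: (@le_trans _ _ (\sum_(p <- primes d | ~~ ((p < (Num.truncn y).+1)%N && (A < p%:R))) Theta)).
  by rewrite big_seq_cond [leRHS]big_seq_cond; apply: ler_sum => p /andP[]; rewrite mem_primes => /and3P[/thb].
rewrite big_const_seq iter_addr addr0 -[leLHS]mulr_natr ler_wpM2l//.
have c1 := small_primes_count A d; have c2 := large_primes_count yE y1 psi0 d0 dF.
apply: (@le_trans _ _ ((count (fun p => ~~ (A < p%:R)) (primes d))%:R +
   (count (fun p => Num.truncn y < p)%N (primes d))%:R)); last by rewrite lerD// ler_nat.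
rewrite -natrD ler_nat -count_predUI (leq_trans _ (leq_addr _ _))//.
by apply: sub_count => p /=; rewrite negb_and -leqNgt orbC.
Qed.

(** The difference is exactly [(W * (1 - v) + (S - S') / V' - u) / v]. The first term needs the
    bound on [W], and [v >= 1 / 2] accounts for the factor 2. *)
Lemma normalized_close (R : realType) (S S' mu mu' V V' L eta th : R) :
  0 < V -> 0 < eta -> eta <= 1 / 2 -> `|(S' - mu') / V'| <= L ->
  0 < V' -> `|(mu - mu') / V'| <= eta -> `|V / V' - 1| <= eta -> `|S - S'| / V' <= eta ->
  `|(S - mu) / V - (S' - mu') / V'| <= 2 * (L * eta + 2 * eta).
Proof.
move=> V0 e0 e1 WL V'0 Hu Hv Hr.
set W := (S' - mu') / V' in WL *; set u := (mu - mu') / V' in Hu; set v := V / V' in Hv.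
have v12 : 1 / 2 <= v by move: Hv; rewrite ler_norml => /andP[? ?]; lra.
have v0 : 0 < v by lra.
have -> : (S - mu) / V - W = (W * (1 - v) + (S - S') / V' - u) / v.
  by rewrite /W /u /v; field; rewrite !gt_eqF.
rewrite normrM normfV (gtr0_norm v0) ler_pdivrMr//.
apply: (@le_trans _ _ (L * eta + 2 * eta)).
  rewrite (le_trans (ler_normB _ _))// (_ : L * eta + 2 * eta = L * eta + eta + eta); last by ring.
  rewrite lerD// (le_trans (ler_normD _ _))// lerD//.
    by rewrite normrM ler_pM// distrC.
  by rewrite normrM normfV (gtr0_norm V'0).
have L0 : 0 <= L by apply: le_trans WL.
have X0 : 0 <= L * eta + 2 * eta by rewrite addr_ge0 ?mulr_ge0 ?(ltW e0).
rewrite -mulrA mulrCA -[leLHS]mulr1 ler_wpM2l//; lra.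
Qed.

Lemma Rintegral_dirac (R : realType) (c : R) (f : R -> R) : continuous f ->
  \int[@dirac _ (borel R) c R]_x f x = f c.
Proof.
move=> cf; rewrite /Rintegral integral_dirac//; last first.
  by apply/measurable_EFinP; exact: measurable_fun_continuous.
by rewrite diracT mul1e.
Qed.

(** * The limit law *)

Section main.
Variables (R : realType) (n : nat) (n_gt0 : (0 < n)%N) (Omega : choiceType).
Variables (M : R -> R) (M_ge0 : forall B, 1 <= B -> 0 <= M B).
Variables (chi : R -> Omega -> R) (chi_ge0 : forall B a, 1 <= B -> 0 <= chi B a).
Hypothesis chi_finite : forall B, 1 <= B -> finite_set [set a | 0 < chi B a].
Hypothesis chi_infty : total chi B @[B --> +oo] --> +oo.
Hypothesis chi_M : total chi B / M B @[B --> +oo] --> (1 : R).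
Variables (m : Omega -> {ffun 'I_n -> nat}) (m_pos : forall a, pos_vec (m a)).
Variables (A : R) (g : {ffun 'I_n -> nat} -> R).
Hypothesis g_lim : forall d, pos_vec d -> primes_above A d ->
  mass chi m d B / M B @[B --> +oo] --> g d.
Hypothesis g_zero : forall d, pos_vec d -> ~ primes_above A d -> g d = 0.
Hypothesis g_mult : multiplicative_vec g.
Variables (theta : 'I_n -> nat -> R) (Theta : R).
Hypothesis theta_bound : forall i p, prime p -> `|theta i p| <= Theta.
Hypothesis stdev_infty : forall i, stdev theta g i T @[T --> +oo] --> +oo.
Variables F psi : R -> R.
Hypothesis trunc : truncation_pair M chi m A g theta Theta F psi.
Variable Sigma : 'M[R]_n.
Hypothesis Sigma_lim : forall i j, correlation theta g i j T @[T --> +oo] --> Sigma i j.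
Variable q : nat -> {set 'I_n} -> R.
Hypothesis q_law : local_law g A q.

(* The truncation level y of the paper. *)
Definition level B := F B `^ psi B.
Local Notation y := level.
Definition trunc_stat (B : R) (a : Omega) : 'rV[R]_n :=
  @statistic R n A g theta (y B) (divisor_pattern (y B) (m a)).
Definition actual (B : R) (h : 'rV[R]_n -> R) : R := expect chi B (fun a => h (trunc_stat B a)).
Definition model (B : R) (h : 'rV[R]_n -> R) : R :=
  pexp (fun p : 'I_(Num.truncn (y B)).+1 => q p) (fun w => h (@statistic R n A g theta (y B) w)).

Lemma Theta_ge0 : 0 <= Theta.
Proof. by apply: le_trans (theta_bound (Ordinal n_gt0) (_ : prime 2)). Qed.

Lemma g_onesE : g (ones n) = 1.
Proof. exact: (g_ones g_lim chi_M). Qed.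

Lemma g_nonneg d : pos_vec d -> 0 <= g d.
Proof. exact: (g_ge0 M_ge0 chi_ge0 g_lim). Qed.

Lemma level_infty : y B @[B --> +oo] --> +oo.
Proof. exact: (trunc_level trunc). Qed.

Lemma stdev_level i : stdev theta g i (y B) @[B --> +oo] --> +oo.
Proof. exact: (cvg_comp level (stdev theta g i) level_infty (stdev_infty i)). Qed.

Lemma correlation_level i j : correlation theta g i j (y B) @[B --> +oo] --> Sigma i j.
Proof.
have H := (@cvg_comp R R R level (correlation theta g i j) +oo +oo (nbhs (Sigma i j)) level_infty).
by apply: H; exact: Sigma_lim.
Qed.

Lemma near_stdev (K : R) : \forall B \near +oo, forall i, K <= stdev theta g i (y B).
Proof.
by apply: filter_forall => i; have /cvgryPge := stdev_level i; exact.
Qed.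

Lemma near_stdev_gt0 : \forall B \near +oo, forall i, 0 < stdev theta g i (y B).
Proof. by apply: filterS (near_stdev 1) => B H i; apply: lt_le_trans (H i). Qed.

Lemma near_ge1 : \forall B \near +oo, (1 : R) <= B.
Proof. exact: nbhs_pinfty_ge. Qed.

Lemma near_total : \forall B \near +oo, 0 < total chi B.
Proof.
have /cvgryPge/(_ 1) := chi_infty.
by apply: filterS => B; exact: lt_le_trans.
Qed.

Lemma avg_actual : \forall B \near +oo, avg (actual B).
Proof.
near=> B; apply: avg_comp; apply: (expect_avg chi_ge0 chi_finite).
  by near: B; exact: near_ge1.
by near: B; exact: near_total.
Unshelve. all: by end_near. Qed.

Lemma avg_model B : avg (model B).
Proof. by apply: avg_comp; apply: pexp_avg; exact: q_pmfs q_law _. Qed.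

(** The multiplicities are all positive, as condition (v) demands. That condition divides by [M B],
    the moment bound by the total mass, and their quotient tends to 1. *)
Lemma word_diff (s : seq 'I_n) : (forall i, i \in s) ->
  actual B (word s) - model B (word s) @[B --> +oo] --> (0 : R).
Proof.
move=> sfull; pose k i := count_mem i s.
have k0 i : (0 < k i)%N by rewrite /k -has_count has_pred1.
have /= Hr := trunc_remainder trunc k0.
set X := (fun B => _) in Hr.
have Hb : (size s)%:R ^+ size s * (X B * (total chi B / M B)^-1) @[B --> +oo] --> (0 : R).
  have -> : (0 : R) = (size s)%:R ^+ size s * (0 * 1^-1) by rewrite mul0r mulr0.
  apply: cvgM; first exact: cvg_cst.
  by apply: cvgM => //; apply: cvgV => //; exact: oner_neq0.
apply/cvgr0Pnorm_le => e e0; move/cvgr0Pnorm_le: Hb => /(_ e e0) Hb.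
near=> B.
have B1 : 1 <= B by near: B; exact: near_ge1.
have t0 : 0 < total chi B by near: B; exact: near_total.
have V0 : forall i, 0 < stdev theta g i (y B) by near: B; exact: near_stdev_gt0.
have Mn0 : M B != 0.
  have h : total chi B / M B != 0.
    by near: B; have /cvgr_neq0 := chi_M; apply; exact: oner_neq0.
  by apply: contraNneq h => ->; rewrite invr0 mulr0.
have M0 : 0 < M B by rewrite lt_neqAle eq_sym Mn0 M_ge0.
have y0 : 0 <= y B by exact: powR_ge0.
have hB : `|(size s)%:R ^+ size s * (X B * (total chi B / M B)^-1)| <= e by near: B.
apply: le_trans hB; apply: le_trans (ler_norm _).
have := @moment_diff R Omega n M chi chi_ge0 chi_finite m A g g_onesE g_nonneg g_mult theta Theta Theta_ge0
  theta_bound q q_law B (y B) s B1 t0 y0 V0.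
move/le_trans; apply; rewrite le_eqVlt; apply/orP; left; apply/eqP.
have : \prod_i stdev theta g i (y B) ^+ count_mem i s != 0.
  by rewrite gt_eqF// prodr_gt0// => i _; rewrite exprn_gt0.
move=> Qn0; congr (_ * _); rewrite /X /k -/(y B); move: Qn0.
set Q := \prod_i stdev _ _ _ _ ^+ _; set P := \prod_i _; set S := \sum_(d \in _) _.
by move: (gt_eqF t0) => /negbT T0 Q0; field; rewrite Q0 T0 Mn0.
Unshelve. all: by end_near. Qed.

(** The deviations tend to infinity, so eventually [|l| * Theta] is at most half of each and the
    bound for small summands applies, with a constant free of [B]. *)
Lemma model_exp (l : R) : exists C, \forall B \near +oo, forall i,
  model B (fun x => expR (l * x 0 i) + expR (- (l * x 0 i))) <= C.
Proof.
exists (expR (2 * l ^+ 2) + expR (2 * l ^+ 2)); near=> B => i.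
have V0 : forall i, 0 < stdev theta g i (y B) by near: B; exact: near_stdev_gt0.
have KV : 2 * `|l| * Theta <= stdev theta g i (y B).
  by move: i; near: B; exact: near_stdev.
have hl : `|l| * (Theta / stdev theta g i (y B)) <= 1 / 2.
  by rewrite mulrA ler_pdivrMr//; lra.
rewrite (avgD (avg_model B)) lerD//.
  exact: (statistic_exp g_zero Theta_ge0 theta_bound q_law V0 hl).
have -> : l ^+ 2 = (- l) ^+ 2 by rewrite sqrrN.
have -> : (fun x : 'rV[R]_n => expR (- (l * x 0 i))) = (fun x => expR (- l * x 0 i)).
  by apply/funext => x; rewrite mulNr.
by apply: (statistic_exp g_zero Theta_ge0 theta_bound q_law V0); rewrite normrN.
Unshelve. all: by end_near. Qed.

Lemma quad_level (t : 'rV[R]_n) : quad g theta (y B) t @[B --> +oo] --> (t *m Sigma *m t^T) 0 0.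
Proof.
have -> : (t *m Sigma *m t^T) 0 0 = \sum_i \sum_j t 0 i * t 0 j * Sigma i j.
  rewrite mxE; under eq_bigr do rewrite mxE mulr_suml.
  rewrite exchange_big; apply: eq_bigr => i _; apply: eq_bigr => j _ /=.
  by rewrite mxE; ring.
rewrite /quad; apply: cvg_bigsum => i _; apply: cvg_bigsum => j _.
by apply: cvgM; [exact: cvg_cst|exact: correlation_level].
Qed.

Lemma Sigma_psd : psd Sigma.
Proof.
split.
  apply/matrixP => i j; rewrite mxE; apply: (@cvg_unique _ (@Rhausdorff R) (correlation theta g j i T @[T --> +oo])); first exact: Sigma_lim.
  have -> : correlation theta g j i = correlation theta g i j; last exact: Sigma_lim.
  apply/funext => T; rewrite /correlation [_ * stdev _ _ _ _]mulrC; congr (_ / _).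
  by apply: eq_bigr => p _; rewrite [theta j p * _]mulrC finset.setUC [g_at _ [set j] p * _]mulrC.
move=> c; apply: (cvgr_to_ge (quad_level (t := c))); near=> B.
have V0 : forall i, 0 < stdev theta g i (y B) by near: B; exact: near_stdev_gt0.
by apply: (quad_ge0 g_zero _ q_law).
Unshelve. all: by end_near. Qed.

Lemma Sigma_diag i : Sigma i i = 1.
Proof.
apply: (@cvg_unique _ (@Rhausdorff R) (correlation theta g i i (y B) @[B --> +oo])); first exact: correlation_level.
apply: (@cvg_trans _ ((fun=> 1 : R) @ +oo)); last exact: cvg_cst.
apply: near_eq_cvg; near=> B; rewrite (correlation_diag g_zero q_law)//.
near: B; exact: near_stdev_gt0.
Unshelve. all: by end_near. Qed.

Lemma model_chf (t : 'rV[R]_n) :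
  model B (fun x => cos (dot t x)) @[B --> +oo] --> expR (- ((t *m Sigma *m t^T) 0 0 / 2)) /\
  model B (fun x => sin (dot t x)) @[B --> +oo] --> (0 : R).
Proof.
pose d B := \sum_i `|t 0 i| * (Theta / stdev theta g i (y B)).
have d0 : d B @[B --> +oo] --> (0 : R).
  have -> : (0 : R) = \sum_(i < n) `|t 0 i| * (Theta * 0) by rewrite big1// => i _; rewrite !mulr0.
  apply: cvg_bigsum => i _; apply: cvgM; first exact: cvg_cst.
  apply: cvgM; first exact: cvg_cst.
  apply: (gtr0_cvgV0 _).2; last exact: stdev_level.
  by apply: filterS near_stdev_gt0 => B; exact.
have e0 : expR (d B * quad g theta (y B) t) - 1 @[B --> +oo] --> (0 : R).
  have -> : (0 : R) = expR (0 * (t *m Sigma *m t^T) 0 0) - 1 by rewrite mul0r expR0 subrr.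
  apply: cvgB; last exact: cvg_cst.
  apply: (cvg_comp (fun B => d B * quad g theta (y B) t) expR); last exact: continuous_expR.
  by apply: cvgM => //; exact: quad_level.
have key : \forall B \near +oo,
  `|model B (fun x => cos (dot t x)) - expR (- (quad g theta (y B) t / 2))| <= expR (d B * quad g theta (y B) t) - 1 /\
  `|model B (fun x => sin (dot t x))| <= expR (d B * quad g theta (y B) t) - 1.
  near=> B; apply: (statistic_chf g_zero Theta_ge0 theta_bound q_law).
    near: B; exact: near_stdev_gt0.
  by near: B; move/cvgr_le: d0; apply.
split.
  have h1 : model B (fun x => cos (dot t x)) - expR (- (quad g theta (y B) t / 2)) @[B --> +oo] --> (0 : R).
    apply/cvgr0Pnorm_le => e e_gt; move/cvgr0Pnorm_le: e0 => /(_ e e_gt); near_simpl.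
    by move=> he; apply: filterS2 key he => B [k1 _] hB; apply: le_trans k1 (le_trans (ler_norm _) hB).
  have : model B (fun x => cos (dot t x)) - expR (- (quad g theta (y B) t / 2)) +
     expR (- (quad g theta (y B) t / 2)) @[B --> +oo] --> 0 + expR (- ((t *m Sigma *m t^T) 0 0 / 2)).
    apply: cvgD => //.
    apply: (cvg_comp (fun B => - (quad g theta (y B) t / 2)) expR); last exact: continuous_expR.
    by apply: cvgN; apply: cvgM; [exact: quad_level|exact: cvg_cst].
  by rewrite add0r; under eq_fun do rewrite subrK.
apply/cvgr0Pnorm_le => e e_gt; move/cvgr0Pnorm_le: e0 => /(_ e e_gt); near_simpl.
by move=> he; apply: filterS2 key he => B [_ k2] hB; apply: le_trans k2 (le_trans (ler_norm _) hB).
Unshelve. all: by end_near. Qed.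

Lemma model_var : \forall B \near +oo, forall i, model B (fun x => x 0 i ^+ 2) <= 1.
Proof.
near=> B => i.
have V0 : forall i, 0 < stdev theta g i (y B) by near: B; exact: near_stdev_gt0.
rewrite -(correlation_diag g_zero q_law V0 i) -(statistic_cov g_zero theta q_law).
exact: lexx.
Unshelve. all: by end_near. Qed.

(** * Passage from the model to the vector [K] *)

Section limit.
Variable mu : probability (borel 'rV[R]_n) R.
Hypothesis mu_law : forall (c : 'rV[R]_n) (S : set R), measurable S ->
  mu [set x | S (dot c x)] = normal_law 0 (Num.sqrt ((c *m Sigma *m c^T) 0 0)) S.

Lemma model_cvg f : bcont f -> model B f @[B --> +oo] --> \int[mu]_x f x.
Proof.
apply: (gaussian_cvg _ Sigma_psd mu_law).
- by apply: nearW => B; exact: avg_model.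
- exact: model_var.
- exact: Sigma_diag.
- by move=> t; exact: (model_chf t).1.
- by move=> t; exact: (model_chf t).2.
Qed.

Lemma actual_cvg f : bcont f -> actual B f @[B --> +oo] --> \int[mu]_x f x.
Proof.
apply: (@remove_weight R n R _ _ actual model (fun f => \int[mu]_x f x)).
- exact: avg_actual.
- exact: posfun_integral.
- by rewrite Rintegral_cst_prob.
- exact: model_cvg.
- move=> h; apply: moment_compare => //.
  + by apply: filterS avg_actual => B aB; split => //; exact: avg_model.
  + exact: word_diff.
  + exact: model_exp.
- by apply: damp_small => i h h0; apply: (gaussian_small_ball mu_law h0); exact: Sigma_diag.
Qed.

(** The clipped distance is a bounded continuous test function vanishing at [c]. Convergence in
    distribution to a constant thus becomes a vanishing expectation, ready for Markov's
    inequality. *)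
Lemma clip_cvg (X : R -> Omega -> R) c : cvg_in_distribution_cst chi X c ->
  expect chi B (fun a => Num.min 1 `|X B a - c|) @[B --> +oo] --> (0 : R).
Proof.
have cc : continuous (fun x : R => Num.min 1 `|x - c| : R).
  move=> x; apply: (@continuous_min R _ (cst 1) (fun x : R => `|x - c|) x).
    exact: cst_continuous.
  by apply: cvg_norm; apply: cvgB; [exact: cvg_id|exact: cvg_cst].
move=> /(_ _ cc); rewrite (Rintegral_dirac _ cc) subrr normr0 (min_idPr _) ?ler01//; apply.
by exists 1 => x; rewrite ger0_norm ?le_min ?ler01 ?normr_ge0//= ge_min lexx.
Qed.

Lemma actual_close (L d : R) : 0 < L -> 0 < d -> exists r : R -> Omega -> R,
  expect chi B (r B) @[B --> +oo] --> (0 : R) /\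
  \forall B \near +oo, forall a, 0 <= r B a /\
    ((forall i, `|trunc_stat B a 0 i| <= L) ->
     (exists i, d < `|K m theta g a 0 i - trunc_stat B a 0 i|) -> 1 <= r B a).
Proof.
move=> L0 d0.
have L2 : 0 < 2 * (L + 2) by rewrite mulr_gt0// addr_gt0.
(* The second term makes the bound of [normalized_close] at most [d]. The first keeps the deviation
   ratio above [1 / 2] and lies below the clipping level 1. *)
pose eta := Num.min (1 / 2) (d / (2 * (L + 2))).
have eta0 : 0 < eta by rewrite lt_min divr_gt0// divr_gt0.
have eta12 : eta <= 1 / 2 by rewrite ge_min lexx.
have etad : 2 * (L * eta + 2 * eta) <= d.
  have : eta <= d / (2 * (L + 2)) by rewrite ge_min lexx orbT.
  by rewrite ler_pdivlMr// => h; apply: le_trans h; rewrite le_eqVlt; apply/orP; left; apply/eqP; ring.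
pose u i B a := (mean theta g i (m a i)%:R - mean theta g i (y B)) / stdev theta g i (y B).
pose v i B a := stdev theta g i (m a i)%:R / stdev theta g i (y B).
pose bdd B := [set a | forall i, (m a i)%:R <= F B].
(* Markov's inequality as a function: [r] reaches 1 as soon as some [m_i] exceeds [F B] or the
   clipped errors add up to [eta]. *)
pose r B a := (1 - (a \in bdd B)%:R) +
  eta^-1 * (\sum_i (Num.min 1 `|u i B a - 0| + Num.min 1 `|v i B a - 1|)).
have min0 (x : R) : 0 <= Num.min 1 `|x| by rewrite le_min ler01 normr_ge0.
exists r; split.
  have hb : 1 - prob chi B (bdd B) @[B --> +oo] --> (1 - 1 : R).
    by apply: cvgB; [exact: cvg_cst|exact: (trunc_bounded trunc)].
  have hs : \sum_i (expect chi B (fun a => Num.min 1 `|u i B a - 0|) +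
      expect chi B (fun a => Num.min 1 `|v i B a - 1|)) @[B --> +oo] --> \sum_(i < n) (0 + 0 : R).
    apply: cvg_bigsum => i _; apply: cvgD; apply: clip_cvg.
      exact: (trunc_mean trunc).
    exact: (trunc_stdev_ratio trunc).
  have -> : (0 : R) = 1 - 1 + eta^-1 * \sum_(i < n) (0 + 0).
    by rewrite subrr big1 ?mulr0 ?addr0// => i _; rewrite addr0.
  have : 1 - prob chi B (bdd B) + eta^-1 * (\sum_i (expect chi B (fun a => Num.min 1 `|u i B a - 0|) +
      expect chi B (fun a => Num.min 1 `|v i B a - 1|))) @[B --> +oo] --> 1 - 1 + eta^-1 * \sum_(i < n) (0 + 0 : R).
    by apply: cvgD => //; apply: cvgM => //; exact: cvg_cst.
  apply: cvg_trans; apply: near_eq_cvg; near=> B.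
  have aE : avg (expect chi B).
    apply: (expect_avg chi_ge0 chi_finite); near: B; [exact: near_ge1|exact: near_total].
  rewrite /r (avgD aE) (avgB aE) (avg_cst aE) prob_expect (avgZ aE) (avg_sum aE).
  by congr (_ + _ * _); apply: eq_bigr => i _; rewrite (avgD aE).
(* The discarded primes number at most a constant plus [1 / psi B]; divided by the deviation both
   parts vanish, the second by condition (iii). *)
have Nr : \forall B \near +oo, forall i, Theta * ((Num.truncn A).+1%:R + (psi B)^-1) / stdev theta g i (y B) <= eta.
  apply: filter_forall => i.
  have h : Theta * ((Num.truncn A).+1%:R * (stdev theta g i (y B))^-1 + 1 / (psi B * stdev theta g i (y B)))
     @[B --> +oo] --> Theta * ((Num.truncn A).+1%:R * 0 + 0).
    apply: cvgM; first exact: cvg_cst.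
    apply: cvgD; last exact: (trunc_stdev trunc).
    apply: cvgM; first exact: cvg_cst.
    apply: (gtr0_cvgV0 _).2; last exact: stdev_level.
    by apply: filterS near_stdev_gt0 => B; exact.
  rewrite mulr0 addr0 mulr0 in h.
  apply: filterS (cvgr_le _ h _ eta0) => B; apply: le_trans; rewrite le_eqVlt; apply/orP; left; apply/eqP.
  by rewrite mul1r invfM; ring.
near=> B => a.
have V0 : forall i, 0 < stdev theta g i (y B) by near: B; exact: near_stdev_gt0.
have y1 : 1 < y B by near: B; have /cvgryPgt := level_infty; apply.
have rem : forall i, Theta * ((Num.truncn A).+1%:R + (psi B)^-1) / stdev theta g i (y B) <= eta by near: B.
have /andP[psi0 psi1] := trunc_psi trunc B.
have b0 : 0 <= 1 - (a \in bdd B)%:R :> R by rewrite subr_ge0; case: (a \in bdd B).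
have s0 : 0 <= \sum_i (Num.min 1 `|u i B a - 0| + Num.min 1 `|v i B a - 1|).
  by apply: sumr_ge0 => i _; rewrite addr_ge0.
have es0 : 0 <= eta^-1 * (\sum_i (Num.min 1 `|u i B a - 0| + Num.min 1 `|v i B a - 1|)).
  by rewrite mulr_ge0// invr_ge0 ltW.
split; first by rewrite /r addr_ge0.
move=> WL [i di]; rewrite leNgt; apply/negP => r1; move: di; apply/negP; rewrite -leNgt.
have ab : a \in bdd B.
  apply: contraLR r1 => /negbTE ab; rewrite -leNgt /r ab subr0 lerDl //.
have mF : (m a i)%:R <= F B by move: ab; rewrite inE; apply.
have /andP[ui vi] : (`|u i B a - 0| <= eta) && (`|v i B a - 1| <= eta).
  have : \sum_i (Num.min 1 `|u i B a - 0| + Num.min 1 `|v i B a - 1|) < eta.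
    move: r1; rewrite /r ab subrr add0r mulrC ltr_pdivrMr// mul1r //.
  rewrite (bigD1 i)//= => h.
  have rest : 0 <= \sum_(j < n | j != i) (Num.min 1 `|u j B a - 0| + Num.min 1 `|v j B a - 1|).
    by apply: sumr_ge0 => j _; rewrite addr_ge0.
  have lt1 (x : R) : Num.min 1 `|x| < eta -> `|x| <= eta.
    rewrite gt_min => /orP[h1|/ltW//]; exfalso; move: h1 eta12; lra.
  have mu0 := min0 (u i B a - 0); have mv0 := min0 (v i B a - 1).
  by apply/andP; split; apply: lt1; lra.
have mi0 : (0 < m a i)%N := m_pos a i.
(* The ratio is at least [1 / 2], so the deviation at [m a i] is positive and the conventional entry
   1 of [K] does not occur. *)
have Vm : 0 < stdev theta g i (m a i)%:R.
  have : 1 / 2 <= v i B a by move: vi; rewrite ler_norml => /andP[? ?]; lra.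
  rewrite /v ler_pdivlMr// => h; apply: lt_le_trans h; rewrite mulr_gt0//.
have WLi := WL i.
rewrite !mxE gt_eqF// in WLi *.
apply: le_trans etad; apply: normalized_close => //.
- by move: ui; rewrite subr0.
have sb := @sieved_sum_bound R A (F B) (psi B) (y B) Theta (theta i) (m a i) erefl y1 psi0 mi0 mF Theta_ge0 (@theta_bound i).
apply: le_trans (rem i); rewrite ler_wpM2r ?invr_ge0 ?(ltW (V0 i))//.
apply: le_trans sb; rewrite le_eqVlt; apply/orP; left; apply/eqP; congr (`|_ - _|).
by apply: eq_bigr => p _; rewrite ffunE inE.
Unshelve. all: by end_near. Qed.

Lemma K_cvg : cvg_in_distribution chi (fun _ : R => K m theta g) mu.
Proof.
move=> f cf bf.
apply: (@slutsky R n R Omega _ _ (expect chi) (fun _ : R => K m theta g) trunc_stat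
   (fun f => \int[mu]_x f x) (\sum_i Sigma i i)) => //.
- near=> B; apply: (expect_avg chi_ge0 chi_finite); near: B; [exact: near_ge1|exact: near_total].
- by move=> L L0; exact: (gaussian_tail Sigma_psd mu_law L0).
- exact: actual_cvg.
- exact: actual_close.
Unshelve. all: by end_near. Qed.

End limit.
End main.

Theorem theorem2p5 (R : realType) (n : nat) (n_gt0 : (0 < n)%N)
  (Omega : choiceType) (Omega_infinite : infinite_set [set: Omega])
  (M : R -> R) (M_ge0 : forall B, 1 <= B -> 0 <= M B)
  (chi : R -> Omega -> R)
  (chi_ge0 : forall B a, 1 <= B -> 0 <= chi B a)
  (chi_finite : forall B, 1 <= B -> finite_set [set a | 0 < chi B a])
  (chi_infty : \sum_(a \in [set: Omega]) chi B a @[B --> +oo] --> +oo)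
  (chi_M : (\sum_(a \in [set: Omega]) chi B a) / M B @[B --> +oo] --> (1 : R))
  (m : Omega -> {ffun 'I_n -> nat}) (m_pos : forall a, pos_vec (m a))
  (A : R) (g : {ffun 'I_n -> nat} -> R)
  (g_lim : forall d, pos_vec d -> primes_above A d ->
     mass chi m d B / M B @[B --> +oo] --> g d)
  (g_zero : forall d, pos_vec d -> ~ primes_above A d -> g d = 0)
  (g_mult : multiplicative_vec g)
  (theta : 'I_n -> nat -> R) (Theta : R)
  (theta_bound : forall i p, prime p -> `|theta i p| <= Theta)
  (stdev_infty : forall i, stdev theta g i T @[T --> +oo] --> +oo)
  (trunc : exists F psi : R -> R,
     truncation_pair M chi m A g theta Theta F psi)
  (Sigma : 'M[R]_n)
  (Sigma_lim : forall i j,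
     correlation theta g i j T @[T --> +oo] --> Sigma i j) :
  exists mu : probability (borel 'rV[R]_n) R,
    central_multivariate_normal Sigma mu /\
    cvg_in_distribution chi (fun _ : R => K m theta g) mu.
Proof.
have [F [psi tr]] := trunc.
have [q q_law] : exists q, local_law g A q.
  exact: (local_law_exists M_ge0 chi_ge0 chi_finite g_lim chi_M).
have Spsd : psd Sigma.
  exact: (Sigma_psd g_zero stdev_infty tr Sigma_lim q_law).
have [mu law] := gaussian_law_exists Spsd.
exists mu; split; first exact: (gaussian_central Spsd law).
exact: (K_cvg n_gt0 M_ge0 chi_ge0 chi_finite chi_infty chi_M m_pos g_lim g_zero
  g_mult theta_bound stdev_infty tr Sigma_lim q_law law).
Qed.
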